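(* Let $w_1,\dots,w_{|\mathrm{NC}_n|}$ be any total ordering of $\mathrm{NC}_n$ extending the Bruhat order, and let $X_0=\emptyset$ and $X_k=\bigcup_{i=1}^kM_{\mathrm{NC}}(w_i)B\subset\mathrm{Fl}_n$. Then $\emptyset=X_0\subset X_1\subset\cdots\subset X_{|\mathrm{NC}_n|}=\mathrm{QFl}_n$ is a good affine paving of $\mathrm{QFl}_n$, and its GKM graph is obtained from $\mathrm{Cayley}(\mathrm{NC}_n)$ by labeling each edge joining $w$ to $(i\,j)w$ by $t_j-t_i$.
   Context: Work over $\mathbb{C}$. $\mathrm{Fl}_m=\mathrm{GL}_m/B_m$ ($B=B_m$ upper triangular) is the complete flag variety, $hB$ corresponding to the flag whose $j$th subspace is the span of the first $j$ columns of $h$; $T=T_n$ is the diagonal torus acting by left multiplication, $\chi_i$ its $i$th coordinate character. A permutation $w$ is identified with the matrix with $1$'s in positions $(w(j),j)$ and with the $T$-fixed point $wB$. $H^\bullet_{T}(\mathrm{pt})=\mathbb{Z}[t_1,\dots,t_n]$ with $t_i=-c_1^T(\mathbb{C}_{\chi_i})$, so that $-c_1^T$ of the character $\chi_1^{a_1}\cdots\chi_n^{a_n}$ is $a_1t_1+\cdots+a_nt_n$. Good affine paving: a filtration $\emptyset=X_0\subset X_1\subset\cdots\subset X_\ell=X$ of a $T$-variety by closed subvarieties such that for each $i\ge1$: (1) $X_i\setminus X_{i-1}$ contains a unique $T$-fixed point $p_i$ and is $T$-equivariantly isomorphic to a linear $T$-representation $V_i$; (2) $V_i=\bigoplus_{j\in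 A_i}V_{i,j}$ is a direct sum of one-dimensional $T$-representations with $A_i\subset\{1,\dots,i-1\}$, such that the closure $\overline{V_{i,j}}$ equals $V_{i,j}\cup\{p_j\}$ and is topologically $\mathbb{P}^1$; (3) for $f_{i,j}=-c_1^T(V_{i,j})$ one has $f_{i,j}\ne\pm f_{i,k}$ for $j\ne k$, and each $f_{i,j}=a_1t_1+\cdots+a_nt_n$ has $\gcd(a_1,\dots,a_n)=1$. Its GKM graph has vertex set $X^T=\{p_1,\dots,p_\ell\}$ and, for each $V_{i,j}$, an edge $p_ip_j$ labelled by $f_{i,j}$, labels being taken up to sign. Noncrossing partitions: $w\in S_n$ lies in $\mathrm{NC}_n$ if every cycle of $w$ has the form $(b_1\cdots b_r)$ with $b_1>\cdots>b_r$ and the underlying sets of its cycles (fixed points included) form a noncrossing set partition of $\{1,\dots,n\}$. $\mathrm{Cayley}(\mathrm{NC}_n)$ is the graph on $\mathrm{NC}_n$ in which $u,w$ are joined by an edge iff $w=(i\,j)u$ for some transposition $(i\,j)$ (it is also the Hasse diagram of $\mathrm{NC}_n$ under refinement, the Kreweras lattice). $\mathrm{Inv}(w)=\{(i,j): i<j, w(i)>w(j)\}$; $\mathrm{Inv}_{\mathrm{NC}}(w)=\{(i,j)\in\mathrm{Inv}(w): w(i\,j)\in\mathrm{NC}_n\}$. For $w\in\mathrm{NC}_n$, $M_{\mathrm{NC}}(w)$ is the set of matrices with $1$ in position $(w(i),i)$ for each $i$, arbitrary complex numbers in positions $(w(j),i)$ for $(i,j)\in\mathrm{Inv}_{\mathrm{NC}}(w)$,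 and $0$ elsewhere. Quasisymmetric flag variety: $e_1,\dots,e_m$ is the standard basis of $\mathbb{C}^m$ and $\epsilon_i:\mathbb{C}^{m-1}\to\mathbb{C}^m$ inserts a $0$ as the $i$th coordinate. For $Z\subset \mathrm{Fl}_{m-1}$, $1\le i\le m-1$, $\mathbb{P}_iZ\subset \mathrm{Fl}_m$ is the set of flags $\mathcal{G}$ for which there is $\mathcal{F}\in Z$ with $\mathcal{G}_j=\epsilon_i(\mathcal{F}_j)$ for $j<i$ and $\mathcal{G}_j=\epsilon_i(\mathcal{F}_{j-1})\oplus\langle e_i\rangle$ for $j>i$ ($\mathcal{G}_i$ arbitrary). $\mathrm{QFl}_n\subset\mathrm{Fl}_n$ is the union of $\mathbb{P}_{i_{n-1}}\cdots\mathbb{P}_{i_1}\mathrm{Fl}_1$ over all sequences $(i_1,\dots,i_{n-1})$ with $1\le i_j\le j$ (these sets are the varieties $X(T)$ indexed by planar binary trees $T$ with $n$ leaves). *)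

(* Defs.v *)
From HB Require Import structures.
From mathcomp Require mpoly.
Import -(notations) mpoly.
From mathcomp Require Import all_boot all_order all_algebra fingroup perm.
From mathcomp Require Import all_classical all_reals all_analysis.
From mathcomp Require Import complex generic_quotient.

Set Implicit Arguments.
Unset Strict Implicit.
Unset Printing Implicit Defensive.

Import Order.TTheory GRing.Theory Num.Theory.
Import numFieldNormedType.Exports.
Local Open Scope classical_set_scope.
Local Open Scope ring_scope.
Local Open Scope quotient_scope.

(* A variety is encoded as a Zariski topology together with its sheaf of regular
   functions, regarded as functions with values in the ground field: [regular U f]
   only depends on the restriction of [f] to the open set [U]. *)
Record funspace (K : fieldType) := FunSpace {
  carrier :> Type;
  zopen : set (set carrier);
  regular : set carrier -> set (carrier -> K) }.

Section FunSpaces.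
Context {K : fieldType}.

Definition zclosed (X : funspace K) (Z : set X) := zopen (~` Z).

Definition zclosure (X : funspace K) (A : set X) : set X :=
  \bigcap_(Z in [set Z | zclosed Z /\ A `<=` Z]) Z.

Definition morphism (X Y : funspace K) (f : X -> Y) :=
  forall V : set Y, zopen V ->
    zopen (f @^-1` V) /\
    forall r, regular V r -> regular (f @^-1` V) (r \o f).

Definition isomorphism (X Y : funspace K) (f : X -> Y) :=
  exists g : Y -> X, [/\ cancel f g, cancel g f, morphism f & morphism g].

Definition mxeval m n (p : mpoly (m * n) K) (A : 'M[K]_(m, n)) : K :=
  meval (fun k => mxvec A 0 k) p.

Definition affine_space m n : funspace K := {|
  carrier := 'M[K]_(m, n);
  zopen := [set U | exists S : set (mpoly (m * n) K),
              U = [set A | exists2 p, S p & mxeval p A != 0]];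
  regular := fun U => [set f | forall x, U x -> exists p q,
              mxeval q x != 0 /\
              forall y, U y -> mxeval q y != 0 -> f y = mxeval p y / mxeval q y] |}.

(* The structure induced along an injection [f : Y -> X]; for the inclusion of a
   locally closed subset this is the reduced subvariety structure. *)
Definition initial_fs (X : funspace K) (Y : Type) (f : Y -> X) : funspace K := {|
  carrier := Y;
  zopen := [set f @^-1` U | U in @zopen K X];
  regular := fun V => [set r | forall y, V y -> exists (U : set X) s,
              [/\ zopen U, regular U s, U (f y) &
                  forall y', V y' -> U (f y') -> r y' = s (f y')]] |}.

(* The quotient structure along a surjection [q : X -> Y]. *)
Definition final_fs (X : funspace K) (Y : Type) (q : X -> Y) : funspace K := {|
  carrier := Y;
  zopen := [set V | zopen (q @^-1` V)];
  regular := fun V => [set r : Y -> K | regular (q @^-1` V) (r \o q)] |}.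

End FunSpaces.

Section Flags.
Variable C : numClosedFieldType.

Definition GL n : set 'M[C]_n := [set g | g \in unitmx].
Arguments GL : clear implicits.

Definition GLmk n (g : 'M[C]_n) (gu : g \in unitmx) : GL n :=
  exist (fun h => h \in GL n) g (mem_set gu).

Lemma GLunit n (g : GL n) : \val g \in unitmx.
Proof. exact: (set_valP g). Qed.

Lemma GLmul_subproof n (g h : GL n) : \val g *m \val h \in unitmx.
Proof. by rewrite unitmx_mul !GLunit. Qed.

Definition GLmul n (g h : GL n) : GL n := GLmk (GLmul_subproof g h).

Definition upper_triangular n (b : 'M[C]_n) : bool := is_trig_mx b^T.

Definition eqmodB n (g h : GL n) : bool :=
  upper_triangular (invmx (\val g) *m \val h).

Lemma upper_triangularP n (b : 'M[C]_n) :
  reflect (forall i j : 'I_n, (i < j)%N -> b j i = 0) (upper_triangular b).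
Proof.
apply: (iffP is_trig_mxP) => H i j ij; first by rewrite -(H i j ij) mxE.
by rewrite mxE H.
Qed.

Lemma upper_triangular_mul n (a b : 'M[C]_n) :
  upper_triangular a -> upper_triangular b -> upper_triangular (a *m b).
Proof.
move=> /upper_triangularP ha /upper_triangularP hb.
apply/upper_triangularP => i j ij; rewrite mxE big1 // => k _.
case: (ltnP k j) => kj; first by rewrite ha ?mul0r.
by rewrite hb ?mulr0 // (leq_trans ij kj).
Qed.

Lemma upper_triangular_inv n (b : 'M[C]_n) :
  b \in unitmx -> upper_triangular b -> upper_triangular (invmx b).
Proof.
move=> bu bt; have := bu; rewrite unitmxE -det_tr (det_trig bt) unitfE.
rewrite prodf_seq_neq0 => /allP /= bd.
have {bt} /upper_triangularP bt := bt; apply/upper_triangularP => i j.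
have [m mj] := ubnP (n - j); elim: m => // m IH in j mj *; move=> ij.
have := mulmxV bu; move=> /matrixP /(_ j i); rewrite !mxE.
rewrite (_ : (j == i) = false); last by apply/negbTE; rewrite -val_eqE /= gtn_eqF.
rewrite (bigD1 j) //= big1 => [|k kj].
  rewrite addr0 => /eqP; rewrite mulf_eq0 => /orP[|/eqP //].
  by have := bd j (mem_index_enum _); rewrite mxE => /negbTE ->.
case: (ltngtP k j) => [kj'|jk|/val_inj kj']; first by rewrite bt ?mul0r.
  rewrite IH ?mulr0 //; last exact: ltn_trans ij jk.
  exact: leq_trans (ltn_sub2l (ltn_ord j) jk) mj.
by rewrite kj' eqxx in kj.
Qed.

Lemma eqmodB_refl n : reflexive (@eqmodB n).
Proof.
move=> g; rewrite /eqmodB mulVmx ?GLunit //; apply/upper_triangularP => i j ij.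
by rewrite mxE -val_eqE /= gtn_eqF.
Qed.

Lemma eqmodB_sym n : symmetric (@eqmodB n).
Proof.
have sym (g h : GL n) : eqmodB g h -> eqmodB h g.
  have ghu : invmx (\val g) *m \val h \in unitmx.
    by rewrite unitmx_mul unitmx_inv !GLunit.
  move=> /(upper_triangular_inv ghu); rewrite /eqmodB.
  congr (upper_triangular _); rewrite -[RHS](mulmxK ghu) -[LHS]mul1mx.
  congr (_ *m _); by rewrite mulmxA mulmxK ?GLunit // mulVmx ?GLunit.
by move=> g h; apply/idP/idP; exact: sym.
Qed.

Lemma eqmodB_trans n : transitive (@eqmodB n).
Proof.
move=> h g k gh hk; have := upper_triangular_mul gh hk.
by rewrite /eqmodB mulmxA mulmxK ?GLunit.
Qed.

Canonical eqmodB_equiv n :=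
  EquivRel (@eqmodB n) (@eqmodB_refl n) (@eqmodB_sym n) (@eqmodB_trans n).

(* As a topological type, [Fl n] carries the analytic topology. *)
Definition Fl n : Type := quotient_topology {eq_quot (@eqmodB n)}.
HB.instance Definition _ n :=
  Topological.copy (Fl n) (quotient_topology {eq_quot (@eqmodB n)}).
HB.instance Definition _ n :=
  Quotient.copy (Fl n) (quotient_topology {eq_quot (@eqmodB n)}).


Definition flag_of n (g : GL n) : Fl n := \pi_(Fl n) g.

Definition Fl_variety n : funspace C :=
  final_fs (X := initial_fs (X := affine_space n n) (@set_val _ (GL n)))
           (@flag_of n).

(* The [j]-th subspace of a flag, [0 <= j <= n]. *)
Definition flag_space n (F : Fl n) (j : nat) : {vspace 'cV[C]_n} :=
  <<[seq col k (\val (repr F)) | k : 'I_n <- enum 'I_n & (k < j)%N]>>%VS.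

Definition GLact n (g : GL n) (F : Fl n) : Fl n := flag_of (GLmul g (repr F)).

Definition torus n : set (GL n) := [set t | is_diag_mx (\val t)].

(* The character chi_1^a_1 ... chi_n^a_n. *)
Definition torus_char n (a : 'I_n -> int) (t : GL n) : C :=
  \prod_(i < n) (\val t) i i ^ a i.

Definition T_stable n (X : set (Fl n)) :=
  forall t F, @torus n t -> X F -> X (GLact t F).

Definition T_fixed n : set (Fl n) :=
  [set F | forall t, @torus n t -> GLact t F = F].

Definition punctured_plane : set 'rV[C]_2 := [set v | v != 0].

Definition same_line (u v : punctured_plane) : bool := (\val u == \val v)%MS.

Lemma same_line_refl : reflexive same_line.
Proof. by move=> u; rewrite /same_line submx_refl. Qed.

Lemma same_line_sym : symmetric same_line.
Proof. by move=> u v; rewrite /same_line andbC. Qed.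

Lemma same_line_trans : transitive same_line.
Proof.
by move=> v u w /eqmxP uv /eqmxP vw; apply/eqmxP; exact: eqmx_trans uv vw.
Qed.

Canonical same_line_equiv :=
  EquivRel same_line same_line_refl same_line_sym same_line_trans.

(* As a topological type, this carries the analytic topology. *)
Definition projective_line : topologicalType :=
  quotient_topology {eq_quot same_line}.

(* For [1 <= i <= m.+1], inserts a zero as the [i]-th coordinate. *)
Definition insert0 m (i : nat) (v : 'cV[C]_m) : 'cV[C]_m.+1 :=
  \col_r (if unlift (inord i.-1) r is Some s then v s 0 else 0).

Fact insert0_is_linear m i : linear (@insert0 m i).
Proof.
move=> a u v; apply/colP => r; rewrite !mxE.
by case: unlift => [s|]; rewrite ?mxE ?mulr0 ?addr0.
Qed.

HB.instance Definition _ m i := GRing.isLinear.Build C 'cV[C]_m 'cV[C]_m.+1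
  _ (@insert0 m i) (@insert0_is_linear m i).

(* The operation P_i from subsets of Fl_m to subsets of Fl_{m+1}, for
   [1 <= i <= m]. *)
Definition bbP m (i : nat) (Z : set (Fl m)) : set (Fl m.+1) :=
  [set G | exists2 F, Z F & forall j, (j <= m.+1)%N ->
     ((j < i)%N -> flag_space G j = (linfun (@insert0 m i) @: flag_space F j)%VS) /\
     ((i < j)%N -> flag_space G j =
        (linfun (@insert0 m i) @: flag_space F j.-1
           + <[delta_mx (inord i.-1) 0%R]>)%VS)].

(* P_{s (m-1)} ... P_{s 1} Fl_1. *)
Fixpoint bbP_iter (s : nat -> nat) (m : nat) : set (Fl m) :=
  if m isn't m'.+1 then setT
  else if m' == 0%N then setT else bbP (s m') (@bbP_iter s m').

Definition QFl n : set (Fl n) :=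
  \bigcup_(s in [set s : nat -> nat | forall j, (0 < j)%N -> (0 < s j <= j)%N])
     @bbP_iter s n.

Definition homeomorphic (X Y : topologicalType) :=
  exists (f : X -> Y) (g : Y -> X),
    [/\ cancel f g, cancel g f, continuous f & continuous g].

(* H_T^*(pt) = Z[t_1, ..., t_n], where [mpolyX int (mnm1 i)] is the variable
   usually written 'X_i. *)
Definition HT n := mpoly n int.

(* -c_1^T of the character with exponents [a]. *)
Definition neg_c1 n (a : 'I_n -> int) : HT n := \sum_(i < n) mpolyX int (mnm1 i) *~ a i.

(* For a filtration X_0, ..., X_l: the fixed point p_i, the index set A_i and the
   exponents of the character of V_{i,j}, for j in A_i.  Index [i : 'I_l] stands
   for i+1 in {1, ..., l}. *)
Record paving_data n l := PavingData {
  fixpt : 'I_l -> Fl n;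
  idx : 'I_l -> {set 'I_l};
  weight : 'I_l -> 'I_l -> 'I_n -> int }.

Section Paving.
Variables (n l : nat) (X : set (Fl n)) (Xf : nat -> set (Fl n)).
Variable D : paving_data n l.

(* The k-th coordinate of V_i corresponds to V_{i,j} for j the k-th element
   of A_i. *)
Definition rep i := 'rV[C]_#|idx D i|.

Definition rep_act i (t : GL n) (v : rep i) : rep i :=
  \row_k (torus_char (weight D i (enum_val k)) t * v 0 k).

Definition stratum (i : 'I_l) : set (Fl n) := Xf i.+1 `\` Xf i.

Definition stratum_variety i :=
  initial_fs (X := Fl_variety n) (@set_val _ (stratum i)).

(* The image of V_{i,j} in X under the isomorphism [phi]. *)
Definition coord_line i (phi : rep i -> stratum i) k : set (Fl n) :=
  [set \val (phi (z *: delta_mx 0 k)) | z in setT].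

Definition good_cell (i : 'I_l) :=
  [/\ stratum i `&` @T_fixed n = [set fixpt D i],
      (forall j, j \in idx D i -> (j < i)%N),
      (exists phi : rep i -> stratum i,
         [/\ isomorphism (X := affine_space _ _) (Y := stratum_variety i) phi,
             (forall t v, @torus n t ->
                \val (phi (rep_act t v)) = GLact t (\val (phi v))) &
             forall k : 'I_#|idx D i|,
               let L := coord_line phi k `|` [set fixpt D (enum_val k)] in
               zclosure (X := Fl_variety n) (coord_line phi k) = L /\
               homeomorphic L projective_line]),
      (forall j k, j \in idx D i -> k \in idx D i -> j != k ->
         neg_c1 (weight D i j) != neg_c1 (weight D i k) /\
         neg_c1 (weight D i j) != - neg_c1 (weight D i k)) &
      forall j, j \in idx D i ->
        \big[gcdn/0%N]_(m < n) `|weight D i j m|%N = 1%N].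

Definition good_affine_paving :=
  [/\ T_stable X, Xf 0%N = set0, Xf l = X,
      (forall k, (k < l)%N -> Xf k `<=` Xf k.+1) &
      forall k, (k <= l)%N -> zclosed (X := Fl_variety n) (Xf k)] /\
  forall i, good_cell i.

End Paving.

(* Graphs with labelled edges; [edge x y f] says that f is a label of an edge
   joining x and y. *)
Record labelled_graph (V L : Type) := LabelledGraph {
  vertex : set V;
  edge : V -> V -> set L }.

Definition map_graph (V V' L : Type) (h : V -> V') (G : labelled_graph V L) :
    labelled_graph V' L := {|
  vertex := h @` vertex G;
  edge := fun x y => [set f | exists u v, [/\ x = h u, y = h v & edge G u v f]] |}.

(* Labels up to sign are encoded as sets of labels closed under [-]. *)
Definition GKM_graph n l (X : set (Fl n)) (D : paving_data n l) :
    labelled_graph (Fl n) (HT n) := {|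
  vertex := X `&` @T_fixed n;
  edge := fun x y => [set f | exists i j, [/\ j \in idx D i,
      (x = fixpt D i /\ y = fixpt D j) \/ (x = fixpt D j /\ y = fixpt D i) &
      f = neg_c1 (weight D i j) \/ f = - neg_c1 (weight D i j)]] |}.

(* Products in 'S_n are composed from left to right: [(u * v)%g x = v (u x)]. *)

Definition noncrossing n (P : {set {set 'I_n}}) : bool :=
  [forall A in P, forall B in P, (A != B) ==>
    ~~ [exists a in A, exists b in B, exists c in A, exists d in B,
          [&& a < b, b < c & c < d]%N]].

(* [enum c] lists [c] in increasing order. *)
Definition NC n : {set 'S_n} :=
  [set w | noncrossing (porbits w) &&
           [forall c in porbits w, fcycle w (rev (enum c))]].

Definition inversions n (w : 'S_n) : {set 'I_n * 'I_n} :=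
  [set p : 'I_n * 'I_n | (p.1 < p.2)%N && (w p.2 < w p.1)%N].

Definition NC_inversions n (w : 'S_n) : {set 'I_n * 'I_n} :=
  [set p in inversions w | (tperm p.1 p.2 * w)%g \in NC n].

Definition bruhat n : rel 'S_n :=
  connect [rel u v | [exists i, exists j, v == (tperm i j * u)%g] &&
                     (#|inversions u| < #|inversions v|)%N].

(* Cayley(NC_n), the edge joining u and (i j)u being labelled by t_j - t_i,
   up to sign. *)
Definition Cayley_NC n : labelled_graph 'S_n (HT n) := {|
  vertex := [set w | w \in NC n];
  edge := fun u v => [set f | [/\ u \in NC n, v \in NC n & exists i j,
    [/\ i != j, v = (u * tperm i j)%g &
        let e := mpolyX int (mnm1 j) - mpolyX int (mnm1 i) in
        f = e \/ f = - e]]] |}.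

(* [perm_mx s] has its ones in positions (i, s i). *)
Definition perm_flag n (w : 'S_n) : Fl n :=
  flag_of (GLmk (unitmx_perm C w^-1)).

Definition M_NC n (w : 'S_n) : set 'M[C]_n :=
  [set M | (forall i, M (w i) i = 1) /\
           forall i j, i != j -> (i, j) \notin NC_inversions w -> M (w j) i = 0].

Definition NC_cell n (w : 'S_n) : set (Fl n) :=
  [set flag_of g | g in [set g : GL n | M_NC w (\val g)]].

Definition NC_filtration n (w : 'I_#|NC n| -> 'S_n) (k : nat) : set (Fl n) :=
  \bigcup_(i in [set i : 'I_#|NC n| | (i < k)%N]) NC_cell (w i).

End Flags.
Arguments GL : clear implicits.
Arguments QFl : clear implicits.

(* Main.v *)
Require Import Defs.
From HB Require Import structures.
From mathcomp Require mpoly.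
Import -(notations) mpoly.
From mathcomp Require Import all_boot all_order all_algebra fingroup perm.
From mathcomp Require Import all_classical all_reals all_analysis.
From mathcomp Require Import complex generic_quotient zify ring.

Set Implicit Arguments.
Unset Strict Implicit.
Unset Printing Implicit Defensive.

Import Order.TTheory GRing.Theory Num.Theory.
Import numFieldNormedType.Exports.

(** Everything rests on an induction on [n] through the operators P_i.

    Combinatorics.  Draw an arc from each [x] to [w x], going down, and around
    the circle when [x <= w x].  A permutation is in [NC n] iff every arc is
    stable under it ([NCP]).  In this form it is clear that inserting a new
    element [q], either as a fixed point or between [q.+1] and its image, both
    preserves and reflects the property; these insertions are [lift_perm p q w]
    with [p = q] or [p = q.+1].  They also carry the pairs of [NC_inversions]
    along.  Conversely every [w != 1] in [NC n] is the longer of the two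
    insertions of some [q] into a smaller noncrossing permutation
    ([NC_reducible]), in such a way that its matrices have only one free entry
    that does not come from the smaller one ([NC_inv_descent],
    [NC_inv_row_last], [NC_inv_fixed_row], [NC_inv_fixed_col]).

    Geometry of the P_i.  A flag is in P_p Z iff it has a matrix of the form
    [insmx q p h *m N], where [h] is a matrix of a flag in [Z], where [insmx]
    inserts the vector [e_q] as a new column, and where [N] is in the minimal
    parabolic subgroup at the columns [q] and [p = q.+1] ([bbP_P]).  Thus P_p Z
    is a bundle of projective lines over [Z].  Over the cell of [w] its open
    part is the cell of the longer insertion of [q] into [w] and the remaining
    section is the cell of the shorter one ([bbP_cell], [NC_cell_bbP]).  By
    induction [QFl] is the union of the cells ([QFl_cells]).  Moreover P_p
    preserves Zariski closed sets, because the matrix [h] is polynomial in the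
    matrix of the flag ([bbP_closed]).  So every cell is contained in a closed
    set that meets only cells of smaller elements for the Bruhat order
    ([NC_cell_closure]), and each step of the filtration is closed.

    Cells.  A cell is a coordinate subspace of a Schubert cell, so its
    coordinates are ratios of minors that are regular on an open set of flags
    ([cell_param_isomorphism]), and the torus scales each of them by the
    character of a root ([cell_equivariant]).  Setting all coordinates but one
    to zero gives the flags of [w (1 + z E_ba)], whose closure is the curve cut
    out by [line_equations] ([zclosure_line]); homogeneous coordinates on this
    curve are two entries of the [a]-th column ([line_homeomorphic]).

    Uniqueness of the graph.  Two pavings with the same filtration differ on a
    stratum by an equivariant bijection of torus representations.  Since the
    weights are primitive and distinct up to sign, it must permute the
    coordinate lines ([line_correspondence]), and hence the graph does not
    depend on the paving ([GKM_graph_unique]).  For the paving constructed here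
    it is read off from the definitions ([NC_paving_graph]). *)

(** * Noncrossing permutations and stable arcs *)

Section Combinatorics.
Local Open Scope nat_scope.

Section Arcs.
Variable n : nat.
Implicit Types (w : 'S_n) (x y : 'I_n).

(** The arc of [x] is the open arc swept when going down from [x] to [w x]
    around the circle.  It wraps around if [x < w x], and the second clause
    speaks of its complement, which is the interval from [x] to [w x]. *)
Definition arcs_stable w : Prop :=
  (forall x y, w x < y -> y < x -> (w x < w y) && (w y < x)) /\
  (forall x y, x < w x -> x <= y <= w x -> x <= w y <= w x).

Lemma sorted_rev_enum (c : {set 'I_n}) (x0 : 'I_n) i j :
  i < j -> j < size (rev (enum c)) ->
  nth x0 (rev (enum c)) j < nth x0 (rev (enum c)) i.
Proof.
move=> ij; rewrite size_rev => js; rewrite !nth_rev //; last exact: ltn_trans js.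
have srt : sorted (fun a b : 'I_n => a < b) (enum c).
  rewrite /enum_mem; apply: sorted_filter; first by move=> a b d; exact: ltn_trans.
  by have := iota_ltn_sorted 0 n; rewrite -val_enum_ord sorted_map enumT.
apply: (@sorted_ltn_nth _ (fun a b : 'I_n => a < b)) => //.
- by move=> a b d; exact: ltn_trans.
- by rewrite inE ltn_subrL (leq_ltn_trans _ js).
- by rewrite inE ltn_subrL (leq_ltn_trans _ js).
- by apply: ltn_sub2l => //; exact: leq_ltn_trans ij js.
Qed.

Lemma arcs_stable_orbit w x (P : pred 'I_n) :
  (forall y, P y -> P (w y)) -> P x -> forall y, y \in porbit w x -> P y.
Proof.
move=> Pw Px y /porbitP[i ->]; elim: i => [|i IH]; first by rewrite expg0 perm1.
by rewrite expgSr permM; exact: Pw.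
Qed.

Lemma mem_porbit1 w x y : y \in porbit w x -> w y \in porbit w x.
Proof.
move=> /porbitP[i ->]; rewrite -permM -expgSr; exact: mem_porbit.
Qed.

(** The cycles of a noncrossing permutation list their elements downwards, so
    the only ascent is from the least element to the greatest one. *)
Lemma NC_step w x : w \in NC n ->
  ((w x < x) /\ forall y, y \in porbit w x -> ~~ ((w x < y) && (y < x))) \/
  (forall y, y \in porbit w x -> x <= y <= w x).
Proof.
rewrite inE => /andP[_ /forall_inP /(_ (porbit w x))].
rewrite imset_f // => /(_ isT) cyc.
set s := rev (enum (porbit w x)) in cyc.
have xs : x \in s by rewrite mem_rev mem_enum porbit_id.
have mems y : (y \in porbit w x) = (y \in s) by rewrite mem_rev mem_enum.
have dec := @sorted_rev_enum (porbit w x) x; rewrite -/s in dec.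
set k := index x s; have ks : k < size s by rewrite index_mem.
have xk : nth x s k = x by rewrite nth_index.
have := cyc; rewrite -(rot_cycle k) /rot (drop_nth x) // xk /=.
case: (ltnP k.+1 (size s)) => k1.
  rewrite (drop_nth x) //= => /andP[/eqP wx _]; left; rewrite wx; split.
    by have := dec k k.+1 (ltnSn k) k1; rewrite xk.
  move=> y; rewrite mems => ys; apply/negP => /andP[].
  have jy := index_mem y s; rewrite ys in jy; have yE := nth_index x ys.
  set j := index y s in jy yE.
  case: (ltngtP j k) => [jk|kj|jk].
  - by have := dec j k jk ks; rewrite yE xk; lia.
  - case: (ltngtP j k.+1) => [|kj'|jk]; [lia| |by rewrite -jk yE; lia].
    by have := dec k.+1 j kj' jy; rewrite yE; lia.
  - by have := xk; rewrite -jk yE => ->; lia.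
have -> : drop k.+1 s = [::] by apply: drop_oversize.
rewrite cat0s => wx; right => y; rewrite mems => ys.
have wx0 : w x = nth x s 0.
  move: wx xk ks; case: (s) => [|z s'] //=; case: (k) => [|k'] /=.
    by rewrite andbT => /eqP ->.
  by move=> /andP[/eqP].
have jy := index_mem y s; rewrite ys in jy; have yE := nth_index x ys.
set j := index y s in jy yE; rewrite wx0.
apply/andP; split.
  case: (ltngtP j k) => [jk|kj|jk]; last by rewrite -yE jk xk.
    by have := dec _ _ jk ks; rewrite xk yE; exact: ltnW.
  have := leq_trans jy k1; rewrite ltnS; lia.
by case: (posnP j) => [j0|j0]; [rewrite -j0 yE|have := dec _ _ j0 jy; rewrite yE; exact: ltnW].
Qed.

Lemma noncrossing_porbits w x y : noncrossing (porbits w) ->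
  y \notin porbit w x -> forall a b c d, a \in porbit w x -> c \in porbit w x ->
    b \in porbit w y -> d \in porbit w y -> ~ (a < b < c /\ c < d) /\ ~ (b < a < d /\ d < c).
Proof.
move=> nc yx a b c d ax cx bY dy.
have AB : porbit w x != porbit w y by rewrite eq_porbit_mem porbit_sym.
have crossing u v : u != v -> u \in porbits w -> v \in porbits w ->
    forall a b c d, a \in u -> b \in v -> c \in u -> d \in v -> ~ (a < b < c /\ c < d).
  move=> uv uP vP {ax cx bY dy} {}a {}b {}c {}d au bv cu dv [/andP[ab bc] cd].
  have := nc => /forall_inP /(_ u uP) /forall_inP /(_ v vP); rewrite uv /=.
  move=> /negP; apply; apply/existsP; exists a; rewrite au; apply/existsP; exists b.
  rewrite bv; apply/existsP; exists c; rewrite cu; apply/existsP; exists d.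
  by rewrite dv ab bc cd.
split; first by apply: (crossing (porbit w x) (porbit w y)) => //; apply: imset_f.
by apply: (crossing (porbit w y) (porbit w x)) => //; rewrite 1?eq_sym //; apply: imset_f.
Qed.

Lemma NC_arcs_stable w : w \in NC n -> arcs_stable w.
Proof.
move=> wNC; have := wNC; rewrite inE => /andP[nc _].
have wxx x : w x \in porbit w x by apply: mem_porbit1; exact: porbit_id.
split=> x y.
  move=> xy yx; case: (NC_step x wNC) => [[wx H]|/(_ (w x) (wxx x))]; last lia.
  have yC : y \notin porbit w x by apply/negP => /H; rewrite xy yx.
  have [H1 H2] := noncrossing_porbits nc yC (wxx x) (porbit_id w x) (porbit_id w y) (wxx y).
  have [H3 H4] := noncrossing_porbits nc yC (wxx x) (porbit_id w x) (wxx y) (porbit_id w y).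
  have wyx : w y != x.
    apply/eqP => e; case/negP: yC; rewrite porbit_sym -e; exact: wxx.
  have wywx : w y != w x by rewrite (inj_eq perm_inj) -val_eqE /=; lia.
  move: wyx wywx; rewrite -!val_eqE /= => wyx wywx.
  have := conj xy yx; case: (ltngtP (w y) x) => [wyx'|xwy|/eqP]; last by rewrite (negbTE wyx).
    case: (ltngtP (w y) (w x)) => [h|//|/eqP]; last by rewrite (negbTE wywx).
    by exfalso; apply: H4; rewrite h xy yx.
  by exfalso; apply: H1; rewrite xwy xy yx.
move=> xwx xyx; case: (NC_step x wNC) => [[]|H]; first lia.
case: (boolP (y \in porbit w x)) => [/mem_porbit1 /H //|yC].
have [H1 H2] := noncrossing_porbits nc yC (porbit_id w x) (wxx x) (porbit_id w y) (wxx y).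
have [H3 H4] := noncrossing_porbits nc yC (porbit_id w x) (wxx x) (wxx y) (porbit_id w y).
have yx : y != x by apply: contraNneq yC => ->; exact: porbit_id.
have ywx : y != w x by apply: contraNneq yC => ->; exact: wxx.
move: yx ywx; rewrite -!val_eqE /= => yx ywx; lia.
Qed.

Lemma arcs_stable_step w x : arcs_stable w ->
  [/\ w x < x -> forall y, y \in porbit w x -> ~~ ((w x < y) && (y < x)),
      x < w x -> forall y, y \in porbit w x -> x <= y <= w x &
      w x = x -> forall y, y \in porbit w x -> y = x].
Proof.
move=> [s1 s2]; split=> wx y yx.
- apply/negP => yA.
  have : (w x < x) && (x < x).
    apply: (@arcs_stable_orbit w y (fun z : 'I_n => (w x < z) && (z < x))) => //.
      by move=> z /andP[xz zx]; exact: s1.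
    by rewrite porbit_sym.
  by rewrite ltnn andbF.
- apply: (@arcs_stable_orbit w x (fun z : 'I_n => x <= z <= w x)) => //.
    by move=> z; exact: s2.
  by rewrite leqnn ltnW.
- apply/eqP; apply: (@arcs_stable_orbit w x (fun z : 'I_n => z == x)) => //.
  by move=> z /eqP ->; rewrite wx.
Qed.

(** A stable arc of [x] is a union of cycles and does not contain [x], so the
    cycle of [x] avoids it: cycles step to their next smaller element.  For the
    same reason, an arc of a cycle over an element [b] of another cycle contains
    this whole other cycle, which rules out crossings. *)
Lemma arcs_stable_NC w : arcs_stable w -> w \in NC n.
Proof.
move=> st; have wxx x : w x \in porbit w x by apply: mem_porbit1; exact: porbit_id.
rewrite inE; apply/andP; split.
  apply/forall_inP => A /imsetP[a0 _ ->]; apply/forall_inP => B /imsetP[b0 _ ->].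
  apply/implyP => AB; apply/negP => /existsP[a /andP[aA /existsP[b /andP[bB]]]].
  move=> /existsP[c /andP[cA /existsP[d /andP[dB /and3P[ab bc cd]]]]].
  have bA : b \notin porbit w a0.
    apply: contra AB => bA; move: bA bB.
    by rewrite -!eq_porbit_mem => /eqP -> /eqP ->.
  (* The least element [c0] of the cycle above [b] starts the arc that contains [b]. *)
  have := @arg_minnP _ c (fun x : 'I_n => (x \in porbit w a0) && (b < x)) val.
  rewrite cA bc => /(_ isT); case=> c0 /andP[c0A bc0] c0min.
  have c0a : porbit w c0 = porbit w a0 by apply/eqP; rewrite eq_porbit_mem.
  have [S1 S2 S3] := arcs_stable_step c0 st; rewrite c0a in S1 S2 S3.
  have wc0A : w c0 \in porbit w a0 by exact: mem_porbit1.
  have c0c : c0 <= c by apply: c0min; rewrite cA.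
  case: (ltngtP (w c0) c0) => [lt|lt|/val_inj e].
  - have wb : w c0 < b.
      have := S1 lt _ c0A => _; case: (ltngtP (w c0) b) => // [bw|/val_inj e].
        by have := c0min (w c0); rewrite wc0A bw leqNgt lt => /(_ isT).
      by case/negP: bA; rewrite -e.
    have : (w c0 < d) && (d < c0).
      apply: (@arcs_stable_orbit w b (fun z : 'I_n => (w c0 < z) && (z < c0))).
      + by move=> z /andP[xz zx]; exact: st.1.
      + by rewrite wb bc0.
      + by move: bB; rewrite -eq_porbit_mem => /eqP ->.
    lia.
  - by have := S2 lt a aA; lia.
  - by have := S3 e a aA => E; move: ab; rewrite E; lia.
apply/forall_inP => C /imsetP[x0 _ ->].
set s := rev _.
have mems y : (y \in porbit w x0) = (y \in s) by rewrite mem_rev mem_enum.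
have dec := @sorted_rev_enum (porbit w x0) x0; rewrite -/s in dec.
have st' x : x \in s -> [/\ w x < x -> forall y, y \in s -> ~~ ((w x < y) && (y < x)),
      x < w x -> forall y, y \in s -> x <= y <= w x &
      w x = x -> forall y, y \in s -> y = x].
  rewrite -mems -eq_porbit_mem => /eqP e.
  have [S1 S2 S3] := arcs_stable_step x st; rewrite e in S1 S2 S3.
  by split=> h y; rewrite -mems; [exact: S1|exact: S2|exact: S3].
have ws x : x \in s -> w x \in s by rewrite -!mems; exact: mem_porbit1.
rewrite -/s; case E : s => [//|z p] /=; apply/(pathP x0) => i.
rewrite size_rcons ltnS => ip; rewrite /= -rcons_cons nth_rcons /= ltnS ip nth_rcons -E.
have is_ : i < size s by rewrite E.
have xs := mem_nth x0 is_; set x := nth x0 s i in xs *.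
have [S1 S2 S3] := st' _ xs; have wxs := ws _ xs.
have [j js wxj] : exists2 j, j < size s & w x = nth x0 s j.
  by exists (index (w x) s); rewrite ?index_mem // nth_index.
case: (ltngtP i (size p)) => [ip'|ip'|ip']; [|lia|].
  have i1s : i.+1 < size s by rewrite E.
  have -> : nth x0 p i = nth x0 s i.+1 by rewrite E.
  have yx := dec _ _ (ltnSn i) i1s; have ys := mem_nth x0 i1s.
  set y := nth x0 s i.+1 in yx ys *; rewrite -/x in yx.
  case: (ltngtP (w x) x) => [lt|lt|/val_inj e].
  - have := S1 lt y ys; rewrite yx andbT -leqNgt => ywx.
    rewrite -val_eqE /= eqn_leq ywx andbT wxj.
    have ij : i < j by case: (ltngtP i j) => // [ji|ij];
      [have := dec _ _ ji is_; rewrite -wxj -/x ltnNge ltnW|move: lt; rewrite wxj -ij -/x ltnn].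
    case: (ltngtP i.+1 j) => [i1j|//|<-//]; last lia.
    exact: ltnW (dec _ _ i1j js).
  - by have := S2 lt y ys; lia.
  - by have := S3 e y ys => yx'; move: yx; rewrite yx'; lia.
have z0 : z = nth x0 s 0 by rewrite E.
have zs : z \in s by rewrite E inE eqxx.
have xle y : y \in s -> x <= y.
  move=> ys; have yE := nth_index x0 ys; have k : index y s < size s by rewrite index_mem.
  case: (ltngtP (index y s) i) => [k'|k'|k'].
  - by have := dec _ _ k' is_; rewrite yE; exact: ltnW.
  - by move: k; rewrite [in X in _ < X]E /= -ip' ltnS leqNgt k'.
  - by rewrite -yE k'.
have lez y : y \in s -> y <= z.
  move=> ys; have yE := nth_index x0 ys; rewrite z0.
  case: (posnP (index y s)) => [j0|j0]; first by rewrite -{1}yE j0.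
  have k : index y s < size s by rewrite index_mem.
  by have := dec _ _ j0 k; rewrite yE; exact: ltnW.
case: (ltngtP (w x) x) => [lt|lt|/val_inj e].
- by have := xle _ wxs; lia.
- have := S2 lt z zs; have := lez _ wxs; rewrite -val_eqE /=; lia.
- by rewrite e (S3 e z zs) eqxx.
Qed.

Lemma NCP w : reflect (arcs_stable w) (w \in NC n).
Proof. by apply: (iffP idP); [exact: NC_arcs_stable|exact: arcs_stable_NC]. Qed.

End Arcs.

(** * Insertion of an element *)

Lemma NC_invE n (w : 'S_n) a b : ((a, b) \in NC_inversions w) =
  [&& a < b, w b < w a & (tperm a b * w)%g \in NC n].
Proof. by rewrite finset.in_set [_ \in inversions w]finset.in_set /= andbA. Qed.

Lemma lift_or m (p z : 'I_m.+1) : (exists z' : 'I_m, z = lift p z') \/ z = p.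
Proof. by case: (unliftP p z) => [z' ->|->]; [left; exists z'|right]. Qed.

Lemma lift_lt m (h : 'I_m.+1) (x y : 'I_m) : (lift h x < lift h y) = (x < y).
Proof. by rewrite /= /bump; lia. Qed.

Lemma lift_le m (h : 'I_m.+1) (x y : 'I_m) : (lift h x <= lift h y) = (x <= y).
Proof. by rewrite /= /bump; lia. Qed.

Section Insert.
Variables (m : nat) (p q : 'I_m.+1).
Hypothesis pq : q <= p <= q.+1.
Implicit Types (w : 'S_m) (x y v : 'I_m).

(** Old positions [x] are renumbered by [lift p] and old values [v] by [lift q].
    As [p] is [q] or [q.+1], comparisons of a position with a value survive. *)
Lemma lift_ltVP v x : (lift q v < lift p x) = (v < x).
Proof. by rewrite /= /bump; lia. Qed.

Lemma lift_leVP x v : (lift p x <= lift q v) = (x <= v).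
Proof. by rewrite /= /bump; lia. Qed.

(** By the comparison lemmas the old arcs keep their old elements.  The new
    element is fixed, or follows [q.+1] immediately, so it respects all arcs. *)
Lemma arcs_stable_lift w : arcs_stable (lift_perm p q w) <-> arcs_stable w.
Proof.
split=> [[s1 s2]|[s1 s2]]; split=> x y.
- move=> h1 h2; have := s1 (lift p x) (lift p y); rewrite !lift_perm_lift.
  by rewrite !lift_ltVP !lift_lt => ->.
- move=> h1 h2; have := s2 (lift p x) (lift p y); rewrite !lift_perm_lift.
  rewrite !lift_leVP !lift_le; apply=> //.
  by move: h1; rewrite /= /bump; lia.
- case: (unliftP p x) => [x' ->|->]; case: (unliftP p y) => [y' ->|->];
    rewrite ?lift_perm_lift ?lift_perm_id.
  + by rewrite !lift_ltVP !lift_lt => h1 h2; exact: s1.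
  + by have := neq_lift q (w x'); rewrite -val_eqE; move: pq; rewrite /= /bump; lia.
  + by move: pq; rewrite /= /bump; lia.
  + by rewrite ltnn.
- case: (unliftP p x) => [x' ->|->]; case: (unliftP p y) => [y' ->|->];
    rewrite ?lift_perm_lift ?lift_perm_id.
  + rewrite !lift_leVP !lift_le => h1 h2.
    case: (ltngtP x' (w x')) => [h|h|/val_inj h]; first exact: s2.
    * by move: h1; rewrite ltnNge => /negP; case; rewrite ltnW // lift_ltVP.
    * suff -> : y' = x' by rewrite -h leqnn.
      by apply: val_inj; move: h2; rewrite -h /=; lia.
  + by move: pq; rewrite /= /bump; lia.
  + by move: pq; rewrite /= /bump; lia.
  + by rewrite leqnn; move: pq; lia.
Qed.

Lemma NC_lift w : (lift_perm p q w \in NC m.+1) = (w \in NC m).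
Proof. by apply/NCP/NCP; rewrite arcs_stable_lift. Qed.

Lemma tperm_lift w x y :
  (tperm (lift p x) (lift p y) * lift_perm p q w)%g = lift_perm p q (tperm x y * w)%g.
Proof.
apply/permP => z; rewrite permM; case: (unliftP p z) => [z' ->|->].
  rewrite lift_perm_lift permM; case: tpermP => [/lift_inj ->|/lift_inj ->|h1 h2].
  - by rewrite tpermL lift_perm_lift.
  - by rewrite tpermR lift_perm_lift.
  - by rewrite lift_perm_lift tpermD //; apply/eqP => e; [apply: h1|apply: h2]; rewrite e.
by rewrite tpermD ?lift_perm_id // eq_sym neq_lift.
Qed.

Lemma NC_inversions_lift w x y :
  ((lift p x, lift p y) \in NC_inversions (lift_perm p q w)) = ((x, y) \in NC_inversions w).
Proof.
by rewrite !NC_invE tperm_lift NC_lift !lift_perm_lift !lift_lt.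
Qed.

Lemma lift_perm_surj (w : 'S_m.+1) : w p = q -> exists w', w = lift_perm p q w'.
Proof.
move=> wpq; pose f x := odflt x (unlift q (w (lift p x))).
have fE x : lift q (f x) = w (lift p x).
  rewrite /f; have : q != w (lift p x).
    by rewrite -wpq (inj_eq perm_inj) neq_lift.
  by case/unlift_some => k -> ->.
have f_inj : injective f.
  by move=> x y /(congr1 (lift q)); rewrite !fE => /perm_inj /lift_inj.
exists (perm f_inj); apply/permP => z; case: (unliftP p z) => [z' ->|->].
  by rewrite lift_perm_lift permE fE.
by rewrite lift_perm_id.
Qed.
End Insert.

Section InsertSwap.
Variables (m : nat) (p q : 'I_m.+1).
Hypothesis pq : p = q.+1 :> nat.

(** The element [k] below is [q] seen before the insertion. *)
Lemma lift_swap (k : 'I_m) : k = q :> nat -> lift q k = p /\ lift p k = q.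
Proof. by move=> kq; split; apply: val_inj; rewrite /= /bump; lia. Qed.

Lemma tperm_lift_perm (w : 'S_m) :
  (tperm q p * lift_perm q q w)%g = lift_perm p q w.
Proof.
apply/permP => z; rewrite permM; have [[z' ->]|->] := lift_or p z.
  rewrite lift_perm_lift; case: (ltngtP z' q) => zq.
  - have ne : q != lift p z' by rewrite -val_eqE /= /bump; lia.
    rewrite tpermD ?neq_lift //.
    have -> : lift p z' = lift q z' by apply: val_inj; rewrite /= /bump; lia.
    by rewrite lift_perm_lift.
  - have ne : q != lift p z' by rewrite -val_eqE /= /bump; lia.
    rewrite tpermD ?neq_lift //.
    have -> : lift p z' = lift q z' by apply: val_inj; rewrite /= /bump; lia.
    by rewrite lift_perm_lift.
  - have [e1 e2] := lift_swap zq.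
    by rewrite e2 tpermL -e1 lift_perm_lift.
by rewrite tpermR !lift_perm_id.
Qed.
End InsertSwap.

Section NCInversions.
Variable n : nat.
Implicit Types (w : 'S_n) (a b i j : 'I_n).

Lemma tpermMl w a b x : (tperm a b * w)%g x =
  if x == a then w b else if x == b then w a else w x.
Proof.
rewrite permM; case: tpermP => [->|->|/eqP/negbTE -> /eqP/negbTE -> //]; rewrite ?eqxx //.
by case: eqP => // ->.
Qed.

(** After the exchange, the arc from [b] to [w a] contains [a] but not its image
    [w b].  Hence the column [a] of the matrices of the cell is a unit vector. *)
Lemma NC_inv_descent w a b : w a < a -> (a, b) \notin NC_inversions w.
Proof.
move=> wa; rewrite NC_invE; apply/negP => /and3P[ab wba /NCP[s1 _]].
have := s1 b a; rewrite !tpermMl eqxx.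
have -> : (b == a) = false by rewrite -val_eqE /=; lia.
by rewrite eqxx => /(_ wa ab); lia.
Qed.

(** The exchanged permutation preserves the interval from [i] to [w i], so it
    also preserves its complement; but it sends [a < i] to [i]. *)
Lemma NC_inv_row_last w i j a : j = i.+1 :> nat -> w \in NC n -> w j = i -> i < w i ->
  (a, j) \in NC_inversions w -> a = i.
Proof.
move=> ji wNC wj wi; rewrite NC_invE wj => /and3P[aj wia /NCP[_ s2]].
apply/eqP/negPn/negP => ai; have ai' : a < i by move: ai; rewrite -val_eqE /=; lia.
have E x : x != a -> x != j -> (tperm a j * w)%g x = w x.
  by rewrite tpermMl => /negbTE -> /negbTE ->.
have Ei : (tperm a j * w)%g i = w i by apply: E; rewrite -val_eqE /=; lia.
set u := (tperm a j * w)%g in s2 Ei *.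
have st : {in [set z : 'I_n | i <= z <= u i], forall z, u z \in [set z : 'I_n | i <= z <= u i]}.
  by move=> z; rewrite !inE; apply: s2; rewrite Ei.
have ua : u a = i by rewrite /u tpermMl eqxx.
have im : u @: [set z : 'I_n | i <= z <= u i] = [set z : 'I_n | i <= z <= u i].
  apply/eqP; rewrite eqEcard card_imset ?leqnn ?andbT; last exact: perm_inj.
  by apply/fintype.subsetP => _ /imsetP[z zI ->]; exact: st.
have : u a \in u @: [set z : 'I_n | i <= z <= u i].
  by rewrite im inE ua leqnn Ei ltnW.
by rewrite mem_imset; [rewrite inE; lia|exact: perm_inj].
Qed.

(** After the exchange, the arc from [j] to [w j] contains [i] but not its image
    [w a]. *)
Lemma NC_inv_fixed_row w i j a : j = i.+1 :> nat -> w i = i -> w j < i ->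
  (a, i) \notin NC_inversions w.
Proof.
move=> ji wi wj; rewrite NC_invE wi; apply/negP => /and3P[ai wa /NCP[s1 _]].
have := s1 j i; rewrite !tpermMl eqxx.
have -> : (j == a) = false by rewrite -val_eqE /=; lia.
have -> : (j == i) = false by rewrite -val_eqE /=; lia.
have -> : (i == a) = false by rewrite -val_eqE /=; lia.
by move=> /(_ wj); rewrite ji ltnSn => /(_ isT); lia.
Qed.

(** For [b] beyond [j], the arc from [b] to [w b] contains [j], so [w b < w j].
    But after the exchange the arc from [j] to [w j] contains [i], whose image
    is then [w b]. *)
Lemma NC_inv_fixed_col w i j b : j = i.+1 :> nat -> w \in NC n -> w i = i -> w j < i ->
  (i, b) \in NC_inversions w -> b = j.
Proof.
move=> ji /NCP[t1 _] wi wj; rewrite NC_invE wi => /and3P[ib wb /NCP[s1 _]].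
apply/eqP/negPn/negP => bj; have jb : j < b by move: bj; rewrite -val_eqE /=; lia.
have := t1 b j; have := s1 j i; rewrite !tpermMl eqxx.
have -> : (j == i) = false by rewrite -val_eqE /=; lia.
have -> : (j == b) = false by rewrite -val_eqE /=; lia.
by move=> /(_ wj); rewrite ji ltnSn => /(_ isT); lia.
Qed.

(** Among the descents onto the least element of a cycle, take a shortest one,
    from [b] to [w b].  If the element [i] preceding [b] is neither [w b] nor
    fixed, then its cycle lies inside the arc of [b], and the last descent of a
    cycle there is shorter. *)
Lemma NC_reducible w : w \in NC n -> w != 1%g ->
  exists i j : 'I_n, j = i.+1 :> nat /\
    ((w j = i /\ i < w i) \/ (w i = i /\ w j < i)).
Proof.
move=> /NCP[s1 s2] w1.
(* In a stable set with a moved point, the least moved point ends a descent. *)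
have first_moved (P : pred 'I_n) z : P z -> w z != z -> (forall y, P (w y) = P y) ->
    exists a, [/\ P (w^-1 a)%g, P a, a < w a & a < (w^-1 a)%g].
  move=> Pz wz stP.
  have := @arg_minnP _ z (fun x : 'I_n => P x && (w x != x)) val.
  rewrite Pz wz => /(_ isT); case=> a /andP[Pa wa] amin.
  exists a; have wwa : w (w^-1%g a) = a by rewrite permKV.
  have Pwa : P (w^-1%g a) by rewrite -stP wwa.
  split=> //.
    have := amin (w a); rewrite stP Pa (inj_eq perm_inj) wa => /(_ isT).
    by move: wa; rewrite -val_eqE /=; lia.
  have : w^-1%g a != a by apply: contra wa => /eqP e; rewrite -{1}e wwa.
  move=> ne; have := amin (w^-1%g a); rewrite Pwa wwa eq_sym ne => /(_ isT).
  by move: ne; rewrite -val_eqE /=; lia.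
have [z wz] : exists z, w z != z.
  apply/existsP; apply: contraNT w1 => /existsPn H; apply/eqP/permP => x.
  by rewrite perm1; have := H x; rewrite negbK => /eqP.
have [a0 [_ _ aw0 ab0]] := first_moved predT z isT wz (fun _ => erefl).
pose good b := (w b < b) && (w b < w (w b)).
have := @arg_minnP _ (w^-1 a0)%g good (fun b => b - w b).
rewrite /good permKV aw0 ab0 => /(_ isT); case=> b /andP[wb wwb] bmin.
have blt : b.-1 < n by apply: leq_ltn_trans (leq_pred _) (ltn_ord b).
pose i := Ordinal blt; have bi : b = i.+1 :> nat by rewrite /=; lia.
exists i, b; split=> //; have := wb; rewrite bi ltnS leq_eqVlt => /orP[/eqP/val_inj e|wbi].
  by left; rewrite e; split=> //; rewrite -e.
case: (eqVneq (w i) i) => [wi|wi]; first by right.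
have [||c [/andP[c1 c2] _ c3 c4]] :=
  first_moved (fun x => (w b < x) && (x < b)) i _ wi.
- by rewrite wbi bi ltnSn.
- have im : w @: [set x : 'I_n | (w b < x) && (x < b)] = [set x : 'I_n | (w b < x) && (x < b)].
    apply/eqP; rewrite eqEcard card_imset ?leqnn ?andbT; last exact: perm_inj.
    by apply/fintype.subsetP => _ /imsetP[x + ->]; rewrite !inE => /andP[x1 x2]; exact: s1.
  move=> y; have : (w y \in w @: [set x : 'I_n | (w b < x) && (x < b)]) =
    (w y \in [set x : 'I_n | (w b < x) && (x < b)]) by rewrite im.
  by rewrite mem_imset ?inE //; exact: perm_inj.
have := bmin ((w^-1)%g c); rewrite /good permKV c3 c4 => /(_ isT).
have : (w b < c) by have := s1 b ((w^-1)%g c); rewrite permKV => /(_ c1 c2) /andP[].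
lia.
Qed.

(** * The Bruhat order *)

(** Exchange [a] and [b] in the inversions of [w], except in those pairs whose
    order would be reversed, which are kept.  This is an injection into the
    inversions of the product, and it misses [(a, b)]. *)
Lemma card_inversions_tperm w a b : a < b -> w a < w b ->
  #|inversions w| < #|inversions (tperm a b * w)%g|.
Proof.
move=> ab wab; set t := tperm a b.
pose f (z : 'I_n * 'I_n) := if t z.1 < t z.2 then (t z.1, t z.2) else z.
have tt x : t (t x) = x by rewrite /t tpermK.
have f_inj : {in inversions w &, injective f}.
  move=> [x1 y1] [x2 y2]; rewrite !inE /f /= => /andP[l1 _] /andP[l2 _].
  case: ifP => h1; case: ifP => h2 [].
  - by move=> /perm_inj -> /perm_inj ->.
  - by move=> e1 e2; move: h2; rewrite -e1 -e2 !tt l1.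
  - by move=> e1 e2; move: h1; rewrite e1 e2 !tt l2.
  - by move=> -> ->.
rewrite -(card_in_imset f_inj); apply: proper_card; apply/properP; split.
  apply/fintype.subsetP => _ /imsetP[[x y] + ->]; rewrite !inE /f /= => /andP[xy wyx].
  case: ifP => h /=; first by rewrite h !permM !tt.
  rewrite xy /= !tpermMl; move: h wyx; rewrite /t.
  case: (tpermP a b x) => [ex|ex|/eqP/negbTE nx /eqP/negbTE nx'];
  case: (tpermP a b y) => [ey|ey|/eqP/negbTE ny /eqP/negbTE ny'];
    rewrite ?ex ?ey ?eqxx ?nx ?nx' ?ny ?ny'; move: xy ab wab; rewrite ?ex ?ey; try lia.
  - by move=> *; case: eqP => [->|_]; lia.
exists (a, b).
  rewrite !inE /= ab !tpermMl eqxx; case: eqP => [e|_]; last by rewrite eqxx wab.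
  by move: ab; rewrite e ltnn.
apply/imsetP => -[[x y]]; rewrite !inE /f /= => /andP[xy wyx]; case: ifP => h [].
  move=> ea eb; move: xy; rewrite -[x]tt -[y]tt -ea -eb /t tpermL tpermR; lia.
by move=> ea eb; move: wyx; rewrite -ea -eb; lia.
Qed.

Lemma bruhat_tperm w a b : a < b -> w a < w b -> bruhat w (tperm a b * w)%g.
Proof.
move=> ab wab; apply: connect1 => /=; rewrite card_inversions_tperm // andbT.
by apply/existsP; exists a; apply/existsP; exists b.
Qed.

Lemma bruhat_tperm_inv w a b : a < b -> w b < w a -> bruhat (tperm a b * w)%g w.
Proof.
move=> ab wab; have := @bruhat_tperm (tperm a b * w)%g a b ab.
rewrite mulgA tperm2 mul1g; apply; rewrite !tpermMl eqxx.
by case: eqP => [e|_]; [move: ab; rewrite e ltnn|rewrite eqxx].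
Qed.

End NCInversions.

Lemma bruhat_lift m (p q : 'I_m.+1) (u v : 'S_m) : q <= p <= q.+1 ->
  bruhat u v -> bruhat (lift_perm p q u) (lift_perm p q v).
Proof.
move=> pq /connectP[s]; elim: s u => [|z s IH] u /=; first by move=> _ ->; exact: connect0.
move=> /andP[/andP[/existsP[i /existsP[j /eqP ->]] lt] pth] vE.
apply: connect_trans (IH _ pth vE); rewrite -tperm_lift.
have up (a b : 'I_m) : a < b -> (#|inversions u| < #|inversions (tperm a b * u)%g|) ->
    bruhat (lift_perm p q u) (tperm (lift p a) (lift p b) * lift_perm p q u)%g.
  move=> ab lt'; apply: bruhat_tperm; rewrite ?lift_lt // !lift_perm_lift lift_lt.
  case: (ltngtP (u a) (u b)) => // [uba|/val_inj/perm_inj e]; last by move: ab; rewrite e ltnn.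
  have := @card_inversions_tperm _ (tperm a b * u)%g a b ab.
  rewrite mulgA tperm2 mul1g !tpermMl eqxx.
  have -> : (b == a) = false by rewrite -val_eqE /=; lia.
  by rewrite eqxx => /(_ uba); lia.
case: (ltngtP i j) => [ij|ji|/val_inj ij]; first exact: up.
  by rewrite tpermC; apply: up; rewrite // tpermC.
by rewrite ij tperm1 mul1g; exact: connect0.
Qed.

Lemma bruhat_trans n (u v w : 'S_n) : bruhat u v -> bruhat v w -> bruhat u w.
Proof. exact: connect_trans. Qed.

Lemma bruhat_refl n (u : 'S_n) : bruhat u u.
Proof. exact: connect0. Qed.

Lemma NC1 n : (1%g : 'S_n) \in NC n.
Proof.
apply/NCP; split=> x y; rewrite !perm1; lia.
Qed.

End Combinatorics.

Local Open Scope classical_set_scope.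
Local Open Scope ring_scope.
Local Open Scope quotient_scope.

(** * Polynomial functions on matrices *)

Section PolynomialFunctions.
Variable K : fieldType.

(** Induction over polynomial expressions: composition, clearing of denominators
    and restriction to a line are the three instances used below. *)
Lemma meval_closure (T : Type) k (x : T -> 'I_k -> K) (Q : (T -> K) -> Prop) :
  (forall c, Q (fun=> c)) ->
  (forall f g, Q f -> Q g -> Q (fun t => f t + g t)) ->
  (forall f g, Q f -> Q g -> Q (fun t => f t * g t)) ->
  (forall i, Q (fun t => x t i)) ->
  forall p : mpoly k K, Q (fun t => meval (x t) p).
Proof.
move=> Qc QD QM Qx p; rewrite (_ : (fun t => _) = fun t =>
  \sum_(m <- msupp p) mcoeff m p * \prod_(i < k) x t i ^+ m i); last first.
  by apply/funext => t; rewrite mevalE.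
have QX f e : Q f -> Q (fun t => f t ^+ e).
  move=> Qf; elim: e => [|e IH]; first exact: Qc.
  rewrite (_ : (fun t => _) = fun t => f t * f t ^+ e); first exact: QM.
  by apply/funext => t; rewrite exprS.
have Qprod (s : seq 'I_k) (F : T -> 'I_k -> K) :
    (forall i, Q (F^~ i)) -> Q (fun t => \prod_(i <- s) F t i).
  move=> QF; elim: s => [|i s IH].
    by rewrite (_ : (fun t => _) = fun=> 1) //; apply/funext => t; rewrite big_nil.
  rewrite (_ : (fun t => _) = fun t => F t i * \prod_(i <- s) F t i); first exact: QM.
  by apply/funext => t; rewrite big_cons.
elim: (msupp p) => [|m s IH].
  by rewrite (_ : (fun t => _) = fun=> 0) //; apply/funext => t; rewrite big_nil.
rewrite (_ : (fun t => _) = fun t => mcoeff m p * (\prod_(i < k) x t i ^+ m i) +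
  \sum_(m <- s) mcoeff m p * \prod_(i < k) x t i ^+ m i).
  apply: (QD) => //; apply: QM; first exact: Qc.
  by apply: Qprod => i; exact: QX.
by apply/funext => t; rewrite big_cons.
Qed.

Definition polyfun m n (f : 'M[K]_(m, n) -> K) := exists p, forall A, f A = mxeval p A.

Section Closure.
Variables m n : nat.
Implicit Types f g : 'M[K]_(m, n) -> K.

Lemma polyfun_mxeval (p : mpoly (m * n) K) : polyfun (mxeval p).
Proof. by exists p. Qed.

Lemma polyfun_cst c : polyfun (fun _ : 'M[K]_(m, n) => c).
Proof. by exists (mpolyC (m * n) c) => A; rewrite /mxeval mevalC. Qed.

Lemma polyfun_coord i j : polyfun (fun A : 'M[K]_(m, n) => A i j).
Proof.
by exists (mpolyX K (mnm1 (mxvec_index i j))) => A; rewrite /mxeval mevalXU mxvecE.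
Qed.

Lemma polyfunD f g : polyfun f -> polyfun g -> polyfun (fun A => f A + g A).
Proof. by move=> [p fp] [q gq]; exists (p + q) => A; rewrite fp gq /mxeval mevalD. Qed.

Lemma polyfunM f g : polyfun f -> polyfun g -> polyfun (fun A => f A * g A).
Proof. by move=> [p fp] [q gq]; exists (p * q) => A; rewrite fp gq /mxeval mevalM. Qed.

Lemma polyfunB f g : polyfun f -> polyfun g -> polyfun (fun A => f A - g A).
Proof. by move=> [p fp] [q gq]; exists (p - q) => A; rewrite fp gq /mxeval mevalB. Qed.

Lemma polyfunX f e : polyfun f -> polyfun (fun A => f A ^+ e).
Proof. by move=> [p fp]; exists (p ^+ e) => A; rewrite fp /mxeval rmorphXn. Qed.

Lemma polyfun_sum (I : Type) (s : seq I) (P : pred I) (F : I -> 'M[K]_(m, n) -> K) :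
  (forall i, P i -> polyfun (F i)) -> polyfun (fun A => \sum_(i <- s | P i) F i A).
Proof.
move=> HF; elim: s => [|i s IH].
  by rewrite (_ : (fun A => _) = fun=> 0); [exact: polyfun_cst|apply/funext => A; rewrite big_nil].
rewrite (_ : (fun A => _) = if P i then fun A => F i A + \sum_(i <- s | P i) F i A
   else fun A => \sum_(i <- s | P i) F i A).
  by case: ifP => // Pi; apply: polyfunD => //; exact: HF.
by apply/funext => A; rewrite big_cons; case: (P i).
Qed.

Lemma polyfun_prod (I : Type) (s : seq I) (P : pred I) (F : I -> 'M[K]_(m, n) -> K) :
  (forall i, P i -> polyfun (F i)) -> polyfun (fun A => \prod_(i <- s | P i) F i A).
Proof.
move=> HF; elim: s => [|i s IH].
  by rewrite (_ : (fun A => _) = fun=> 1); [exact: polyfun_cst|apply/funext => A; rewrite big_nil].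
rewrite (_ : (fun A => _) = if P i then fun A => F i A * \prod_(i <- s | P i) F i A
   else fun A => \prod_(i <- s | P i) F i A).
  by case: ifP => // Pi; apply: polyfunM => //; exact: HF.
by apply/funext => A; rewrite big_cons; case: (P i).
Qed.

Lemma polyfun_det k (F : 'M[K]_(m, n) -> 'M[K]_k) :
  (forall i j, polyfun (fun A => F A i j)) -> polyfun (fun A => \det (F A)).
Proof.
move=> HF; apply: polyfun_sum => s _; apply: polyfunM; first exact: polyfun_cst.
by apply: polyfun_prod => i _; exact: HF.
Qed.

Lemma polyfun_adj k (F : 'M[K]_(m, n) -> 'M[K]_k) i j :
  (forall i j, polyfun (fun A => F A i j)) -> polyfun (fun A => (\adj (F A)) i j).
Proof.
move=> HF; rewrite (_ : (fun A => _) = fun A => cofactor (F A) j i); last first.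
  by apply/funext => A; rewrite mxE.
apply: polyfunM; first exact: polyfun_cst.
apply: polyfun_det => a b; rewrite (_ : (fun A => _) = fun A => F A (lift j a) (lift i b)) //.
by apply/funext => A; rewrite !mxE.
Qed.

Lemma polyfun_comp k l (F : 'M[K]_(m, n) -> 'M[K]_(k, l)) (f : 'M[K]_(k, l) -> K) :
  (forall i j, polyfun (fun A => F A i j)) -> polyfun f -> polyfun (fun A => f (F A)).
Proof.
move=> HF [p fp]; rewrite (_ : (fun A => _) = fun A => mxeval p (F A)); last first.
  by apply/funext => A; rewrite fp.
apply: (@meval_closure _ _ (fun A k => mxvec (F A) 0 k)).
- exact: polyfun_cst.
- exact: polyfunD.
- exact: polyfunM.
move=> i; case/mxvec_indexP: i => i j.
rewrite (_ : (fun A => _) = fun A => F A i j) //.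
by apply/funext => A; rewrite mxvecE.
Qed.

(** Denominators are kept as powers of the single function [D], a form stable
    under sums and products. *)
Lemma polyfun_quotient k l (N : 'M[K]_(m, n) -> 'M[K]_(k, l)) (D : 'M[K]_(m, n) -> K)
    (p : mpoly (k * l) K) :
  (forall i j, polyfun (fun A => N A i j)) -> polyfun D ->
  exists P d, polyfun P /\
    forall A, D A != 0 -> mxeval p ((D A)^-1 *: N A) = P A / D A ^+ d.
Proof.
move=> HN HD.
apply: (@meval_closure _ _ (fun A k => mxvec ((D A)^-1 *: N A) 0 k)
  (fun f => exists P d, polyfun P /\ forall A, D A != 0 -> f A = P A / D A ^+ d)).
- by move=> c; exists (fun=> c), 0%N; split; [exact: polyfun_cst|move=> A _; rewrite expr0 divr1].
- move=> f g [P [d [HP Pf]]] [Q [e [HQ Qg]]].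
  exists (fun A => P A * D A ^+ e + Q A * D A ^+ d), (d + e)%N; split.
    by apply: polyfunD; apply: polyfunM => //; exact: polyfunX.
  move=> A DA; rewrite Pf // Qg // exprD.
  have h1 : D A ^+ d != 0 by rewrite expf_neq0.
  have h2 : D A ^+ e != 0 by rewrite expf_neq0.
  by field; rewrite h1 h2.
- move=> f g [P [d [HP Pf]]] [Q [e [HQ Qg]]].
  exists (fun A => P A * Q A), (d + e)%N; split; first exact: polyfunM.
  move=> A DA; rewrite Pf // Qg // exprD.
  have h1 : D A ^+ d != 0 by rewrite expf_neq0.
  have h2 : D A ^+ e != 0 by rewrite expf_neq0.
  by field; rewrite h1 h2.
- move=> i; case/mxvec_indexP: i => i j; exists (fun A => N A i j), 1%N; split => // A DA.
  by rewrite mxvecE mxE expr1 mulrC.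
Qed.

Lemma polyfun_line (f : 'M[K]_(m, n) -> K) (A B : 'M[K]_(m, n)) :
  polyfun f -> exists P : {poly K}, forall s, f (A + s *: B) = P.[s].
Proof.
move=> [p fp]; have : exists P : {poly K}, forall s, mxeval p (A + s *: B) = P.[s].
  refine (@meval_closure _ _ (fun s k => mxvec (A + s *: B) 0 k)
    (fun h => exists P : {poly K}, forall s : K, h s = P.[s]) _ _ _ _ p).
  - by move=> c; exists c%:P => s; rewrite hornerC.
  - by move=> f1 f2 [P1 h1] [P2 h2]; exists (P1 + P2) => s; rewrite hornerD h1 h2.
  - by move=> f1 f2 [P1 h1] [P2 h2]; exists (P1 * P2) => s; rewrite hornerM h1 h2.
  - move=> i; case/mxvec_indexP: i => i j; exists ((A i j)%:P + 'X * (B i j)%:P) => s.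
    by rewrite mxvecE !mxE !hornerE.
by move=> [P HP]; exists P => s; rewrite fp.
Qed.
End Closure.
End PolynomialFunctions.

(** The positive integers are infinitely many nonzero roots. *)
Lemma horner_punctured (K : numDomainType) (P : {poly K}) :
  (forall s, s != 0 -> P.[s] = 0) -> P.[0] = 0.
Proof.
move=> H; suff -> : P = 0 by rewrite horner0.
pose f (i : nat) : K := i.+1%:R.
have f_inj : injective f by move=> i j /eqP; rewrite eqr_nat => /eqP [].
apply: (@roots_geq_poly_eq0 _ _ (map f (iota 0 (size P)))).
- by apply/allP => _ /mapP[i _ ->]; apply/rootP; apply: H; rewrite pnatr_eq0.
- by rewrite map_inj_uniq // iota_uniq.
- by rewrite size_map size_iota.
Qed.

(** * Matrices of flags *)

Section FlagsOfMatrices.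
Variable C : numClosedFieldType.

Lemma flag_ofP n (g h : GL C n) :
  flag_of g = flag_of h <-> upper_triangular (invmx (\val g) *m \val h).
Proof. by split=> [/eqmodP|H]; last apply/eqmodP. Qed.

Lemma flag_of_mulmx n (g h : GL C n) (u : 'M[C]_n) :
  \val g = \val h *m u -> upper_triangular u -> flag_of g = flag_of h.
Proof.
move=> gh ut; apply/esym/flag_ofP; rewrite gh mulmxA mulVmx ?mul1mx //.
exact: GLunit.
Qed.

Lemma flag_of_surj n (F : Fl C n) : exists g, F = flag_of g.
Proof. by exists (repr F); rewrite /flag_of reprK. Qed.

Lemma repr_flag_of n (g : GL C n) : exists2 u : 'M[C]_n,
  upper_triangular u & \val (repr (flag_of g)) = \val g *m u.
Proof.
exists (invmx (\val g) *m \val (repr (flag_of g))); last by rewrite mulKVmx ?GLunit.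
by apply/flag_ofP; rewrite /flag_of reprK.
Qed.

Lemma GLactE n (t g : GL C n) : GLact t (flag_of g) = flag_of (GLmul t g).
Proof.
have [u uu E] := repr_flag_of g; apply: (@flag_of_mulmx _ _ _ u) => //.
by rewrite /= E mulmxA.
Qed.

Lemma GL_inj n (g h : GL C n) : \val g = \val h -> g = h.
Proof. exact: val_inj. Qed.

Lemma upper_triangular_unit_diag n (u : 'M[C]_n) i : u \in unitmx ->
  upper_triangular u -> u i i != 0.
Proof.
move=> uu ut; have := uu; rewrite unitmxE -det_tr (det_trig ut) unitfE.
rewrite prodf_seq_neq0 => /allP /(_ i); rewrite mem_index_enum => /(_ isT).
by rewrite mxE.
Qed.

(** The equations live on invertible matrices; only the set of their common
    zeros has to be invariant under [B], not each of them. *)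
Lemma zclosed_Fl n (Z : set (Fl C n)) (S : set ('M[C]_n -> C)) :
  (forall f, S f -> polyfun f) ->
  (forall g, Z (flag_of g) <-> forall f, S f -> f (\val g) = 0) ->
  zclosed (X := Fl_variety C n) Z.
Proof.
move=> Sp ZS; rewrite /zclosed /=.
exists [set A | exists2 p, (exists2 f, S f & forall A, f A = mxeval p A) & mxeval p A != 0].
  by exists [set p | exists2 f, S f & forall A, f A = mxeval p A].
rewrite predeqE => g /=; split.
  move=> [p [f Sf fp] pg] /ZS /(_ f Sf); rewrite fp => e.
  by rewrite e eqxx in pg.
move=> nZ; apply: contrapT => H; apply: nZ; apply/ZS => f Sf.
apply/eqP/negPn/negP => f0; have [p fp] := Sp f Sf.
by apply: H; exists p; [exists f|rewrite -fp].
Qed.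

Lemma zclosed_FlP n (Z : set (Fl C n)) : zclosed (X := Fl_variety C n) Z ->
  exists S : set ('M[C]_n -> C), (forall f, S f -> polyfun f) /\
  (forall g, Z (flag_of g) <-> forall f, S f -> f (\val g) = 0).
Proof.
move=> [_ [S ->] E]; exists [set mxeval p | p in S]; split.
  by move=> _ [p _ <-]; exact: polyfun_mxeval.
move=> g; move: E; rewrite predeqE => /(_ g) /= [E1 E2]; split.
  move=> Zg _ [p Sp <-]; apply/eqP/negPn/negP => pg.
  by apply: E1 => //; exists p.
move=> H; apply: contrapT => /E2 [p Sp]; rewrite H ?eqxx //.
by exists p.
Qed.

Lemma zclosedU n (I : eqType) (P : set I) (Z : I -> set (Fl C n)) (s : seq I) :
  (forall i, P i <-> i \in s) ->
  (forall i, P i -> zclosed (X := Fl_variety C n) (Z i)) ->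
  zclosed (X := Fl_variety C n) (\bigcup_(i in P) Z i).
Proof.
elim: s P => [|i s IH] P Ps HZ.
  apply: (@zclosed_Fl _ _ [set fun=> 1]).
    by move=> _ ->; exact: polyfun_cst.
  move=> g; split; first by move=> [j /Ps].
  by move=> /(_ _ erefl) /eqP; rewrite oner_eq0.
have Pi : P i by apply/Ps; rewrite mem_head.
have Pj j : j \in s -> P j by move=> js; apply/Ps; rewrite inE js orbT.
have [S1 [P1 E1]] := zclosed_FlP (HZ i Pi).
have [S2 [P2 E2]] := zclosed_FlP (IH [set j | j \in s] (fun j => iff_refl _)
  (fun j js => HZ j (Pj j js))).
apply: (@zclosed_Fl _ _ [set h | exists f1 f2, [/\ S1 f1, S2 f2 & h = fun A => f1 A * f2 A]]).
  by move=> _ [f1 [f2 [h1 h2 ->]]]; apply: polyfunM; [exact: P1|exact: P2].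
move=> g; split.
  move=> [j /Ps + Zj] _ [f1 [f2 [h1 h2 ->]]]; rewrite inE => /orP[/eqP ji|js].
    by rewrite ((E1 g).1 _ _ h1) ?mul0r // -ji.
  by rewrite ((E2 g).1 _ _ h2) ?mulr0 //; exists j.
move=> H; case: (pselect (Z i (flag_of g))) => [Zi|nZi]; first by exists i.
have [f1 h1 n1] : exists2 f1, S1 f1 & f1 (\val g) != 0.
  apply: contrapT => H1; apply: nZi; apply/E1 => f Sf; apply/eqP/negPn/negP => f0.
  by apply: H1; exists f.
have [|j js Zj] := (E2 g).2.
  move=> f2 h2; have /eqP := H _ (ex_intro _ f1 (ex_intro _ f2 (And3 h1 h2 erefl))).
  by rewrite mulf_eq0 (negbTE n1) => /eqP.
by exists j => //; exact: Pj.
Qed.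

Definition colspan n (g : 'M[C]_n) (j : nat) : {vspace 'cV[C]_n} :=
  <<[seq col k g | k : 'I_n <- enum 'I_n & (k < j)%N]>>%VS.

Lemma mem_colspan_col n (g : 'M[C]_n) j (k : 'I_n) : (k < j)%N -> col k g \in colspan g j.
Proof.
by move=> kj; apply: memv_span; apply: map_f; rewrite mem_filter kj mem_enum.
Qed.

(** Membership is the vanishing of the last coordinates in the basis formed by
    the columns of [g]. *)
Lemma mem_colspan n (g : 'M[C]_n) j v : g \in unitmx ->
  reflect (forall r : 'I_n, (j <= r)%N -> (invmx g *m v) r 0 = 0) (v \in colspan g j).
Proof.
move=> gu; apply: (iffP idP).
  rewrite /colspan => vs r jr; set X := [seq _ | _ <- _] in vs.
  have := @coord_span _ _ _ (in_tuple X) v vs => ->.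
  rewrite mulmx_sumr summxE big1 // => i _; rewrite -scalemxAr mxE.
  have /mapP[k] := mem_nth 0 (ltn_ord i).
  rewrite mem_filter => /andP[kj _] ->; rewrite colE mulmxA mulVmx // mul1mx mxE.
  by rewrite -val_eqE /= gtn_eqF ?mulr0 // (leq_trans kj jr).
move=> H; rewrite -[v](mulKVmx gu) -[X in X \in _]mul1mx.
have -> : 1%:M *m (g *m (invmx g *m v)) = \sum_k (invmx g *m v) k 0 *: col k g.
  rewrite mul1mx; apply/colP => r; rewrite mxE summxE; apply: eq_bigr => k _.
  by rewrite !mxE mulrC.
apply: memv_suml => k _; case: (ltnP k j) => kj.
  by rewrite memvZ // mem_colspan_col.
by rewrite H // scale0r mem0v.
Qed.

Lemma dim_colspan n (g h : 'M[C]_n) j : g \in unitmx -> h \in unitmx ->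
  \dim (colspan g j) = \dim (colspan h j).
Proof.
suff E : forall k : 'M[C]_n, k \in unitmx ->
    \dim (colspan k j) = \dim (colspan (1%:M : 'M[C]_n) j).
  by move=> gu hu; rewrite !E.
move=> k ku; have -> : colspan k j =
    (linfun (mulmx k : 'cV_n -> 'cV_n) @: colspan (1%:M : 'M[C]_n) j)%VS.
  rewrite limg_span -map_comp; congr (<<_>>)%VS; apply: eq_map => i /=.
  by rewrite lfunE /= !colE mulmxA mulmx1.
apply: limg_dim_eq; apply/eqP; rewrite -subv0; apply: subv_trans (capvSr _ _) _.
rewrite subv0; apply/lker0P => u v; rewrite !lfunE /= => /(congr1 (mulmx (invmx k))).
by rewrite !mulKmx.
Qed.

Lemma colspan_eqP n (g h : 'M[C]_n) j : g \in unitmx -> h \in unitmx ->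
  colspan g j = colspan h j <->
  forall r c : 'I_n, (c < j)%N -> (j <= r)%N -> (invmx h *m g) r c = 0.
Proof.
move=> gu hu; have E r (c : 'I_n) : (invmx h *m g) r c = (invmx h *m col c g) r 0.
  by rewrite !mxE; apply: eq_bigr => k _; rewrite !mxE.
split=> [e r c cj jr|H].
  by have := mem_colspan_col g cj; rewrite E e => /mem_colspan; exact.
apply/eqP; rewrite eqEdim (dim_colspan j gu hu) leqnn andbT.
apply/span_subvP => v /mapP[c + ->]; rewrite mem_filter => /andP[cj _].
by apply/mem_colspan => // r jr; rewrite -E; exact: H.
Qed.

Lemma flag_spaceE n (g : GL C n) j : flag_space (flag_of g) j = colspan (\val g) j.
Proof.
apply/colspan_eqP; rewrite ?GLunit // => r c cj jr.
have [u /upper_triangularP ut ->] := repr_flag_of g.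
by rewrite mulKmx ?GLunit // ut // (leq_trans cj jr).
Qed.

Section Insmx.
Variable m : nat.
Implicit Types (p q s : 'I_m.+1).

(** For [p = q.+1], the columns of [insmx q p h] are the columns of [h] with a
    zero inserted in row [q], among which [e_q] is inserted as column [p]. *)
Definition insmx q p (h : 'M[C]_m) : 'M[C]_m.+1 := \matrix_(r, c)
  match unlift q r, unlift p c with
  | Some r', Some c' => h r' c' | None, None => 1 | _, _ => 0 end.

Lemma insmx_lift q p h (r c : 'I_m) : insmx q p h (lift q r) (lift p c) = h r c.
Proof. by rewrite mxE !liftK. Qed.

Lemma insmx_row q p h (c : 'I_m) : insmx q p h q (lift p c) = 0.
Proof. by rewrite mxE unlift_none liftK. Qed.

Lemma insmx_col q p h (r : 'I_m) : insmx q p h (lift q r) p = 0.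
Proof. by rewrite mxE unlift_none liftK. Qed.

Lemma insmx_pivot q p h : insmx q p h q p = 1.
Proof. by rewrite mxE !unlift_none. Qed.

Definition insmxE := (insmx_lift, insmx_row, insmx_col, insmx_pivot).

Lemma sum_lift (V : zmodType) p (F : 'I_m.+1 -> V) :
  \sum_k F k = F p + \sum_(k < m) F (lift p k).
Proof.
rewrite (bigD1 p) //=; congr (_ + _); rewrite (reindex_omap (lift p) (unlift p)) /=; last first.
  by move=> i ip; case: unliftP ip => [j ->|->]; rewrite ?eqxx.
by apply: eq_bigl => i; rewrite liftK eqxx andbT eq_sym neq_lift.
Qed.

Lemma insmxM q p s (g h : 'M[C]_m) : insmx q p g *m insmx p s h = insmx q s (g *m h).
Proof.
apply/matrixP => r c; rewrite mxE (sum_lift p).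
have [[r' ->]|->] := lift_or q r; have [[c' ->]|->] := lift_or s c; rewrite !insmxE.
- by rewrite mulr0 add0r mxE; apply: eq_bigr => k _; rewrite !insmxE.
- by rewrite mul0r add0r big1 // => k _; rewrite !insmxE mulr0.
- by rewrite mulr0 add0r big1 // => k _; rewrite !insmxE mul0r.
- by rewrite mulr1 big1 ?addr0 // => k _; rewrite !insmxE mul0r.
Qed.

Lemma insmx1 p : insmx p p 1%:M = 1%:M.
Proof.
apply/matrixP => r c; have [[r' ->]|->] := lift_or p r; have [[c' ->]|->] := lift_or p c;
  rewrite !insmxE !mxE.
- by rewrite (inj_eq lift_inj).
- by rewrite eq_sym (negbTE (neq_lift _ _)).
- by rewrite (negbTE (neq_lift _ _)).
- by rewrite eqxx.
Qed.

Lemma insmx_unit q p (h : 'M[C]_m) : h \in unitmx -> insmx q p h \in unitmx.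
Proof.
by move=> hu; apply: (mulmx1_unit (B := insmx p q (invmx h)) _).1; rewrite insmxM mulmxV // insmx1.
Qed.

Definition GLins q p (h : GL C m) : GL C m.+1 := GLmk (insmx_unit q p (GLunit h)).

Lemma col_insmx_lift q p h (k : 'I_m) : col (lift p k) (insmx q p h) = insert0 q.+1 (col k h).
Proof.
apply/colP => r; rewrite mxE /insert0 mxE /= inord_val.
by have [[r' ->]|->] := lift_or q r; rewrite !insmxE ?liftK ?unlift_none // mxE.
Qed.

Lemma col_insmx q p h : col p (insmx q p h) = delta_mx q 0.
Proof.
apply/colP => r; rewrite !mxE unlift_none.
by have [[r' ->]|->] := lift_or q r; rewrite ?liftK ?unlift_none ?eqxx // eq_sym (negbTE (neq_lift _ _)).
Qed.
End Insmx.

End FlagsOfMatrices.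

(** * Minimal parabolic subgroups *)

Section Elementary.
Variable C : numClosedFieldType.

Definition elem n (p q : 'I_n) (z : C) : 'M[C]_n := 1%:M + z *: delta_mx p q.

Lemma mulmx_elem m n (A : 'M[C]_(m, n)) (p q : 'I_n) z r c :
  (A *m elem p q z) r c = A r c + z * (A r p *+ (c == q)).
Proof.
rewrite mulmxDr mulmx1 mxE -scalemxAr mxE; congr (_ + _ * _).
rewrite mxE (bigD1 p) //= big1 ?addr0 => [|k kp]; last by rewrite mxE (negbTE kp) mulr0.
by rewrite mxE eqxx /= mulr_natr.
Qed.

Lemma elem_mulmx m n (A : 'M[C]_(n, m)) (p q : 'I_n) z r c :
  (elem p q z *m A) r c = A r c + z * (A q c *+ (r == p)).
Proof.
rewrite mulmxDl mul1mx mxE -scalemxAl mxE; congr (_ + _ * _).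
rewrite mxE (bigD1 q) //= big1 ?addr0 => [|k kq].
  by rewrite mxE eqxx andbT mulr_natl.
by rewrite mxE (negbTE kq) andbF mul0r.
Qed.

Lemma elemE n (p q : 'I_n) z r c :
  elem p q z r c = (r == c)%:R + z *+ ((r == p) && (c == q)).
Proof. by rewrite !mxE mulr_natr. Qed.

Lemma elemK n (p q : 'I_n) z : p != q -> elem p q z *m elem p q (- z) = 1%:M.
Proof.
move=> pq; rewrite /elem mulmxDl mul1mx mulmxDr mulmx1 -scalemxAl -scalemxAr.
by rewrite mul_delta_mx_0 1?eq_sym // !scaler0 addr0 scaleNr addrNK.
Qed.

Lemma elem_unit n (p q : 'I_n) z : p != q -> elem p q z \in unitmx.
Proof. by move=> pq; exact: (mulmx1_unit (elemK z pq)).1. Qed.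

(** For [p = q.+1], the invertible ones form the minimal parabolic subgroup fixing the
    standard flag except for its subspace of dimension [p]. *)
Definition parabolic n (p q : 'I_n) (N : 'M[C]_n) :=
  forall r c : 'I_n, (c < r)%N -> (r, c) != (p, q) -> N r c = 0.

Lemma parabolic_upper n (p q : 'I_n) (N : 'M[C]_n) :
  parabolic p q N -> N p q = 0 -> upper_triangular N.
Proof.
move=> par N0; apply/upper_triangularP => i j ij.
by case: (eqVneq (j, i) (p, q)) => [[-> ->] //|ne]; exact: par.
Qed.

Lemma parabolic_elem n (p q : 'I_n) z : parabolic p q (elem p q z).
Proof.
move=> r c cr ne; rewrite elemE -val_eqE /= gtn_eqF //.
by move: ne; rewrite xpair_eqE => /negbTE ->; rewrite addr0.
Qed.

Section Simple.
Variables (m : nat) (p q : 'I_m.+1).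
Hypothesis pq : p = q.+1 :> nat.

Let pNq : p != q. Proof. by rewrite -val_eqE /= pq; lia. Qed.

Lemma parabolic_decomp (N : 'M[C]_m.+1) : parabolic p q N -> N q q != 0 ->
  exists z u, upper_triangular u /\ N = elem p q z *m u.
Proof.
move=> par Nq; pose z := N p q / N q q; exists z, (elem p q (- z) *m N); split; last first.
  by rewrite mulmxA elemK // mul1mx.
apply: (@parabolic_upper _ p q).
  move=> r c cr ne; rewrite elem_mulmx par // add0r.
  case: eqP => [rp|]; last by rewrite mulr0n mulr0.
  rewrite rp xpair_eqE eqxx /= -val_eqE /= in ne cr *; rewrite par ?mul0rn ?mulr0 //.
    by move: ne cr; lia.
  by rewrite xpair_eqE eq_sym (negbTE pNq).
by rewrite elem_mulmx eqxx mulr1n /z mulNr divfK // subrr.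
Qed.

Definition swapmx : 'M[C]_m.+1 := insmx p q 1%:M.

Lemma insmx1E (a b r c : 'I_m.+1) :
  (insmx a b 1%:M : 'M[C]_m.+1) r c = (r == lift_perm b a 1 c)%:R.
Proof.
have [[r' ->]|->] := lift_or a r; have [[c' ->]|->] := lift_or b c;
  rewrite !insmxE ?lift_perm_id ?lift_perm_lift ?perm1 ?mxE ?(inj_eq lift_inj) ?eqxx //.
  by rewrite eq_sym (negbTE (neq_lift _ _)).
by rewrite (negbTE (neq_lift _ _)).
Qed.

Lemma swapmxE : insmx q p 1%:M = swapmx.
Proof.
apply/matrixP => r c; rewrite /swapmx !insmx1E.
have E : lift_perm p q 1%g = tperm q p by rewrite -tperm_lift_perm // lift_perm1 mulg1.
have E' : lift_perm q p 1%g = tperm q p by rewrite -[1%g]invg1 -lift_permV E tpermV.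
by rewrite E E'.
Qed.

Lemma swapmxK : swapmx *m swapmx = 1%:M.
Proof. by rewrite -{1}swapmxE insmxM mulmx1 insmx1. Qed.

Lemma swapmx_rows (N : 'M[C]_m.+1) : exists q' : 'I_m,
  [/\ q' = q :> nat, forall c, (swapmx *m N) q c = N p c,
  forall c, (swapmx *m N) p c = N q c &
  forall r c, r != p -> r != q -> (swapmx *m N) r c = N r c].
Proof.
have km : (q < m)%N by have := ltn_ord p; lia.
have rowE r c : (swapmx *m N) (lift q r) c = N (lift p r) c.
  rewrite -swapmxE mxE (sum_lift p) insmxE mul0r add0r (bigD1 r) //= insmxE mxE eqxx mul1r.
  by rewrite big1 ?addr0 // => k kr; rewrite insmxE mxE eq_sym (negbTE kr) mul0r.
exists (Ordinal km); split=> //.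
- move=> c; rewrite -swapmxE mxE (sum_lift p) insmxE mul1r big1 ?addr0 // => k _.
  by rewrite insmxE mul0r.
- move=> c; have [e1 e2] := @lift_swap _ _ _ pq (Ordinal km) erefl.
  by rewrite -{1}e1 rowE e2.
- move=> r c rp rq; have [[r' E]|E] := lift_or q r; last by rewrite E eqxx in rq.
  rewrite E rowE; congr (N _ _); apply: val_inj; move: rp; rewrite E -val_eqE /= /bump; lia.
Qed.

Lemma parabolic_swap (N : 'M[C]_m.+1) : parabolic p q N -> parabolic p q (swapmx *m N).
Proof.
move=> par r c cr ne; have [q' [_ h1 h2 h3]] := swapmx_rows N.
case: (eqVneq r p) => [rp|rp].
  have {}cr : (c < q)%N.
    by move: ne cr; rewrite rp xpair_eqE eqxx /= -val_eqE /=; lia.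
  by rewrite rp h2 par // xpair_eqE eq_sym (negbTE pNq).
case: (eqVneq r q) => [rq|rq]; last by rewrite h3 ?par.
rewrite rq h1 par //; first by move: cr; rewrite rq; lia.
by rewrite xpair_eqE eqxx /= -val_eqE /=; move: cr; rewrite rq; lia.
Qed.

(** The quotient of the parabolic subgroup by [B] is a projective line: an affine
    line through the identity and the point of the swap. *)
Lemma parabolic_near_id (N : 'M[C]_m.+1) : parabolic p q N ->
  (exists z u, upper_triangular u /\ N = elem p q z *m u) \/
  (exists u, upper_triangular u /\ N = swapmx *m u).
Proof.
move=> par; case: (eqVneq (N q q) 0) => N0; last by left; exact: parabolic_decomp.
right; exists (swapmx *m N); split; last by rewrite mulmxA swapmxK mul1mx.
apply: (@parabolic_upper _ p q); first exact: parabolic_swap.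
by have [q' [_ _ -> _]] := swapmx_rows N.
Qed.

(** The same projective line with the identity as point at infinity. *)
Lemma parabolic_near_swap (N : 'M[C]_m.+1) : parabolic p q N ->
  upper_triangular N \/
  (exists z u, upper_triangular u /\ N = swapmx *m elem p q z *m u).
Proof.
move=> par; case: (eqVneq (N p q) 0) => N0; first by left; exact: parabolic_upper par N0.
right; have [|z [u [uu e]]] := parabolic_decomp (parabolic_swap par).
  by have [q' [_ -> _ _]] := swapmx_rows N.
by exists z, u; split => //; rewrite -mulmxA -e mulmxA swapmxK mul1mx.
Qed.

(** * The operators P_i on matrices *)

Lemma colspan_insmx_low (h : 'M[C]_m) j : (j < p)%N ->
  colspan (insmx q p h) j = (linfun (@insert0 C m p) @: colspan h j)%VS.
Proof.
move=> jp; rewrite limg_span -map_comp; apply: eq_span => v.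
apply/mapP/mapP => -[k]; rewrite mem_filter => /andP[kj _] ->.
  have [[k' E]|E] := lift_or p k; last by move: jp; rewrite E in kj; lia.
  exists k'; last by rewrite E col_insmx_lift /= lfunE /= pq.
  by rewrite mem_filter mem_enum andbT; move: kj; rewrite E /= /bump; lia.
exists (lift p k); last by rewrite col_insmx_lift /= lfunE /= pq.
by rewrite mem_filter mem_enum andbT /= /bump; lia.
Qed.

Lemma colspan_insmx_high (h : 'M[C]_m) j : (p < j)%N ->
  colspan (insmx q p h) j =
    (linfun (@insert0 C m p) @: colspan h j.-1 + <[delta_mx (inord p.-1) 0%R]>)%VS.
Proof.
move=> pj; rewrite limg_span -map_comp -span_seq1 -span_cat; apply: eq_span => v.
have -> : inord p.-1 = q by rewrite pq inord_val.
rewrite mem_cat; apply/idP/idP.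
  case/mapP => k; rewrite mem_filter => /andP[kj _] ->.
  have [[k' E]|->] := lift_or p k; last by rewrite col_insmx mem_head orbT.
  apply/orP; left; apply/mapP; exists k'; last by rewrite E col_insmx_lift /= lfunE /= pq.
  by rewrite mem_filter mem_enum andbT; move: kj; rewrite E /= /bump; lia.
case/orP.
  case/mapP => k; rewrite mem_filter => /andP[kj _] ->; apply/mapP.
  exists (lift p k); last by rewrite col_insmx_lift /= lfunE /= pq.
  by rewrite mem_filter mem_enum andbT /= /bump; lia.
rewrite inE => /eqP ->; apply/mapP; exists p; last by rewrite col_insmx.
by rewrite mem_filter mem_enum pj.
Qed.

(** The conditions on a flag of P_p Z prescribe all its subspaces but the one of
    dimension [p], so it differs from the flag of [insmx q p h] by an element of
    the parabolic subgroup.  The matrix [h] may be any matrix of the flag in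
    [Z], which matters when it has to be taken in a cell. *)
Lemma bbP_parabolic (Z : set (Fl C m)) (g : GL C m.+1) : bbP p Z (flag_of g) ->
  exists2 F, Z F & forall h : GL C m, F = flag_of h ->
    parabolic p q (invmx (insmx q p (\val h)) *m \val g).
Proof.
move=> [F ZF H]; exists F => // h E r c cr ne.
have inu := insmx_unit q p (GLunit h).
have {}H j : (j <= m.+1)%N -> j != p -> colspan (\val g) j = colspan (insmx q p (\val h)) j.
  move=> jm jp; have [H1 H2] := H j jm; rewrite -flag_spaceE.
  case: (ltngtP j p) => [lt|lt|e]; last by rewrite e eqxx in jp.
    by rewrite H1 // E flag_spaceE colspan_insmx_low.
  by rewrite H2 // E flag_spaceE colspan_insmx_high.
case: (eqVneq (r : nat) p) => rp.
  have : (c < q)%N by move: ne cr; rewrite xpair_eqE -!val_eqE /= rp eqxx /=; lia.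
  move=> cq; have qp : (q : nat) != p by rewrite pq ltn_eqF.
  apply: ((colspan_eqP q (GLunit g) inu).1 (H q (ltnW (ltn_ord q)) qp)) => //.
  by rewrite rp pq.
exact: ((colspan_eqP r (GLunit g) inu).1 (H r (ltnW (ltn_ord r)) rp)).
Qed.

Lemma bbP_P (Z : set (Fl C m)) (g : GL C m.+1) : bbP p Z (flag_of g) <->
  exists h : GL C m, Z (flag_of h) /\
    parabolic p q (invmx (insmx q p (\val h)) *m \val g).
Proof.
split=> [/bbP_parabolic [F ZF H]|[h [Zh par]]].
  by have [h E] := flag_of_surj F; exists h; rewrite -E; split=> //; exact: H.
exists (flag_of h) => // j jm; rewrite !flag_spaceE.
have inu := insmx_unit q p (GLunit h).
have E : j != p -> colspan (\val g) j = colspan (insmx q p (\val h)) j.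
  move=> jp; apply/colspan_eqP => //; first exact: GLunit.
  move=> r c cj jr; apply: par; first exact: leq_trans cj jr.
  by apply: contra jp; rewrite xpair_eqE => /andP[/eqP rp /eqP cq]; move: cj jr; rewrite rp cq pq; lia.
split=> lt; rewrite E ?flag_spaceE.
- exact: colspan_insmx_low.
- by rewrite ltn_eqF.
- exact: colspan_insmx_high.
- by rewrite gtn_eqF.
Qed.

End Simple.
End Elementary.

Section BBClosed.
Variable C : numClosedFieldType.
Variables (m : nat) (p q : 'I_m.+1) (q' : 'I_m).
Hypotheses (pq : p = q.+1 :> nat) (qq' : q' = q :> nat).

Let pNq : p != q. Proof. by rewrite -val_eqE /= pq; lia. Qed.
Let liftp_q' : lift p q' = q. Proof. by have [] := lift_swap pq qq'. Qed.

(** A matrix of the flag in [Z] under a flag of P_p Z.  The row [q] is deleted;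
    of the columns [q] and [p] there remains the combination that has a zero in
    the row [q]. *)
Definition contract (g : 'M[C]_m.+1) : 'M[C]_m := \matrix_(r, k)
  if k == q' then g q p * g (lift q r) q - g q q * g (lift q r) p
  else g (lift q r) (lift p k).

Lemma polyfun_contract r k : polyfun (fun g => contract g r k).
Proof.
rewrite (_ : (fun g => _) = fun g : 'M[C]_m.+1 =>
  if k == q' then g q p * g (lift q r) q - g q q * g (lift q r) p
  else g (lift q r) (lift p k)); last by apply/funext => g; rewrite mxE.
case: eqP => _; last exact: polyfun_coord.
by apply: polyfunB; apply: polyfunM; exact: polyfun_coord.
Qed.

(** The subspace of dimension [q] has zero [q]-th coordinates, and the subspace
    of dimension [p.+1] contains [e_q]; by Cramer's rule the latter is the
    vanishing of entries of the adjugate matrix. *)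
Definition bb_equations (g : 'M[C]_m.+1) :=
  (forall c : 'I_m.+1, (c < q)%N -> g q c = 0) /\
  (forall k : 'I_m.+1, (p < k)%N -> (\adj g) k q = 0).

Lemma insmx_unitE (h : 'M[C]_m) : insmx q p h \in unitmx -> h \in unitmx.
Proof.
move=> u; pose X := invmx (insmx q p h).
apply: (mulmx1_unit (B := \matrix_(r, c) X (lift p r) (lift q c)) _).1.
apply/matrixP => r c; have := mulmxV u => /matrixP /(_ (lift q r) (lift q c)).
rewrite !mxE (sum_lift p) insmxE mul0r add0r (inj_eq lift_inj) => <-.
by apply: eq_bigr => k _; rewrite insmxE mxE.
Qed.

(** Let [v] be the coordinates of [e_q] in the columns of [g], and [x], [y] the
    entries of [g] in row [q] and columns [q], [p].  Then [x v_q + y v_p = 1],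
    and this relation expresses the columns [q] and [p] of [g] by the earlier
    ones, the column [q] of the contraction and [e_q]: this is [N] below. *)
Lemma contract_parabolic (g : 'M[C]_m.+1) : g \in unitmx -> bb_equations g ->
  exists N, [/\ parabolic p q N, g = insmx q p (contract g) *m N &
    contract g \in unitmx].
Proof.
move=> gu [e1 e2]; pose v (k : 'I_m.+1) : C := invmx g k q.
have v0 (k : 'I_m.+1) : (p < k)%N -> v k = 0.
  by move=> pk; rewrite /v /invmx gu mxE e2 // mulr0.
have gv r : \sum_k g r k * v k = (r == q)%:R.
  by have := mulmxV gu => /matrixP /(_ r q); rewrite !mxE.
pose x := g q q; pose y := g q p.
have xy : x * v q + y * v p = 1.
  have := gv q; rewrite eqxx (sum_lift p) (bigD1 q') //= liftp_q' big1 ?addr0.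
    by rewrite addrC.
  move=> k kq; case: (ltngtP k q') => [lt|lt|/val_inj e]; last by rewrite e eqxx in kq.
    by rewrite e1 ?mul0r //= /bump; lia.
  by rewrite v0 ?mulr0 //= /bump; lia.
(* The rows other than [q] of the equation [g v = e_q]. *)
have rel r : g (lift q r) p * v p + g (lift q r) q * v q +
    \sum_(k < m | k != q') g (lift q r) (lift p k) * v (lift p k) = 0.
  have := gv (lift q r); rewrite (sum_lift p) (bigD1 q') //= liftp_q' addrA => ->.
  by rewrite eq_sym (negbTE (neq_lift _ _)).
pose N : 'M[C]_m.+1 := \matrix_(r, c)
  if c == q then (if r == p then x else if r == q then v p else - (x * v r))
  else if c == p then (if r == p then y else if r == q then - v q else - (y * v r))
  else if r == p then g q c else (r == c)%:R.
have NE : g = insmx q p (contract g) *m N.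
  apply/matrixP => r c; rewrite mxE (sum_lift p).
  have pl k : (lift p k == p) = false by rewrite eq_sym (negbTE (neq_lift _ _)).
  have plq k : (lift p k == q) = (k == q') by rewrite -liftp_q' (inj_eq lift_inj).
  have [[r' ->]|->] := lift_or q r; last first.
    rewrite insmxE mul1r big1 ?addr0 => [|k _]; last by rewrite insmxE mul0r.
    by rewrite mxE eqxx; case: eqP => [->//|_]; case: eqP => [->|].
  rewrite insmxE mul0r add0r.
  case: (eqVneq c q) => [->|cq].
    rewrite (bigD1 q') //= insmxE !mxE liftp_q' !eqxx eq_sym (negbTE pNq).
    have -> : \sum_(i < m | i != q') insmx q p (contract g) (lift q r') (lift p i) * N (lift p i) q =
      - x * \sum_(k < m | k != q') g (lift q r') (lift p k) * v (lift p k).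
      rewrite mulr_sumr; apply: eq_bigr => k /negbTE kq.
      by rewrite insmxE !mxE eqxx pl plq kq; ring.
    have R := rel r'; rewrite -/x -/y.
    set T := \sum_(k < m | k != q') _ in R *.
    have -> : T = - (g (lift q r') p * v p + g (lift q r') q * v q).
      by apply/eqP; rewrite -addr_eq0 addrC R.
    rewrite -[LHS]mulr1 -xy. ring.
  case: (eqVneq c p) => [->|cp].
    rewrite (bigD1 q') //= insmxE !mxE liftp_q' !eqxx (negbTE pNq) eq_sym (negbTE pNq).
    have -> : \sum_(i < m | i != q') insmx q p (contract g) (lift q r') (lift p i) * N (lift p i) p =
      - y * \sum_(k < m | k != q') g (lift q r') (lift p k) * v (lift p k).
      rewrite mulr_sumr; apply: eq_bigr => k /negbTE kq.
      by rewrite insmxE !mxE (negbTE pNq) eqxx pl plq kq; ring.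
    have R := rel r'; rewrite -/x -/y.
    set T := \sum_(k < m | k != q') _ in R *.
    have -> : T = - (g (lift q r') p * v p + g (lift q r') q * v q).
      by apply/eqP; rewrite -addr_eq0 addrC R.
    rewrite -[LHS]mulr1 -xy; ring.
  have [[c' E]|E] := lift_or p c; last by rewrite E eqxx in cp.
  have c'q : c' != q' by rewrite -plq -E.
  rewrite (bigD1 c') //= insmxE !mxE (negbTE c'q) -E (negbTE cq) (negbTE cp) eqxx mulr1.
  rewrite big1 ?addr0 // => k kc; rewrite !mxE (negbTE cq) (negbTE cp) pl.
  by rewrite E (inj_eq lift_inj) (negbTE kc) mulr0.
exists N; split=> //.
  move=> r c cr ne; rewrite mxE.
  case: (eqVneq c q) => [cq|cq].
    have rp : (p < r)%N by move: ne cr; rewrite cq xpair_eqE eqxx andbT -val_eqE /=; lia.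
    rewrite -!val_eqE /= !gtn_eqF ?v0 ?mulr0 ?oppr0 //; lia.
  case: (eqVneq c p) => [cp|cp].
    have rp : (p < r)%N by move: cr; rewrite cp.
    rewrite -!val_eqE /= !gtn_eqF ?v0 ?mulr0 ?oppr0 //; lia.
  case: (eqVneq r p) => [rp|rp]; last by rewrite -val_eqE /= gtn_eqF.
  by rewrite e1 //; move: cq cr; rewrite rp -val_eqE /=; lia.
by move: gu; rewrite {1}NE unitmx_mul => /andP[/insmx_unitE].
Qed.

(** The last equations hold because [g] is [A *m u] with [u] upper triangular and
    [A] having [e_q] among its first [p.+1] columns. *)
Lemma bbP_equations (h : GL C m) (g : GL C m.+1) :
  parabolic p q (invmx (insmx q p (\val h)) *m \val g) ->
  bb_equations (\val g) /\ exists2 u, upper_triangular u & contract (\val g) = \val h *m u.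
Proof.
have inu := insmx_unit q p (GLunit h).
set N := invmx _ *m _ => par; have gE : \val g = insmx q p (\val h) *m N by rewrite mulKVmx.
clearbody N.
have gq c : \val g q c = N p c.
  rewrite gE mxE (sum_lift p) insmxE mul1r big1 ?addr0 // => k _.
  by rewrite insmxE mul0r.
have gl r c : \val g (lift q r) c = \sum_k \val h r k * N (lift p k) c.
  by rewrite gE mxE (sum_lift p) insmxE mul0r add0r; apply: eq_bigr => k _; rewrite insmxE.
split; first split.
- move=> c cq; rewrite gq par //; first lia.
  by rewrite xpair_eqE eqxx /= -val_eqE /=; lia.
- move=> k pk; suff : invmx (\val g) k q = 0.
    rewrite /invmx GLunit mxE => /eqP; rewrite mulf_eq0 => /orP[|/eqP //].
    by rewrite invr_eq0 => /eqP d0; have := GLunit g; rewrite unitmxE d0 unitr0.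
  have [A [u [uu E Aq]]] : exists A u, [/\ upper_triangular u, \val g = A *m u &
     exists2 s : 'I_m.+1, (s <= p)%N & forall r, A r s = (r == q)%:R].
    have colq (r : 'I_m.+1) : insmx q p (\val h) r p = (r == q)%:R.
      have [[r' ->]|->] := lift_or q r; rewrite insmxE ?eqxx //.
      by rewrite eq_sym (negbTE (neq_lift _ _)).
    case: (parabolic_near_id pq par) => [[z [u [uu E]]]|[u [uu E]]].
      exists (insmx q p (\val h) *m elem p q z), u; split=> //; first by rewrite gE E mulmxA.
      by exists p => // r; rewrite mulmx_elem (negbTE pNq) mulr0n mulr0 addr0 colq.
    exists (insmx q p (\val h) *m swapmx C p q), u; split=> //; first by rewrite gE E mulmxA.
    exists q; first by rewrite pq.
    move=> r; rewrite insmxM mulmx1; have [[r' ->]|->] := lift_or q r; rewrite insmxE ?eqxx //.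
    by rewrite eq_sym (negbTE (neq_lift _ _)).
  case: Aq => s sp As; have := GLunit g; rewrite E unitmx_mul => /andP[Au uu'].
  have -> : invmx (A *m u) = invmx u *m invmx A.
    apply: (can_inj (mulKmx (x := A *m u) _)); first by rewrite unitmx_mul Au.
    by rewrite mulmxV ?unitmx_mul ?Au // mulmxA mulmxK // mulmxV.
  have /upper_triangularP ui := upper_triangular_inv uu' uu.
  have iA r : invmx A r q = (r == s)%:R.
    have := mulVmx Au => /matrixP /(_ r s); rewrite !mxE => <-.
    rewrite (bigD1 q) //= As eqxx mulr1 big1 ?addr0 // => j jq.
    by rewrite As (negbTE jq) mulr0.
  rewrite mxE big1 // => j _; rewrite iA; case: eqP => [->|]; rewrite ?mulr0 //.
  by rewrite ui ?mul0r //; apply: leq_ltn_trans sp pk.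
exists (\matrix_(j, k) if k == q' then N p p * N (lift p j) q - N p q * N (lift p j) p
    else N (lift p j) (lift p k)).
  apply/upper_triangularP => j k jk; rewrite mxE; case: eqP => [e|/eqP ne].
    rewrite e in jk *. 
    by rewrite ![N (lift p k) _]par ?mulr0 ?subrr // ?xpair_eqE -?val_eqE /= /bump; lia.
  rewrite par //; first by rewrite lift_lt.
  by rewrite xpair_eqE eq_sym (negbTE (neq_lift _ _)).
apply/matrixP => r k; rewrite !mxE; case: eqP => [e|/eqP ne].
  rewrite !gq !gl !mulr_sumr -sumrB; apply: eq_bigr => j _.
  by rewrite mxE e eqxx; ring.
by rewrite gl; apply: eq_bigr => j _; rewrite mxE (negbTE ne).
Qed.

(** The equations of [Z] are pulled back by the polynomial map [contract]. *)
Lemma bbP_closed (Z : set (Fl C m)) : zclosed (X := Fl_variety C m) Z ->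
  zclosed (X := Fl_variety C m.+1) (bbP p Z).
Proof.
move=> /zclosed_FlP [S [Sp SZ]].
pose S1 := [set f : 'M[C]_m.+1 -> C | exists2 c : 'I_m.+1, (c < q)%N & f = fun g => g q c].
pose S2 := [set f : 'M[C]_m.+1 -> C | exists2 k : 'I_m.+1, (p < k)%N & f = fun g => (\adj g) k q].
pose S3 := [set f : 'M[C]_m.+1 -> C | exists2 f' , S f' & f = fun g => f' (contract g)].
apply: (@zclosed_Fl _ _ _ (S1 `|` S2 `|` S3)).
  move=> f [[[c _ ->]|[k _ ->]]|[f' Sf ->]].
  - exact: polyfun_coord.
  - by apply: polyfun_adj => i j; exact: polyfun_coord.
  - by apply: polyfun_comp; [exact: polyfun_contract|exact: Sp].
move=> g; rewrite (bbP_P pq); split.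
  move=> [h [Zh par]]; have [eqs [u uu cE]] := bbP_equations par.
  have [N [_ _ cu]] := contract_parabolic (GLunit g) eqs.
  move=> f [[[c cq ->]|[k pk ->]]|[f' Sf ->]]; [exact: eqs.1|exact: eqs.2|].
  have -> : contract (\val g) = \val (GLmk cu) by [].
  by apply: (SZ _).1 => //; rewrite (@flag_of_mulmx _ _ _ h u).
move=> H; have eqs : bb_equations (\val g).
  split=> [c cq|k pk].
    by apply: (H (fun g => g q c)); left; left; exists c.
  by apply: (H (fun g => (\adj g) k q)); left; right; exists k.
have [N [par E cu]] := contract_parabolic (GLunit g) eqs.
exists (GLmk cu); split.
  apply/SZ => f Sf; apply: (H (fun g => f (contract g))).
  by right; exists f.
rewrite /= {2}E mulmxA mulVmx ?mul1mx //.
exact: insmx_unit.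
Qed.
End BBClosed.

(** * The cells and the bundles P_i *)

Section Cells.
Variable C : numClosedFieldType.

Lemma M_NC0 n (w : 'S_n) (A : 'M[C]_n) i j :
  M_NC w A -> j != i -> (i, j) \notin NC_inversions w -> A (w j) i = 0.
Proof. by move=> [_ H] ji; apply: H; rewrite eq_sym. Qed.

(** The column [p] is a unit vector, and its entry is in the row of a free
    position of the column [q]. *)
Lemma M_NC_elem n (w : 'S_n) (A : 'M[C]_n) (p q : 'I_n) z :
  (q, p) \in NC_inversions w -> (w p < p)%N -> M_NC w A -> M_NC w (A *m elem p q z).
Proof.
move=> qp wp MA; have := qp; rewrite NC_invE => /and3P[qltp _ _].
have desc j : j != p -> A (w j) p = 0.
  by move=> jp; apply: (M_NC0 MA) => //; exact: NC_inv_descent.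
split=> [i|i j ij nij]; rewrite mulmx_elem.
  rewrite MA.1; case: (eqVneq i q) => [->|_]; last by rewrite mulr0 addr0.
  by rewrite desc ?mulr0 ?addr0 // -val_eqE /= ltn_eqF.
rewrite MA.2 // add0r; case: (eqVneq i q) => [iq|_]; last by rewrite mulr0.
by rewrite desc ?mulr0 //; apply: contraNneq nij => ->; rewrite iq.
Qed.

Section InsertCells.
Variables (m : nat) (p q : 'I_m.+1).
Hypothesis pq : (q <= p <= q.+1)%N.

Lemma M_NC_insmx (w : 'S_m) (h : 'M[C]_m) :
  M_NC (lift_perm p q w) (insmx q p h) <-> M_NC w h.
Proof.
split=> -[H1 H2]; split.
- by move=> i; have := H1 (lift p i); rewrite lift_perm_lift insmx_lift.
- move=> i j ij nij; have := H2 (lift p i) (lift p j).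
  by rewrite (inj_eq lift_inj) NC_inversions_lift // lift_perm_lift insmx_lift; exact.
- move=> i; have [[i' ->]|->] := lift_or p i.
    by rewrite lift_perm_lift insmx_lift.
  by rewrite lift_perm_id insmx_pivot.
- move=> i j; have [[i' ->]|->] := lift_or p i; have [[j' ->]|->] := lift_or p j;
    rewrite ?lift_perm_lift ?lift_perm_id ?insmxE //.
    by rewrite (inj_eq lift_inj) NC_inversions_lift //; exact: H2.
  by rewrite eqxx.
Qed.
End InsertCells.

Section StepCells.
Variables (m : nat) (p q : 'I_m.+1) (q' : 'I_m).
Hypotheses (pq : p = q.+1 :> nat) (qq' : q' = q :> nat).

Let pNq : p != q. Proof. by rewrite -val_eqE /= pq; lia. Qed.
Let pqB : (q <= p <= q.+1)%N. Proof. by rewrite pq leqnn leqnSn. Qed.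
Let pqA : (q <= q <= q.+1)%N. Proof. by rewrite leqnn leqnSn. Qed.

Lemma NC_swap_insert (w : 'S_m) : w \in NC m ->
  (tperm q p * lift_perm q q w)%g \in NC m.+1 /\ (tperm q p * lift_perm p q w)%g \in NC m.+1.
Proof.
move=> wNC; split; first by rewrite tperm_lift_perm // NC_lift.
by rewrite -(tperm_lift_perm pq) mulgA tperm2 mul1g NC_lift.
Qed.

Lemma lift_permA_p (w : 'S_m) : lift_perm q q w p = lift q (w q').
Proof. by have [<- _] := lift_swap pq qq'; rewrite lift_perm_lift. Qed.

Lemma lift_permB_q (w : 'S_m) : lift_perm p q w q = lift q (w q').
Proof. by have [_ <-] := lift_swap pq qq'; rewrite lift_perm_lift. Qed.

(** The values of the two insertions at [q] and [p] are exchanged, so exactly one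
    of them is the longer one; the right summand is the case [q <= w q']. *)
Lemma insert_dichotomy (w : 'S_m) : w \in NC m ->
  ((q, p) \in NC_inversions (lift_perm q q w) /\ (lift_perm q q w p < p)%N) \/
  ((q, p) \in NC_inversions (lift_perm p q w) /\ (lift_perm p q w p < p)%N).
Proof.
move=> /NC_swap_insert [hA hB]; rewrite !NC_invE hA hB lift_permA_p lift_permB_q !lift_perm_id !andbT.
by rewrite /= /bump; case: (ltnP (w q') q) => h; [left|right]; lia.
Qed.

Lemma NC_cell_flag n (w : 'S_n) (g : GL C n) : M_NC w (\val g) -> NC_cell w (flag_of g).
Proof. by exists g. Qed.

(** Each fibre is a projective line.  The point at infinity is chosen to be the
    section formed by the shorter insertion; the other points are obtained from
    the longer one by the elementary matrices, which preserve its cell. *)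
Lemma bbP_cell (w : 'S_m) : w \in NC m ->
  @bbP C m p (NC_cell w) `<=` NC_cell (lift_perm q q w) `|` NC_cell (lift_perm p q w).
Proof.
move=> wNC F; have [g ->] := flag_of_surj F.
move=> /(bbP_parabolic pq) [_ [h Mh <-] /(_ h erefl) par].
have gE : \val g = insmx q p (\val h) *m (invmx (insmx q p (\val h)) *m \val g).
  by rewrite mulKVmx // insmx_unit // GLunit.
set N := invmx _ *m _ in par gE.
have MA : M_NC (lift_perm q q w) (\val (GLins q q h)) by apply/M_NC_insmx.
have MB : M_NC (lift_perm p q w) (\val (GLins q p h)) by apply/M_NC_insmx.
have elu (A : GL C m.+1) z : \val A *m elem p q z \in unitmx.
  by rewrite unitmx_mul GLunit elem_unit.
have swapE : insmx q p (\val h) *m swapmx C p q = insmx q q (\val h).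
  by rewrite insmxM mulmx1.
case: (insert_dichotomy wNC) => [[qp wp]|[qp wp]].
  case: (parabolic_near_swap pq par) => [ut|[z [u [uu e]]]].
    right; rewrite (@flag_of_mulmx _ _ _ (GLins q p h) N) //.
    exact: NC_cell_flag.
  left; rewrite (@flag_of_mulmx _ _ _ (GLmk (elu (GLins q q h) z)) u) //.
    by apply: NC_cell_flag; exact: M_NC_elem.
  by rewrite gE e /= !mulmxA swapE.
case: (parabolic_near_id pq par) => [[z [u [uu e]]]|[u [uu e]]].
  right; rewrite (@flag_of_mulmx _ _ _ (GLmk (elu (GLins q p h) z)) u) //.
    by apply: NC_cell_flag; exact: M_NC_elem.
  by rewrite gE e /= !mulmxA.
left; rewrite (@flag_of_mulmx _ _ _ (GLins q q h) u) //.
  exact: NC_cell_flag.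
by rewrite gE e /= !mulmxA swapE.
Qed.

(** Removing the entry in row [w p] and column [q] by an elementary matrix leaves
    a matrix whose new row and new column vanish off the pivot. *)
Lemma NC_cell_bbP (w : 'S_m.+1) : w \in NC m.+1 ->
  (w p = q /\ (q < w q)%N) \/ (w q = q /\ (w p < q)%N) ->
  exists w' : 'S_m, [/\ w' \in NC m, w = lift_perm q q w' \/ w = lift_perm p q w',
    (q, p) \in NC_inversions w & NC_cell w `<=` @bbP C m p (NC_cell w')].
Proof.
move=> wNC H.
have [s [w' [sE wE w'NC]]] : exists s w', [/\ s = q \/ s = p, w = lift_perm s q w' & w' \in NC m].
  case: H => -[wq _]; have [w' E] := lift_perm_surj wq.
    by exists p, w'; split; [right| |move: wNC; rewrite E NC_lift].
  by exists q, w'; split; [left| |move: wNC; rewrite E NC_lift].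
have qp : (q, p) \in NC_inversions w.
  rewrite NC_invE pq ltnSn /=; have [hA hB] := NC_swap_insert w'NC.
  have -> : (tperm q p * w)%g \in NC m.+1 by rewrite wE; case: sE => ->.
  by rewrite andbT; case: H => -[-> ].
have wp : (w p < p)%N by case: H => -[]; [move=> ->; rewrite pq|rewrite pq; lia].
exists w'; split=> //; first by rewrite wE; case: sE => ->; [left|right].
move=> _ [g Mg <-]; pose z := \val g (w p) q.
pose A := \val g *m elem p q (- z); have MA : M_NC w A by exact: M_NC_elem.
(* [z] is the coordinate on the fibre. *)
have Awp : A (w p) q = 0.
  by rewrite mulmx_elem eqxx mulr1n Mg.1 mulr1 subrr.
have gA : \val g = A *m elem p q z.
  rewrite -mulmxA; have := elemK (- z) pNq; rewrite opprK => ->.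
  by rewrite mulmx1.
clearbody A.
have AE : A = insmx q s (\matrix_(r, c) A (lift q r) (lift s c)).
  have wsq : w s = q by rewrite wE lift_perm_id.
  have col j : j != s -> A (w j) s = 0.
    move=> js; case: H sE => -[e1 e2] [] es; rewrite es in wsq js *.
    - by move: e2; rewrite wsq ltnn.
    - by apply: (M_NC0 MA) => //; exact: NC_inv_descent.
    - case: (eqVneq j p) => [->//|jp]; apply: (M_NC0 MA) => //.
      by apply: contra jp => /(NC_inv_fixed_col pq wNC e1 e2) ->.
    - by move: e2; rewrite wsq ltnn.
  have row i : i != s -> A q i = 0.
    rewrite -{1}wsq => is_; case: H sE => -[e1 e2] [] es; rewrite es in wsq is_ *.
    - by move: e2; rewrite wsq ltnn.
    - case: (eqVneq i q) => [->//|iq]; apply: (M_NC0 MA); first by rewrite eq_sym.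
      by apply: contra iq => /(NC_inv_row_last pq wNC e1 e2) ->.
    - by apply: (M_NC0 MA); rewrite 1?eq_sym //; exact: NC_inv_fixed_row pq e1 e2.
    - by move: e2; rewrite wsq ltnn.
  apply/matrixP => r c; have [[r' ->]|->] := lift_or q r; have [[c' ->]|->] := lift_or s c;
    rewrite !insmxE ?mxE //.
  - have -> : lift q r' = w (w^-1 (lift q r'))%g by rewrite permKV.
    rewrite col //; apply: contraNneq (neq_lift q r') => e.
    by rewrite -[lift q r'](permKV w) e wsq.
  - by rewrite row // eq_sym neq_lift.
  - by rewrite -{1}wsq MA.1.
set h := \matrix_(r, c) _ in AE.
have gu := GLunit g; have Au : A \in unitmx by move: gu; rewrite gA unitmx_mul => /andP[].
have hu : h \in unitmx.
  move: Au; rewrite AE => Au; apply: (@insmx_unitE _ _ p q).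
  rewrite (_ : insmx q p h = insmx q s h *m insmx s p 1%:M); last by rewrite insmxM mulmx1.
  by rewrite unitmx_mul Au insmx_unit // unitmx1.
have Mh : M_NC w' h.
  by apply/(@M_NC_insmx _ s q); [case: sE => ->|rewrite -AE -wE].
apply/(bbP_P pq); exists (GLmk hu); split; first exact: NC_cell_flag.
rewrite gA AE mulmxA /=; case: sE => ->.
  have -> : invmx (insmx q p h) *m insmx q q h = swapmx C p q.
    apply: (can_inj (mulKmx (insmx_unit q p hu))).
    by rewrite mulKVmx ?insmx_unit // insmxM mulmx1.
  by apply: parabolic_swap => //; exact: parabolic_elem.
by rewrite mulVmx ?insmx_unit // mul1mx; exact: parabolic_elem.
Qed.
End StepCells.

Lemma insert_index m i : (0 < i <= m)%N -> exists (p q : 'I_m.+1) (q' : 'I_m),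
  [/\ p = i :> nat, p = q.+1 :> nat & q' = q :> nat].
Proof.
move=> im; have h1 : (i < m.+1)%N by lia.
have h2 : (i.-1 < m.+1)%N by lia.
have h3 : (i.-1 < m)%N by lia.
by exists (Ordinal h1), (Ordinal h2), (Ordinal h3); split=> //=; lia.
Qed.

Lemma NC_reducible_index m (w : 'S_m.+1) : w \in NC m.+1 -> w != 1%g ->
  exists (p q : 'I_m.+1) (q' : 'I_m), [/\ p = q.+1 :> nat, q' = q :> nat &
    (w p = q /\ (q < w q)%N) \/ (w q = q /\ (w p < q)%N)].
Proof.
move=> wNC /(NC_reducible wNC) [q [p [pq H]]].
have h3 : (q < m)%N by have := ltn_ord p; lia.
by exists p, q, (Ordinal h3).
Qed.

Lemma M_NC1 n (A : 'M[C]_n) : M_NC 1%g A <-> A = 1%:M.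
Proof.
have inv0 i j : (i, j) \notin NC_inversions (1%g : 'S_n).
  by rewrite NC_invE !perm1; apply/negP => /and3P[]; lia.
split=> [[H1 H2]|->].
  apply/matrixP => i j; rewrite mxE; case: eqVneq => [->|ij].
    by have := H1 j; rewrite perm1.
  by have := H2 j i; rewrite perm1 => -> //; rewrite eq_sym.
split=> [i|i j ij _]; rewrite perm1 mxE ?eqxx //.
by rewrite eq_sym (negbTE ij).
Qed.

Lemma NC_cell1 n : NC_cell 1%g = [set flag_of (GLmk (unitmx1 C n))].
Proof.
rewrite predeqE => F; split=> [[g /M_NC1 E <-] /=|->].
  by congr flag_of; exact: GL_inj.
by apply: NC_cell_flag; apply/M_NC1.
Qed.

(** For [w != 1], the closed set is obtained by applying P_p to the one of the
    smaller permutation [w'].  It only meets cells of insertions of elements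
    below [w']; these are below the insertions of [w'], hence below [w]. *)
Lemma NC_cell_closure n (w : 'S_n) : w \in NC n ->
  exists Y : set (Fl C n), [/\ zclosed (X := Fl_variety C n) Y, NC_cell w `<=` Y &
    forall F, Y F -> exists v, [/\ v \in NC n, bruhat v w & NC_cell v F]].
Proof.
elim: n w => [|m IH] w wNC.
  exists setT; split=> //.
    by apply: (@zclosed_Fl _ _ _ set0) => // g.
  move=> F _; exists w; split=> //; first exact: bruhat_refl.
  have [g ->] := flag_of_surj F; apply: NC_cell_flag.
  by split=> -[].
case: (eqVneq w 1%g) => [->|w1].
  exists (NC_cell 1%g); split=> //; last first.
    by move=> F cF; exists 1%g; split; [exact: NC1|exact: bruhat_refl|].
  rewrite NC_cell1.
  apply: (@zclosed_Fl _ _ _ [set f : 'M[C]_m.+1 -> C |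
    exists r c : 'I_m.+1, (c < r)%N /\ f = fun g => g r c]).
    by move=> _ [r [c [_ ->]]]; exact: polyfun_coord.
  move=> g /=; split=> [/esym /flag_ofP /=|H].
    rewrite invmx1 mul1mx => /upper_triangularP H _ [r [c [cr ->]]]; exact: H.
  apply: (@flag_of_mulmx _ _ _ _ (\val g)); first by rewrite mul1mx.
  by apply/upper_triangularP => i j ij; apply: (H (fun g => g j i)); exists j, i.
have [p [q [q' [pq qq' H]]]] := NC_reducible_index wNC w1.
have [w' [w'NC wE qp cw]] := NC_cell_bbP pq qq' wNC H.
have [Y [Ycl cY Yc]] := IH w' w'NC; exists (bbP p Y); split.
- exact: (bbP_closed pq qq').
- move=> F /cw; rewrite /bbP /= => -[G cG HG]; exists G => //; exact: cY.
move=> F [G YG HG]; have [v [vNC vw cG]] := Yc G YG.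
have bF : @bbP C m p (NC_cell v) F by exists G.
have pqB : (q <= p <= q.+1)%N by rewrite pq leqnn leqnSn.
have pqA : (q <= q <= q.+1)%N by rewrite leqnn leqnSn.
have AB := tperm_lift_perm pq w'.
have [longA longB] : bruhat (lift_perm q q w') w /\ bruhat (lift_perm p q w') w.
  move: qp; rewrite NC_invE => /and3P[qltp wqp _].
  have step : bruhat (tperm q p * w)%g w by exact: bruhat_tperm_inv.
  case: wE step => ->; first by rewrite AB; split=> //; exact: bruhat_refl.
  by rewrite -{1}AB mulgA tperm2 mul1g; split=> //; exact: bruhat_refl.
have [cA|cB] := bbP_cell pq qq' vNC bF.
  exists (lift_perm q q v); split=> //; first by rewrite NC_lift.
  exact: bruhat_trans (bruhat_lift pqA vw) longA.
exists (lift_perm p q v); split=> //; first by rewrite NC_lift.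
exact: bruhat_trans (bruhat_lift pqB vw) longB.
Qed.

Lemma QFl_step m (F : Fl C m.+2) : QFl C m.+2 F <->
  exists i, (0 < i <= m.+1)%N /\ @bbP C m.+1 i (QFl C m.+1) F.
Proof.
split=> [[s sP /=] [G GF H]|[i [im [G [s sP GF] H]]]].
  by exists (s m.+1); split; [exact: sP|exists G => //; exists s].
exists (fun j => if j == m.+1 then i else s j).
  by move=> j j0 /=; case: eqP => [->|_] //; exact: sP.
have itE k (s1 s2 : nat -> nat) : (forall j, (j < k)%N -> s1 j = s2 j) ->
    @bbP_iter C s1 k = @bbP_iter C s2 k.
  elim: k => [//|k IH] E /=; rewrite E // IH // => j jk; apply: E; exact: ltnW.
change (@bbP C m.+1 (if m.+1 == m.+1 then i else s m.+1)
  (@bbP_iter C (fun j => if j == m.+1 then i else s j) m.+1) F).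
rewrite eqxx; exists G => //.
by rewrite (itE _ _ s) // => j jm; rewrite ltn_eqF.
Qed.

Lemma QFl1 : QFl C 1 = setT.
Proof.
rewrite predeqE => F; split=> // _; exists id => //.
by move=> j /= j0; rewrite j0 leqnn.
Qed.

(** One inclusion is [bbP_cell]; for the other, all cells except that of the
    identity are reached by [NC_cell_bbP], and the identity matrix is an
    insertion into the identity matrix. *)
Lemma QFl_cells n : (0 < n)%N -> QFl C n = \bigcup_(w in [set w | w \in NC n]) NC_cell w.
Proof.
case: n => // m _; elim: m => [|m IH].
  rewrite QFl1 predeqE => F; split=> // _; exists 1%g; first exact: NC1.
  rewrite NC_cell1 /=; have [g ->] := flag_of_surj F.
  apply: (@flag_of_mulmx _ _ _ _ (\val g)); first by rewrite mul1mx.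
  by apply/upper_triangularP => i j; rewrite !ord1.
rewrite predeqE => F; split.
  move/QFl_step => [i [im]]; rewrite IH.
  have [p [q [q' [<- pq qq']]]] := insert_index im.
  move=> [G [w wNC cG] H]; have [|cA|cB] := bbP_cell pq qq' wNC (t := F).
  - by exists G.
  - by exists (lift_perm q q w) => //=; rewrite NC_lift // leqnn leqnSn.
  - by exists (lift_perm p q w) => //=; rewrite NC_lift // pq leqnn leqnSn.
move=> [w /= wNC cF]; apply/QFl_step.
case: (eqVneq w 1%g) => [w1|w1].
  have [p [q [q' [p1 pq qq']]]] := @insert_index m.+1 1 isT.
  exists 1%N; split=> //; move: cF; rewrite w1 NC_cell1 /= => ->; rewrite -p1.
  apply/(bbP_P pq); exists (GLmk (unitmx1 C _)); split.
    by rewrite IH; exists 1%g; [exact: NC1|rewrite NC_cell1].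
  rewrite /= mulmx1 => r c cr ne.
  have -> : invmx (insmx q p 1%:M) = insmx p q (1%:M : 'M[C]_m.+1).
    rewrite -[RHS](mulKmx (insmx_unit q p (unitmx1 C _))) insmxM mulmx1 insmx1.
    by rewrite mulmx1.
  rewrite -/(swapmx C p q) -[swapmx C p q]mulmx1.
  apply: (parabolic_swap pq) cr ne => i j ij _.
  by rewrite mxE -val_eqE /= gtn_eqF.
have [p [q [q' [pq qq' H]]]] := NC_reducible_index wNC w1.
have [w' [w'NC wE qp cw]] := NC_cell_bbP pq qq' wNC H.
have pm : (p <= m.+1)%N := ltn_ord p.
exists p; split; first by rewrite pm andbT pq.
have [G cG HG] := cw _ cF; exists G => //.
by rewrite IH; exists w'.
Qed.

Lemma M_NC_row n (w : 'S_n) (A : 'M[C]_n) (i j : 'I_n) : M_NC w A -> (j < i)%N -> A (w j) i = 0.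
Proof.
move=> MA ji; apply: (M_NC0 MA); first by rewrite -val_eqE /= ltn_eqF.
by rewrite NC_invE; apply/negP => /and3P[]; lia.
Qed.

Lemma M_NC_pivot n (w : 'S_n) (A : 'M[C]_n) (i r : 'I_n) : M_NC w A -> A r i != 0 -> (r <= w i)%N.
Proof.
move=> MA; rewrite -[r](permKV w); set j := (w^-1)%g r.
case: (eqVneq j i) => [->//|ji] /eqP A0; rewrite leqNgt; apply/negP => lt; apply: A0.
by apply: (M_NC0 MA) => //; rewrite NC_invE; apply/negP => /and3P[]; lia.
Qed.

(** If [w] and [v] agree before [i], then both columns [i] vanish in the earlier
    pivot rows, so no earlier column can be added.  The columns are therefore
    proportional, and the pivot is the lowest nonzero entry. *)
Lemma NC_cell_disjoint n (w v : 'S_n) (F : Fl C n) : NC_cell w F -> NC_cell v F -> w = v.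
Proof.
move=> [g Mg <-] [h Mh] /esym /flag_ofP /=; set u := invmx _ *m _ => /upper_triangularP ut.
have hE : \val h = \val g *m u by rewrite mulKVmx // GLunit.
have hu := GLunit h; clearbody u.
suff H k (i : 'I_n) : (i < k)%N -> w i = v i by apply/permP => i; exact: (H i.+1 i).
elim: k i => // k IH i; rewrite ltnS => ik.
have {}IH (j : 'I_n) : (j < i)%N -> w j = v j by move=> ji; apply: IH; exact: leq_trans ji ik.
have u0 l (j : 'I_n) : (j < l)%N -> (j < i)%N -> u j i = 0.
  elim: l j => // l IHl j; rewrite ltnS => jl ji.
  have := M_NC_row Mh ji; rewrite -IH // hE mxE (bigD1 j) //= Mg.1 mul1r big1 ?addr0 // => a aj.
  case: (ltngtP a j) => [lt|lt|/val_inj e]; last by rewrite e eqxx in aj.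
    by rewrite IHl ?mulr0 //; [exact: leq_trans lt jl|exact: ltn_trans lt ji].
  by rewrite (M_NC_row Mg) // mul0r.
have col r : \val h r i = u i i * \val g r i.
  rewrite hE mxE (bigD1 i) //= mulrC big1 ?addr0 // => a ai.
  case: (ltngtP a i) => [lt|lt|/val_inj e]; last by rewrite e eqxx in ai.
    by rewrite (u0 a.+1) ?mulr0.
  by rewrite ut // mulr0.
have uii : u i i != 0.
  by apply/eqP => e; have := col (v i); rewrite Mh.1 e mul0r => /eqP; rewrite oner_eq0.
apply/val_inj/eqP; rewrite eqn_leq; apply/andP; split.
  by apply: (M_NC_pivot Mh); rewrite col Mg.1 mulr1.
apply: (M_NC_pivot Mg); have := col (v i); rewrite Mh.1 => /esym e.
by apply/eqP => g0; move: e; rewrite g0 mulr0 => /eqP; rewrite eq_sym oner_eq0.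
Qed.
End Cells.

(** * The cells as affine spaces *)

Section AffineOpens.
Variable K : fieldType.

Lemma zopen_affine m n (S : set ('M[K]_(m, n) -> K)) : (forall f, S f -> polyfun f) ->
  zopen (f := @affine_space K m n) [set A | exists2 f, S f & f A != 0].
Proof.
move=> Sp; exists [set p | exists2 f, S f & forall A, f A = mxeval p A].
rewrite predeqE => A; split=> [[f Sf fA]|[p [f Sf E] pA]].
  by have [p E] := Sp f Sf; exists p; [exists f|rewrite -E].
by exists f => //; rewrite E.
Qed.
End AffineOpens.

Section CellChart.
Variable C : numClosedFieldType.
Variables (n : nat) (w : 'S_n) (k : nat) (pr : 'I_k -> 'I_n * 'I_n).
Hypotheses (pr_inj : injective pr)
  (prP : forall x, reflect (exists i, pr i = x) (x \in NC_inversions w)).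

Definition cellmx (v : 'rV[C]_k) : 'M[C]_n :=
  perm_mx w^-1 + \sum_i v 0 i *: delta_mx (w (pr i).2) (pr i).1.

Lemma cellmxE v i j : cellmx v (w j) i =
  (i == j)%:R + \sum_l v 0 l *+ (pr l == (i, j)).
Proof.
rewrite mxE perm_mxEsub !mxE permK eq_sym; congr (_ + _).
rewrite summxE; apply: eq_bigr => l _; rewrite !mxE (inj_eq perm_inj) mulr_natr.
by case: (pr l) => a b; rewrite xpair_eqE andbC [b == _]eq_sym [a == _]eq_sym.
Qed.

Lemma cellmx_coord v l : cellmx v (w (pr l).2) (pr l).1 = v 0 l.
Proof.
rewrite cellmxE -surjective_pairing (bigD1 l) //= eqxx mulr1n big1 ?addr0 => [|i il].
  have /prP := ex_intro (fun i => pr i = pr l) l erefl.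
  rewrite [pr l]surjective_pairing NC_invE => /and3P[lt _ _].
  by rewrite -val_eqE /= ltn_eqF // add0r.
by rewrite (inj_eq pr_inj) (negbTE il).
Qed.

Lemma M_NC_cellmx v : M_NC w (cellmx v).
Proof.
split=> [i|i j ij nij]; rewrite cellmxE.
  rewrite eqxx big1 ?addr0 // => l _; case: eqP => // e; exfalso.
  have /prP : exists l, pr l = (i, i) by exists l.
  by rewrite NC_invE ltnn.
rewrite (negbTE ij) add0r big1 // => l _; case: eqP => // e; exfalso.
by case/negP: nij; apply/prP; exists l.
Qed.

Lemma M_NC_cellmxE A : M_NC w A -> A = cellmx (\row_l A (w (pr l).2) (pr l).1).
Proof.
move=> MA; apply/matrixP => r c; rewrite -[r](permKV w); set j := (w^-1)%g r.
case: (eqVneq c j) => [->|cj]; first by rewrite MA.1 (M_NC_cellmx _).1.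
case: (boolP ((c, j) \in NC_inversions w)) => [/prP [l e]|nij].
  have [-> ->] : c = (pr l).1 /\ j = (pr l).2 by rewrite e.
  by rewrite cellmx_coord mxE.
by rewrite MA.2 // (M_NC_cellmx _).2.
Qed.

Lemma M_NC_unit (A : 'M[C]_n) : M_NC w A -> A \in unitmx.
Proof.
move=> MA; have : perm_mx w *m A \in unitmx.
  rewrite -row_permE unitmxE det_trig; last first.
    by apply/is_trig_mxP => i j ij; rewrite mxE (M_NC_row MA).
  by rewrite big1 ?unitr1 // => i _; rewrite mxE MA.1.
by rewrite unitmx_mul => /andP[].
Qed.

Definition cellGL v : GL C n := GLmk (M_NC_unit (M_NC_cellmx v)).

Lemma NC_cellE : @NC_cell C n w = range (fun v => flag_of (cellGL v)).
Proof.
rewrite predeqE => F; split=> [[g Mg <-]|[v _ <-]].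
  exists (\row_l \val g (w (pr l).2) (pr l).1) => //.
  by congr flag_of; apply: GL_inj; rewrite /= -(M_NC_cellmxE Mg).
by apply: NC_cell_flag; exact: M_NC_cellmx.
Qed.

Lemma polyfun_cellmx i j : polyfun (fun v => cellmx v i j).
Proof.
rewrite (_ : (fun v => _) = fun v : 'rV[C]_k => (perm_mx w^-1 : 'M[C]_n) i j +
    \sum_l v 0 l * (delta_mx (w (pr l).2) (pr l).1 : 'M[C]_n) i j).
  apply: polyfunD; first exact: polyfun_cst.
  by apply: polyfun_sum => l _; apply: polyfunM; [exact: polyfun_coord|exact: polyfun_cst].
by apply/funext => v; rewrite mxE summxE; congr (_ + _); apply: eq_bigr => l _; rewrite mxE.
Qed.

(** Rows [w 0, ..., w (a - 1), r] and columns [0, ..., a].  For a fixed flag these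
    minors are determined up to a factor that depends on [a] only, so that their
    ratios are functions of the flag.  On matrices of the cell the submatrix is
    triangular with determinant the entry in row [r] and column [a]. *)
Definition minor (a r : 'I_n) (g : 'M[C]_n) : C :=
  \det (\matrix_(x < a.+1, y < a.+1)
    g (if (x < a)%N then w (widen_ord (ltn_ord a) x) else r) (widen_ord (ltn_ord a) y)).

Lemma polyfun_minor a r : polyfun (minor a r).
Proof.
apply: polyfun_det => x y.
rewrite (_ : (fun g => _) = fun g : 'M[C]_n =>
   g (if (x < a)%N then w (widen_ord (ltn_ord a) x) else r) (widen_ord (ltn_ord a) y)).
  exact: polyfun_coord.
by apply/funext => g; rewrite mxE.
Qed.

Lemma minor_cell a r A : M_NC w A -> minor a r A = A r a.
Proof.
move=> MA; rewrite /minor det_trig; last first.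
  apply/is_trig_mxP => x y xy; rewrite mxE.
  have -> : (x < a)%N by have := ltn_ord y; rewrite ltnS; exact: leq_trans xy.
  by rewrite (M_NC_row MA).
rewrite big_ord_recr /= !mxE /= ltnn big1 ?mul1r => [|x _].
  by congr (A _ _); exact: val_inj.
by rewrite mxE /= ltn_ord MA.1.
Qed.

(** The factor by which the minors of the first [a.+1] columns change. *)
Definition leading (a : 'I_n) (u : 'M[C]_n) : C :=
  \prod_(x < a.+1) u (widen_ord (ltn_ord a) x) (widen_ord (ltn_ord a) x).

Lemma minor_mulmx a r g u : upper_triangular u -> minor a r (g *m u) = minor a r g * leading a u.
Proof.
move=> /upper_triangularP uu.
pose U := \matrix_(x < a.+1, y < a.+1) u (widen_ord (ltn_ord a) x) (widen_ord (ltn_ord a) y).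
have -> : leading a u = \det U.
  rewrite -det_tr det_trig; last by apply/is_trig_mxP => x y xy; rewrite !mxE uu.
  by apply: eq_bigr => x _; rewrite !mxE.
rewrite /minor -det_mulmx; congr (\det _); apply/matrixP => x y; rewrite !mxE.
rewrite (bigID (fun j : 'I_n => (j < a.+1)%N)) /= [X in _ + X]big1 ?addr0; last first.
  move=> j; rewrite -leqNgt => aj; rewrite uu ?mulr0 //.
  exact: leq_trans (ltn_ord y) aj.
rewrite (big_ord_narrow (ltn_ord a)); apply: eq_bigr => j _.
by rewrite !mxE.
Qed.

(** All coordinates are written with the same denominator, whose nonvanishing
    defines the open set on which they are regular. *)
Definition den (g : 'M[C]_n) := \prod_l minor (pr l).1 (w (pr l).1) g.
Definition num (g : 'M[C]_n) : 'rV[C]_k := \row_l (minor (pr l).1 (w (pr l).2) g *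
  \prod_(i | i != l) minor (pr i).1 (w (pr i).1) g).
Definition ratio (g : 'M[C]_n) : 'rV[C]_k := (den g)^-1 *: num g.

Lemma polyfun_den : polyfun den.
Proof. by apply: polyfun_prod => l _; exact: polyfun_minor. Qed.

Lemma polyfun_num i l : polyfun (fun g => num g i l).
Proof.
rewrite (_ : (fun g => _) = fun g => minor (pr l).1 (w (pr l).2) g *
  \prod_(i | i != l) minor (pr i).1 (w (pr i).1) g); last first.
  by apply/funext => g; rewrite mxE.
apply: polyfunM; first exact: polyfun_minor.
by apply: polyfun_prod => j _; exact: polyfun_minor.
Qed.

Lemma den_cell A : M_NC w A -> den A = 1.
Proof. by move=> MA; rewrite /den big1 // => l _; rewrite minor_cell // MA.1. Qed.

Lemma ratio_cell v : ratio (cellmx v) = v.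
Proof.
have Mv := M_NC_cellmx v; apply/rowP => l; rewrite mxE den_cell // invr1 mul1r mxE.
rewrite minor_cell // big1 ?mulr1 ?cellmx_coord // => i _.
by rewrite minor_cell // Mv.1.
Qed.

Lemma den_mulmx g u : g \in unitmx -> g *m u \in unitmx -> upper_triangular u ->
  exists2 c, c != 0 & den (g *m u) = den g * c /\ num (g *m u) = c *: num g.
Proof.
move=> gu guu uu; have {gu guu}u_unit : u \in unitmx by move: guu; rewrite unitmx_mul gu.
have lead0 a : leading a u != 0.
  by apply/prodf_neq0 => x _; exact: upper_triangular_unit_diag.
exists (\prod_l leading (pr l).1 u).
  by apply/prodf_neq0 => l _.
split; first by rewrite -big_split; apply: eq_bigr => l _; rewrite minor_mulmx.
apply/rowP => l; rewrite !mxE minor_mulmx // [in RHS](bigD1 l) //=.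
rewrite [X in _ * X = _](_ : _ = (\prod_(i | i != l) minor (pr i).1 (w (pr i).1) g) *
   \prod_(i | i != l) leading (pr i).1 u); first by ring.
by rewrite -big_split; apply: eq_bigr => i _; rewrite minor_mulmx.
Qed.

Lemma ratio_flag (g h : GL C n) : flag_of g = flag_of h ->
  (den (\val g) != 0) = (den (\val h) != 0) /\
  (den (\val h) != 0 -> ratio (\val g) = ratio (\val h)).
Proof.
move=> /esym /flag_ofP uu; set u := _ *m _ in uu.
have E : \val g = \val h *m u by rewrite mulKVmx // GLunit.
have gu := GLunit g; have hu := GLunit h; rewrite E in gu *.
have [c c0 [e1 e2]] := den_mulmx hu gu uu; rewrite /ratio e1 e2; split.
  by rewrite mulf_eq0 (negbTE c0) orbF.
by move=> d0; rewrite scalerA invfM mulfVK.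
Qed.

Lemma zopen_chart (V : set 'rV[C]_k) : zopen (f := @affine_space C 1 k) V ->
  zopen (f := @affine_space C n n) [set A | den A != 0 /\ V (ratio A)].
Proof.
move=> [S ->].
rewrite (_ : [set A | _] = [set A | exists2 f, [set f | polyfun f /\ exists2 p, S p &
    forall A, (f A != 0) = (den A != 0) && (mxeval p (ratio A) != 0)] f & f A != 0]).
  by apply: zopen_affine => f [].
rewrite predeqE => A; split=> [[d0 [p Sp pA]]|[f [pf [p Sp E]]]]; last first.
  by rewrite E => /andP[d0 pA]; split=> //; exists p.
have [P [d [PP PE]]] := polyfun_quotient p polyfun_num polyfun_den.
exists (fun A => den A * P A).
  split; first by apply: polyfunM => //; exact: polyfun_den.
  exists p => // B; rewrite mulf_eq0 negb_or; case: (eqVneq (den B) 0) => //= dB.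
  by rewrite /ratio PE // mulf_eq0 invr_eq0 expf_eq0 (negbTE dB) andbF orbF.
by move: pA; rewrite /ratio PE // !mulf_eq0 invr_eq0 expf_eq0 (negbTE d0) andbF orbF.
Qed.

Lemma zopen_Fl (U : set (Fl C n)) (U' : set 'M[C]_n) :
  zopen (f := @affine_space C n n) U' -> (forall g, U (flag_of g) <-> U' (\val g)) ->
  zopen (f := Fl_variety C n) U.
Proof.
by move=> oU' E; exists U' => //; rewrite predeqE => g /=; rewrite E.
Qed.

Section Stratum.
Variable S : set (Fl C n).
Hypothesis SE : S = NC_cell w.

Lemma cell_param_subproof v : flag_of (cellGL v) \in S.
Proof. by apply: mem_set; rewrite SE; apply: NC_cell_flag; exact: M_NC_cellmx. Qed.

(** The target is any set equal to the cell, so that it can be a difference of two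
    steps of a filtration. *)
Definition cell_param (v : 'rV[C]_k) : S := exist (fun F => F \in S) _ (cell_param_subproof v).

Definition cell_coord (F : S) : 'rV[C]_k := ratio (\val (repr (\val F))).

Lemma chart_flag_of v (F := flag_of (cellGL v)) :
  den (\val (repr F)) != 0 /\ ratio (\val (repr F)) = v.
Proof.
have e : flag_of (repr F) = flag_of (cellGL v) by rewrite /flag_of reprK.
have [e1 e2] := ratio_flag e; have d1 : den (cellmx v) = 1 by exact: den_cell (M_NC_cellmx v).
by rewrite e1 e2 /= ?ratio_cell ?d1 ?oner_neq0.
Qed.

Lemma cell_paramK : cancel cell_param cell_coord.
Proof. by move=> v; exact: (chart_flag_of v).2. Qed.

Lemma cell_param_surj (F : S) : exists v, F = cell_param v.
Proof.
have : NC_cell w (\val F) by have := set_valP F; rewrite -[X in X _]/S {1}SE.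
by rewrite NC_cellE => -[v _ E]; exists v; exact: val_inj.
Qed.

Lemma cell_coordK : cancel cell_coord cell_param.
Proof. by move=> F; have [v ->] := cell_param_surj F; rewrite cell_paramK. Qed.

(** A regular function is locally a quotient of polynomials in the entries of the
    matrix of the flag.  The polynomials cutting out the neighbourhoods on which
    this holds are multiplied into the denominator. *)
Lemma cell_param_morphism : morphism (X := @affine_space C 1 k)
  (Y := initial_fs (X := Fl_variety C n) (@set_val _ S)) cell_param.
Proof.
move=> V [U [U' [S1 E1] E2] UV]; have {E1}E2 :
    (@flag_of C n) @^-1` U = (@set_val _ (GL C n)) @^-1`
       [set A | exists2 p, S1 p & mxeval p A != 0].
  by rewrite -E2 E1.
have UE g : U (flag_of g) <-> exists2 p, S1 p & mxeval p (\val g) != 0.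
  by have := congr1 (fun A => A g) E2 => /= ->.
split.
  rewrite (_ : _ @^-1` V = [set v | exists2 f,
    [set f | polyfun f /\ exists2 p, S1 p & f = fun v => mxeval p (cellmx v)] f & f v != 0]).
    by apply: zopen_affine => f [].
  rewrite -UV predeqE => v; split.
    move=> /UE [p Sp pv]; exists (fun v => mxeval p (cellmx v)) => //.
    split; last by exists p.
    by apply: polyfun_comp; [exact: polyfun_cellmx|exact: polyfun_mxeval].
  by move=> [f [_ [p Sp ->]] pv]; apply/UE; exists p.
move=> r Vr v Vv; have [W [s [[W' [S2 W'E] EW] sW Wv rs]]] := Vr _ Vv.
have WE g : W (flag_of g) <-> exists2 p, S2 p & mxeval p (\val g) != 0.
  by have := congr1 (fun A => A g) EW; rewrite W'E /= => ->.
have [U1 [s1 [[S3 U1E] s1r U1v ss1]]] := sW (cellGL v) Wv.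
have [p [q [qv pqE]]] := s1r _ U1v.
have [p2 Sp2 p2v] := (WE _).1 Wv.
have [p3 Sp3 p3v] : exists2 p, S3 p & mxeval p (cellmx v) != 0 by move: U1v; rewrite U1E.
have pc f : polyfun f -> polyfun (fun v => f (cellmx v)).
  by move=> pf; apply: polyfun_comp => //; exact: polyfun_cellmx.
have [P PE] := pc _ (polyfun_mxeval (p * p2 * p3)).
have [Q QE] := pc _ (polyfun_mxeval (q * p2 * p3)).
have ev (a b c : mpoly (n * n) C) A : mxeval (a * b * c) A = mxeval a A * mxeval b A * mxeval c A.
  by rewrite /mxeval !mevalM.
exists P, Q; rewrite -QE ev; split; first by rewrite !mulf_neq0.
move=> y Vy; rewrite -QE ev -PE ev !mulf_eq0 !negb_or => /andP[/andP[qy p2y] p3y].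
have Wy : W (flag_of (cellGL y)) by apply/WE; exists p2.
have U1y : U1 (cellmx y) by rewrite U1E; exists p3.
have -> : (r \o cell_param) y = mxeval p (cellmx y) / mxeval q (cellmx y).
  rewrite /= (rs _ Vy Wy); have := ss1 (cellGL y) Wy U1y => /= ->.
  exact: pqE.
by field; rewrite qy p2y p3y.
Qed.

(** The open sets and the regular functions of the affine space are pulled back to
    the open set of flags with [den] nonzero, on which [ratio] is defined. *)
Lemma cell_coord_morphism : morphism (Y := @affine_space C 1 k)
  (X := initial_fs (X := Fl_variety C n) (@set_val _ S)) cell_coord.
Proof.
have denF (F : S) : den (\val (repr (\val F))) != 0.
  by have [v ->] := cell_param_surj F; exact: (chart_flag_of v).1.
have opn (V : set 'rV[C]_k) : zopen (f := @affine_space C 1 k) V ->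
    zopen (f := Fl_variety C n) [set F | den (\val (repr F)) != 0 /\ V (ratio (\val (repr F)))].
  move=> oV; apply: (zopen_Fl (zopen_chart oV)) => g /=.
  have e : flag_of (repr (flag_of g)) = flag_of g by rewrite /flag_of reprK.
  have [e1 e2] := ratio_flag e; rewrite e1; split=> -[d0]; first by rewrite e2.
  by rewrite e2.
move=> V oV; split.
  exists [set F | den (\val (repr F)) != 0 /\ V (ratio (\val (repr F)))]; first exact: opn.
  by rewrite predeqE => F; split=> [[]//|VF]; split=> //; exact: denF.
move=> r Vr F VF; have [p [q [qF rE]]] := Vr _ VF.
have qo : zopen (f := @affine_space C 1 k) [set v | mxeval q v != 0].
  exists [set q]; rewrite predeqE => v; split=> [qv|[_ -> //]]; by exists q.
exists [set F | den (\val (repr F)) != 0 /\ mxeval q (ratio (\val (repr F))) != 0].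
exists (fun F => mxeval p (ratio (\val (repr F))) / mxeval q (ratio (\val (repr F)))).
split.
- exact: opn qo.
- move=> g [dg qg]; exists [set A | den A != 0 /\ mxeval q (ratio A) != 0].
  exists (fun A => mxeval p (ratio A) / mxeval q (ratio A)).
  have e (g' : GL C n) := ratio_flag
    (esym (reprK (flag_of g')) : flag_of g' = flag_of (repr (flag_of g'))).
  split.
  + exact: zopen_chart qo.
  + move=> A [dA qA].
    have [P [d [Pp PE]]] := polyfun_quotient p polyfun_num polyfun_den.
    have [Q [d' [Qp QE]]] := polyfun_quotient q polyfun_num polyfun_den.
    have [P1 P1E] := polyfunM Pp (polyfunX d' polyfun_den).
    have [Q1 Q1E] := polyfunM Qp (polyfunX d polyfun_den).
    exists P1, Q1; rewrite -Q1E; have QA := qA; rewrite /ratio QE // mulf_eq0 invr_eq0 negb_or in QA.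
    split; first by rewrite mulf_neq0 ?expf_neq0 //; case/andP: QA.
    move=> B [dB qB] _; rewrite -P1E -Q1E /ratio PE // QE //.
    have QB := qB; rewrite /ratio QE // mulf_eq0 invr_eq0 negb_or in QB.
    have h1 := expf_neq0 d dB; have h2 := expf_neq0 d' dB.
    by case/andP: QB => h3 _; field; rewrite h1 h2 h3.
  + by have [e1 e2] := e g; rewrite /= e1 e2 //.
  + move=> g' [dg' qg'] _ /=; have [e1 e2] := e g'; rewrite e2 //.
- by split=> //; exact: denF.
- move=> F' VF' [_ qF'] /=; exact: rE.
Qed.

Lemma cell_param_isomorphism : isomorphism (X := @affine_space C 1 k)
  (Y := initial_fs (X := Fl_variety C n) (@set_val _ S)) cell_param.
Proof.
exists cell_coord; split.
- exact: cell_paramK.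
- exact: cell_coordK.
- exact: cell_param_morphism.
- exact: cell_coord_morphism.
Qed.
End Stratum.
End CellChart.

(** * The torus action on a cell *)

Section Torus.
Variable C : numClosedFieldType.

Definition root_weight n (x y : 'I_n) (m : 'I_n) : int := (m == x)%:R - (m == y)%:R.

Lemma torus_upper n (t : GL C n) : torus t -> upper_triangular (\val t).
Proof.
by move=> /is_diag_mxP dt; apply/upper_triangularP => i j ij; rewrite dt // gtn_eqF.
Qed.

Lemma torus_neq0 n (t : GL C n) i : torus t -> \val t i i != 0.
Proof. by move=> /torus_upper ut; exact: upper_triangular_unit_diag (GLunit t) ut. Qed.

Lemma torus_exists n (s : 'I_n -> C) : (forall i, s i != 0) ->
  exists t : GL C n, torus t /\ forall i, \val t i i = s i.
Proof.
move=> s0; pose d : 'rV[C]_n := \row_i s i.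
have du : diag_mx d \in unitmx.
  by rewrite unitmxE det_diag unitfE; apply/prodf_neq0 => i _; rewrite mxE.
exists (GLmk du); split; first by rewrite /torus /=; exact: diag_mx_is_diag.
by move=> i; rewrite /= !mxE eqxx mulr1n.
Qed.

Lemma torus_char_root n (t : GL C n) x y : x != y -> torus t ->
  torus_char (root_weight x y) t = \val t x x / \val t y y.
Proof.
move=> xy tt; rewrite /torus_char (bigD1 x) //= (bigD1 y) 1?eq_sym //= big1 ?mulr1 => [|i /andP[ix iy]].
  by rewrite /root_weight !eqxx (negbTE xy) eq_sym (negbTE xy) subr0 sub0r expr1z exprN1.
by rewrite /root_weight (negbTE ix) (negbTE iy) subrr expr0z.
Qed.

Section Cell.
Variables (n : nat) (w : 'S_n) (k : nat) (pr : 'I_k -> 'I_n * 'I_n).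
Hypotheses (pr_inj : injective pr)
  (prP : forall x, reflect (exists i, pr i = x) (x \in NC_inversions w)).

Let cellGL := @cellGL C n w k pr prP.

Lemma pr_lt l : ((pr l).1 < (pr l).2)%N.
Proof.
have : pr l \in NC_inversions w by apply/prP; exists l.
by rewrite [pr l]surjective_pairing NC_invE => /and3P[].
Qed.

Lemma pr_neq l : w (pr l).2 != w (pr l).1.
Proof. by rewrite (inj_eq perm_inj) -val_eqE /= gtn_eqF // pr_lt. Qed.

Definition cell_act (t : GL C n) (v : 'rV[C]_k) : 'rV[C]_k :=
  \row_l (torus_char (root_weight (w (pr l).2) (w (pr l).1)) t * v 0 l).

(** Left multiplication by [t] is undone on the pivots by right multiplication by
    the inverse of the diagonal matrix [d], which lies in [B]. *)
Lemma cell_equivariant t v : torus t ->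
  flag_of (cellGL (cell_act t v)) = GLact t (flag_of (cellGL v)).
Proof.
move=> tt; rewrite GLactE; apply/esym.
pose d : 'rV[C]_n := \row_i \val t (w i) (w i).
apply: (@flag_of_mulmx _ _ _ _ (diag_mx d)); last first.
  by apply/upper_triangularP => i j ij; rewrite mxE -val_eqE /= gtn_eqF.
apply/matrixP => r c; rewrite mul_mx_diag /= [LHS]mxE [RHS]mxE [d 0 c]mxE.
have -> : \sum_j \val t r j * cellmx w pr v j c = \val t r r * cellmx w pr v r c.
  rewrite (bigD1 r) //= big1 ?addr0 // => j jr.
  have /is_diag_mxP -> := tt; rewrite ?mul0r //.
  by apply: contra jr => /eqP e; apply/eqP/val_inj.
rewrite -[r](permKV w); set j := (w^-1)%g r.
have M1 := M_NC_cellmx prP v; have M2 := M_NC_cellmx prP (cell_act t v).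
case: (eqVneq c j) => [->|cj]; first by rewrite M1.1 M2.1 mulrC.
case: (boolP ((c, j) \in NC_inversions w)) => [/prP [l e]|nij].
  have [-> ->] : c = (pr l).1 /\ j = (pr l).2 by rewrite e.
  rewrite !cellmx_coord // mxE torus_char_root ?pr_neq //.
  by rewrite mulrAC divfK // torus_neq0.
by rewrite M1.2 // M2.2 // mulr0 mul0r.
Qed.

Lemma cellmx0 : cellmx w pr 0 = perm_mx w^-1 :> 'M[C]_n.
Proof. by rewrite /cellmx big1 ?addr0 // => l _; rewrite mxE scale0r. Qed.

Lemma cell_origin : flag_of (cellGL 0) = perm_flag C w.
Proof. by congr flag_of; apply: GL_inj; rewrite /= cellmx0. Qed.

(** Every coordinate is scaled by a nontrivial character, which takes the value 2
    at the torus element [s]. *)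
Lemma cell_fixed : @NC_cell C n w `&` @T_fixed C n = [set perm_flag C w].
Proof.
have inj v v' : flag_of (cellGL v) = flag_of (cellGL v') -> v = v'.
  move=> e; apply: (can_inj (cell_paramK pr_inj prP (erefl (NC_cell w)))).
  exact: val_inj.
rewrite predeqE => F; split=> [[]|->] /=.
  rewrite (NC_cellE C pr_inj prP) => -[v _ <-] fx; rewrite -cell_origin; congr flag_of.
  congr cellGL; apply/rowP => l; rewrite mxE.
  pose s i : C := if i == w (pr l).2 then 2 else 1.
  have [|t [tt ts]] := @torus_exists _ s.
    by move=> i; rewrite /s; case: ifP => _; rewrite ?oner_eq0 // pnatr_eq0.
  have := fx t tt; rewrite -cell_equivariant // => /inj /rowP /(_ l).
  rewrite mxE torus_char_root ?pr_neq // !ts /s eqxx eq_sym (negbTE (pr_neq l)) divr1.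
  by move=> /eqP; rewrite mulr_natl -subr_eq0 mulr2n addrK => /eqP.
split; first by rewrite -cell_origin; apply: NC_cell_flag; exact: M_NC_cellmx.
move=> t tt; rewrite -cell_origin -cell_equivariant //; congr flag_of; congr cellGL.
by apply/rowP => l; rewrite !mxE mulr0.
Qed.

Lemma cellmx_line l z :
  cellmx w pr (z *: delta_mx 0 l) = perm_mx w^-1 *m elem (pr l).2 (pr l).1 z :> 'M[C]_n.
Proof.
rewrite /cellmx mulmxDr mulmx1 -scalemxAr; congr (_ + _).
rewrite (bigD1 l) //= !mxE !eqxx mulr1 big1 ?addr0 => [|i il]; last first.
  by rewrite !mxE eqxx (negbTE il) mulr0 scale0r.
congr (_ *: _); apply/matrixP => r c; rewrite !mxE (bigD1 (pr l).2) //= big1 ?addr0.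
  by rewrite perm_mxEsub !mxE eqxx /= (canF_eq (permKV w)) -natrM mulnb.
by move=> i il; rewrite !mxE (negbTE il) mulr0.
Qed.
End Cell.
End Torus.

(** * Closures of the coordinate lines *)

Section Lines.
Variable C : numClosedFieldType.
Variables (n : nat) (a b : 'I_n).
Hypothesis ab : (a < b)%N.

Let bNa : b != a. Proof. by rewrite -val_eqE /= gtn_eqF. Qed.

Lemma tperm_mulmx m (N : 'M[C]_(n, m)) r c : (perm_mx (tperm a b) *m N) r c = N (tperm a b r) c.
Proof. by rewrite -row_permE mxE. Qed.

Lemma perm_mulmx (s : 'S_n) m (N : 'M[C]_(n, m)) r c : (perm_mx s^-1 *m N) (s r) c = N r c.
Proof. by rewrite -row_permE mxE permK. Qed.

(** Equations for the union of the flags of the matrices [1 + z E_ba] and of the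
    flag of the transposition of [a] and [b].  The last clause says that the
    rows [a] and [b] are proportional in the columns before [b]. *)
Definition line_equations (N : 'M[C]_n) :=
  [/\ forall r c : 'I_n, (c < r)%N -> r != b -> N r c = 0,
      forall c : 'I_n, (c < a)%N -> N b c = 0 &
      forall c : 'I_n, (a <= c < b)%N -> N a a * N b c = N a c * N b a].

Lemma line_equations_elem z u : upper_triangular u -> line_equations (elem b a z *m u).
Proof.
move=> /upper_triangularP uu; have aNb := bNa; rewrite eq_sym in aNb.
split=> [r c cr rb|c ca|c /andP[ac cb]]; rewrite !elem_mulmx ?eqxx ?(negbTE aNb).
- by rewrite (negbTE rb) mulr0n mulr0 addr0 uu.
- by rewrite uu ?(ltn_trans ca ab) // uu // mulr1n mulr0 addr0.
- by rewrite [u b c]uu // [u b a]uu // !mulr0n !mulr1n; ring.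
Qed.

Lemma line_equations_tperm u : upper_triangular u -> line_equations (perm_mx (tperm a b) *m u).
Proof.
move=> /upper_triangularP uu; split=> [r c cr rb|c ca|c /andP[ac cb]]; rewrite !tperm_mulmx.
- case: (eqVneq r a) => [ra|ra]; first by rewrite ra tpermL uu // (ltn_trans _ ab) // -ra.
  by rewrite tpermD 1?eq_sym // uu.
- by rewrite tpermR uu.
- by rewrite tpermL tpermR [u b a]uu // [u b c]uu // !mul0r.
Qed.

(** Otherwise the first [a.+1] columns of the matrix lie in the span of [a] basis
    vectors. *)
Lemma line_pivot N : N \in unitmx -> line_equations N -> (N a a != 0) || (N b a != 0).
Proof.
move=> Nu [e1 e2 e3]; case: (eqVneq (N a a) 0) => //= Na; case: eqP => //= Nb.
have z (r c : 'I_n) : (c <= a)%N -> (a <= r)%N -> N r c = 0.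
  move=> ca ar; case: (ltngtP c a) ca => // [ca|/val_inj ->] _.
    case: (eqVneq r b) => [->|rb]; first exact: e2.
    by apply: e1 => //; exact: leq_trans ca ar.
  case: (eqVneq r b) => [->//|rb]; case: (eqVneq r a) => [->//|ra].
  by apply: e1 => //; move: ra; rewrite -val_eqE /=; lia.
have e : colspan N a.+1 = colspan (1%:M : 'M[C]_n) a.+1.
  apply/colspan_eqP; rewrite ?unitmx1 // => r c; rewrite invmx1 mul1mx !ltnS => ca ar.
  by apply: z => //; exact: ltnW.
have : col a (1%:M : 'M[C]_n) \in colspan N a.+1 by rewrite e mem_colspan_col.
have sub : (colspan N a.+1 <= colspan (1%:M : 'M[C]_n) a)%VS.
  apply/span_subvP => v /mapP[c + ->]; rewrite mem_filter ltnS => /andP[ca _].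
  apply/mem_colspan; rewrite ?unitmx1 // => r ar.
  by rewrite invmx1 mul1mx mxE z.
move=> /(subvP sub) /mem_colspan - /(_ (unitmx1 _ _) a (leqnn a)).
by rewrite invmx1 mul1mx !mxE eqxx => /eqP; rewrite oner_eq0.
Qed.

Lemma line_equations_decomp N : N \in unitmx -> line_equations N ->
  (exists z u, upper_triangular u /\ N = elem b a z *m u) \/
  (exists u, upper_triangular u /\ N = perm_mx (tperm a b) *m u).
Proof.
move=> Nu eqs; have := line_pivot Nu eqs; case: eqs => e1 e2 e3.
case: (eqVneq (N a a) 0) => [Na|Na] /= Nb.
  right; exists (perm_mx (tperm a b) *m N); split; last first.
    by rewrite mulmxA -perm_mxM tperm2 perm_mx1 mul1mx.
  apply/upper_triangularP => c r cr; rewrite tperm_mulmx.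
  case: tpermP => [ra|rb|/eqP ra /eqP rb].
  - by apply: e2; rewrite -ra.
  - case: (ltnP c a) => ca; first by rewrite e1 // eq_sym.
    have := e3 c; rewrite ca Na mul0r /= => /(_ _)/esym/eqP.
    by rewrite mulf_eq0 (negbTE Nb) orbF => H; apply/eqP/H; rewrite -rb.
  - by apply: e1 => //; apply/eqP.
left; pose z := N b a / N a a; exists z, (elem b a (- z) *m N); split; last first.
  by rewrite mulmxA elemK // mul1mx.
apply/upper_triangularP => c r cr; rewrite elem_mulmx.
case: (eqVneq r b) => [rb|rb]; last by rewrite mulr0 addr0 e1.
rewrite rb mulr1n; case: (ltnP c a) => ca.
  by rewrite e2 // e1 ?mulr0 ?addr0 // eq_sym.
have := e3 c; rewrite ca -{1}rb cr => /(_ isT) e.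
by rewrite /z; apply: (mulfI Na); rewrite mulr0 mulrDr e; field.
Qed.

Variable w : 'S_n.
Let P : 'M[C]_n := perm_mx w^-1.
Let Pu : P \in unitmx. Proof. exact: unitmx_perm. Qed.

Lemma line_point_unit z : P *m elem b a z \in unitmx.
Proof. by rewrite unitmx_mul Pu elem_unit. Qed.

Definition line_point z : Fl C n := flag_of (GLmk (line_point_unit z)).
Definition line_infty : Fl C n := perm_flag C (tperm a b * w)%g.
Definition flag_line : set (Fl C n) := range line_point `|` [set line_infty].

Lemma line_inftyE (g : GL C n) : flag_of g = line_infty <->
  exists u, upper_triangular u /\ \val g = P *m (perm_mx (tperm a b) *m u).
Proof.
have E : perm_mx (tperm a b * w)^-1 = P *m perm_mx (tperm a b) :> 'M[C]_n.
  by rewrite invMg tpermV perm_mxM.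
split=> [/esym/flag_ofP /=|[u [uu e]]].
  rewrite E; set u := _ *m \val g => uu; exists u; split => //.
  by rewrite mulmxA mulKVmx // -E unitmx_perm.
by apply: (@flag_of_mulmx _ _ _ _ u) => //; rewrite /= E -mulmxA.
Qed.

Lemma line_pointE (g : GL C n) z : flag_of g = line_point z <->
  exists u, upper_triangular u /\ \val g = P *m (elem b a z *m u).
Proof.
split=> [/esym/flag_ofP /=|[u [uu e]]].
  set u := _ *m \val g => uu; exists u; split => //.
  by rewrite mulmxA mulKVmx // line_point_unit.
by apply: (@flag_of_mulmx _ _ _ _ u) => //; rewrite /= -mulmxA.
Qed.

Lemma flag_lineP (g : GL C n) :
  flag_line (flag_of g) <-> line_equations (perm_mx w *m \val g).
Proof.
have wP (A : 'M[C]_n) : perm_mx w *m (P *m A) = A.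
  by rewrite mulmxA -perm_mxM mulgV perm_mx1 mul1mx.
have Pw (A : 'M[C]_n) : P *m (perm_mx w *m A) = A.
  by rewrite mulmxA -perm_mxM mulVg perm_mx1 mul1mx.
split=> [[[z _ /esym/line_pointE [u [uu ->]]]|/line_inftyE [u [uu ->]]]|eqs].
- by rewrite wP; exact: line_equations_elem.
- by rewrite wP; exact: line_equations_tperm.
have Nu : perm_mx w *m \val g \in unitmx by rewrite unitmx_mul unitmx_perm GLunit.
have [[z [u [uu e]]]|[u [uu e]]] := line_equations_decomp Nu eqs.
  by left; exists z => //; apply/esym/line_pointE; exists u; rewrite -e Pw.
by right; apply/line_inftyE; exists u; rewrite -e Pw.
Qed.

Lemma flag_line_closed : zclosed (X := Fl_variety C n) flag_line.
Proof.
pose N (g : 'M[C]_n) := perm_mx w *m g.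
pose S1 := [set f : 'M[C]_n -> C | exists r c : 'I_n, [/\ (c < r)%N, r != b & f = fun g => N g r c]].
pose S2 := [set f : 'M[C]_n -> C | exists2 c : 'I_n, (c < a)%N & f = fun g => N g b c].
pose S3 := [set f : 'M[C]_n -> C | exists2 c : 'I_n, (a <= c < b)%N &
  f = fun g => N g a a * N g b c - N g a c * N g b a].
have pN r c : polyfun (fun g => N g r c).
  rewrite (_ : (fun g => _) = fun g : 'M[C]_n => g (w r) c); first exact: polyfun_coord.
  by apply/funext => g; rewrite /N -row_permE mxE.
apply: (@zclosed_Fl _ _ _ (S1 `|` S2 `|` S3)).
  move=> f [[[r [c [_ _ ->]]]|[c _ ->]]|[c _ ->]] //.
  by apply: polyfunB; apply: polyfunM.
move=> g; rewrite flag_lineP; split.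
  move=> [e1 e2 e3] f [[[r [c [cr rb ->]]]|[c cb ->]]|[c cab ->]]; [exact: e1|exact: e2|].
  by rewrite e3 ?subrr.
move=> H; split=> [r c cr rb|c ca|c cab].
- by apply: (H (fun g => N g r c)); left; left; exists r, c.
- by apply: (H (fun g => N g b c)); left; right; exists c.
- apply/eqP; rewrite -subr_eq0; apply/eqP.
  by apply: (H (fun g => N g a a * N g b c - N g a c * N g b a)); right; exists c.
Qed.

(** For [s != 0] this matrix has the flag of [1 + s^-1 E_ba], but it is polynomial
    in [s] and becomes the transposition at [s = 0]. *)
Definition line_near_infty (s : C) : 'M[C]_n := perm_mx (tperm a b) + s *: delta_mx a a.

Lemma line_near_infty_entry s r c :
  line_near_infty s r c = (tperm a b r == c)%:R + s *+ ((r == a) && (c == a)).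
Proof. by rewrite mxE perm_mxEsub !mxE mulr_natr. Qed.

Lemma line_near_inftyE s : s != 0 -> exists2 u : 'M[C]_n, upper_triangular u &
  line_near_infty s = elem b a s^-1 *m u.
Proof.
move=> s0; exists (elem b a (- s^-1) *m line_near_infty s); last first.
  by rewrite mulmxA elemK // mul1mx.
apply/upper_triangularP => r c cr; rewrite elem_mulmx.
rewrite !line_near_infty_entry eqxx tpermL.
case: tpermP => [ca|cb|/eqP/negbTE ca /eqP/negbTE cb].
- have -> : (b == r) = false by rewrite -val_eqE /= gtn_eqF // (ltn_trans _ ab) // -ca.
  have -> : (r == a) = false by rewrite -val_eqE /= ltn_eqF // -ca.
  by rewrite ca !andbF [a == b]eq_sym (negbTE bNa) !mulr0n mulr0 !addr0.
- have -> : (b == r) = false by rewrite -val_eqE /= gtn_eqF // -cb.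
  rewrite cb (negbTE bNa) eqxx mulr0n addr0 add0r mulr1n eq_sym.
  case: eqP => _; last by rewrite mulr0n mulr0 addr0.
  by rewrite mulr1n mulNr mulVf // subrr.
- by rewrite ca cb !mulr0n mulr0 !addr0 -val_eqE /= gtn_eqF.
Qed.

(** An equation that holds at all points of the line is a polynomial in [s] that
    vanishes for [s != 0], hence also at [s = 0]. *)
Lemma line_infty_closure (Z : set (Fl C n)) : zclosed (X := Fl_variety C n) Z ->
  range line_point `<=` Z -> Z line_infty.
Proof.
move=> /zclosed_FlP [S [Sp SZ]] LZ.
have lu : P *m line_near_infty 0 \in unitmx.
  by rewrite /line_near_infty scale0r addr0 unitmx_mul Pu unitmx_perm.
have -> : line_infty = flag_of (GLmk lu).
  apply/esym/line_inftyE; exists 1%:M; split; last by rewrite /= /line_near_infty scale0r addr0 mulmx1.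
  by apply/upper_triangularP => i j ij; rewrite mxE -val_eqE /= gtn_eqF.
apply/SZ => f Sf /=; have [Q QE] :=
  @polyfun_line _ _ _ _ (P *m perm_mx (tperm a b)) (P *m delta_mx a a) (Sp f Sf).
have E s : P *m line_near_infty s = P *m perm_mx (tperm a b) + s *: (P *m delta_mx a a).
  by rewrite mulmxDr -scalemxAr.
rewrite E QE; apply: horner_punctured => s s0; rewrite -QE -E.
have [u uu e] := line_near_inftyE s0.
have su : P *m line_near_infty s \in unitmx.
  have d : line_near_infty s \in unitmx.
    rewrite /line_near_infty (_ : _ + _ = perm_mx (tperm a b) *m elem b a s).
      by rewrite unitmx_mul unitmx_perm elem_unit.
    rewrite mulmxDr mulmx1 -scalemxAr; congr (_ + _ *: _).
    apply/matrixP => r c; rewrite tperm_mulmx !mxE.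
    by rewrite (canF_eq (tpermK a b)) tpermR.
  by rewrite unitmx_mul Pu.
apply: ((SZ (GLmk su)).1 _ f Sf); apply: LZ; exists s^-1 => //.
by apply/esym/line_pointE; exists u; rewrite /= e.
Qed.

Lemma zclosure_line : zclosure (X := Fl_variety C n) (range line_point) = flag_line.
Proof.
rewrite predeqE => F; split.
  by move=> /(_ flag_line); apply; split; [exact: flag_line_closed|move=> ? ?; left].
move=> [LF|->] Z [Zcl LZ]; first exact: LZ.
exact: line_infty_closure.
Qed.
End Lines.

(** * The analytic topology of the closed lines *)

Section Topology.

Lemma open_set_typeP (X : topologicalType) (A : set X) (U : set A) :
  open U <-> exists2 V : set X, open V & (@set_val _ A) @^-1` V = U.
Proof. by []. Qed.

Lemma open_quotientP (T : topologicalType) (Q : quotType T) (U : set (quotient_topology Q)) :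
  open U <-> open (\pi_(quotient_topology Q) @^-1` U).
Proof. by []. Qed.

Lemma continuous_mx (T : topologicalType) (K : topologicalType) m n (f : T -> 'M[K]_(m, n)) :
  (forall i j, continuous (fun t => f t i j)) -> continuous f.
Proof.
move=> fc t U [P Pn PU]; have : \forall s \near t, forall i j, P i j (f s i j).
  by apply: filter_forall => i; apply: filter_forall => j; exact: (fc i j t _ (Pn i j)).
by apply: filterS => s; exact: PU.
Qed.

Lemma open_neq0 (K : numFieldType) (T : topologicalType) (f : T -> K) :
  continuous f -> open [set t | f t != 0].
Proof.
move=> /continuousP fc; apply: (fc [set x | x != 0]).
rewrite (_ : [set x | x != 0] = ~` [set (0 : K^o)]); last first.
  by rewrite predeqE => x; split=> [/eqP|/eqP].
apply: closed_openC; apply: accessible_closed_set1; apply: hausdorff_accessible.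
exact: norm_hausdorff.
Qed.

End Topology.

Section LineTopology.
Variable C : numClosedFieldType.
Variables (n : nat) (a b : 'I_n).
Hypothesis ab : (a < b)%N.
Variable w : 'S_n.
Let P : 'M[C]_n := perm_mx w^-1.
Let L : set (Fl C n) := flag_line ab w.
Let bNa : b != a. Proof. by rewrite -val_eqE /= gtn_eqF. Qed.

(** Homogeneous coordinates on the closed line. *)
Definition line_vec (g : 'M[C]_n) : 'rV[C]_2 := \row_j g (w (if j == 0 then a else b)) a.

Lemma row2P (u v : 'rV[C]_2) : u 0 0 = v 0 0 -> u 0 1 = v 0 1 -> u = v.
Proof.
move=> h0 h1; apply/rowP => i; case: i => -[|[|//]] im.
  by rewrite (_ : Ordinal im = 0) //; exact: val_inj.
by rewrite (_ : Ordinal im = 1) //; exact: val_inj.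
Qed.

Lemma line_vec_neq0 (g : GL C n) : L (flag_of g) -> line_vec (\val g) != 0.
Proof.
move=> /flag_lineP eqs.
have Nu : perm_mx w *m \val g \in unitmx by rewrite unitmx_mul unitmx_perm GLunit.
have := line_pivot ab Nu eqs; rewrite -!row_permE ![row_perm _ _ _ _]mxE.
apply: contraTneq => e; have e0 i : line_vec (\val g) 0 i = 0 by rewrite e mxE.
by have := e0 0; have := e0 1; rewrite !mxE /= => -> ->; rewrite eqxx.
Qed.

(** The flag whose [a]-th vector is [x e_(w a) + y e_(w b)], for [v = (x, y)]. *)
Definition line_flag (v : 'rV[C]_2) : Fl C n :=
  if v 0 0 != 0 then line_point ab w (v 0 1 / v 0 0) else line_infty C a b w.

Lemma line_flag_in v : L (line_flag v).
Proof. by rewrite /line_flag; case: ifP => _; [left|right]. Qed.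

Lemma same_lineP (u v : @punctured_plane C) :
  same_line u v <-> exists2 c, c != 0 & \val u = c *: \val v.
Proof.
split=> [/andP[/sub_rVP [c e] _]|[c c0 e]].
  exists c => //; apply/eqP => c0; have := set_valP u.
  by rewrite /punctured_plane /= e c0 scale0r eqxx.
by rewrite /same_line e; apply/eqmxP; exact: eqmx_scale.
Qed.

Lemma line_flagZ c v : c != 0 -> line_flag (c *: v) = line_flag v.
Proof.
move=> c0; rewrite /line_flag !mxE mulf_eq0 (negbTE c0) /=; case: ifP => // v0.
by congr (line_point _ _ _); rewrite invfM mulrACA divff // mul1r.
Qed.

Lemma line_vec_point (g : GL C n) z : flag_of g = line_point ab w z ->
  exists2 c, c != 0 & line_vec (\val g) 0 0 = c /\ line_vec (\val g) 0 1 = c * z.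
Proof.
move=> e; have gL : L (flag_of g) by rewrite e; left.
have := line_vec_neq0 gL; move/line_pointE: e => [u [/upper_triangularP uu ->]].
set A := P *m _; have A1 : line_vec A 0 0 = u a a.
  by rewrite mxE /= perm_mulmx elem_mulmx eq_sym (negbTE bNa) mulr0 addr0.
have A2 : line_vec A 0 1 = u a a * z.
  by rewrite mxE /= perm_mulmx elem_mulmx eqxx uu // add0r mulr1n mulrC.
move=> A0; exists (u a a) => //; apply: contraNneq A0 => u0.
by apply/eqP; apply: row2P; rewrite [RHS]mxE ?A1 ?A2 u0 ?mul0r.
Qed.

Lemma line_vec_infty (g : GL C n) : flag_of g = line_infty C a b w ->
  exists2 c, c != 0 & line_vec (\val g) 0 0 = 0 /\ line_vec (\val g) 0 1 = c.
Proof.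
move=> e; have gL : L (flag_of g) by rewrite e; right.
have := line_vec_neq0 gL; move/line_inftyE: e => [u [/upper_triangularP uu ->]].
set A := P *m _; have A1 : line_vec A 0 0 = 0.
  by rewrite mxE /= perm_mulmx tperm_mulmx tpermL uu.
have A2 : line_vec A 0 1 = u a a.
  by rewrite mxE /= perm_mulmx tperm_mulmx tpermR.
move=> A0; exists (u a a) => //; apply: contraNneq A0 => u0.
by apply/eqP; apply: row2P; rewrite [RHS]mxE ?A1 ?A2 ?u0.
Qed.

Lemma line_flag_vec (g : GL C n) : L (flag_of g) -> line_flag (line_vec (\val g)) = flag_of g.
Proof.
move=> gL; case: (gL) => [[z _ /esym e]|e]; rewrite /line_flag.
  have [c c0 [-> ->]] := line_vec_point e.
  by rewrite c0 mulrC mulKf // e.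
by have [c c0 [-> _]] := line_vec_infty e; rewrite eqxx e.
Qed.

Lemma line_vec_flag (g : GL C n) v : v != 0 -> flag_of g = line_flag v ->
  exists2 c, c != 0 & line_vec (\val g) = c *: v.
Proof.
move=> v0; rewrite /line_flag; case: eqVneq => vE /=.
  have v1 : v 0 1 != 0.
    by apply: contraNneq v0 => v1; apply/eqP; apply: row2P; rewrite [RHS]mxE.
  move=> /line_vec_infty [c c0 [e0 e1]]; exists (c / v 0 1).
    by rewrite mulf_neq0 ?invr_eq0.
  by apply: row2P; rewrite [RHS]mxE ?e0 ?e1 ?vE ?mulr0 // divfK.
move=> /line_vec_point [c c0 [e0 e1]]; exists (c / v 0 0).
  by rewrite mulf_neq0 ?invr_eq0.
by apply: row2P; rewrite [RHS]mxE ?e0 ?e1 ?divfK // mulrA mulrAC.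
Qed.

(** Both matrices have the flag [line_flag v], the first where the first coordinate
    is nonzero and the second where the second one is.  Their entries are affine
    functions of [v], so no division enters the proof of continuity. *)
Definition chart0 (v : 'rV[C]_2) : 'M[C]_n :=
  P *m \matrix_(r, c) (if c == a then v 0 0 *+ (r == a) + v 0 1 *+ (r == b) else (r == c)%:R).
Definition chart1 (v : 'rV[C]_2) : 'M[C]_n :=
  P *m \matrix_(r, c) (if c == a then v 0 0 *+ (r == a) + v 0 1 *+ (r == b)
    else if c == b then (r == a)%:R else (r == c)%:R).

Lemma continuous_chart (M0 M1 M2 : 'M[C]_n) :
  continuous (fun v : 'rV[C]_2 => M0 + v 0 0 *: M1 + v 0 1 *: M2).
Proof.
apply: continuous_mx => i j.
rewrite (_ : (fun v => _) = fun v : 'rV[C]_2 => M0 i j + v 0 0 * M1 i j + v 0 1 * M2 i j); last first.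
  by apply/funext => v; rewrite !mxE.
have cc (l : 'I_2) (c : C) : continuous (fun v : 'rV[C]_2 => v 0 l * c).
  move=> v; have h1 := @coord_continuous C 1 2 0 l v.
  exact: (cvgM h1 (@cst_continuous _ _ c v)).
have cD (f g : 'rV[C]_2 -> C) : continuous f -> continuous g -> continuous (fun v => f v + g v).
  by move=> fc gc v; exact: (@cvgD C C^o _ _ _ f g _ _ (fc v) (gc v)).
have c0 : continuous (fun _ : 'rV[C]_2 => M0 i j) by exact: cst_continuous.
exact: (cD _ _ (cD _ _ c0 (cc 0 _)) (cc 1 _)).
Qed.

Lemma chart0_continuous : continuous chart0.
Proof.
rewrite (_ : chart0 = fun v => (P *m \matrix_(r, c) (if c == a then 0 else (r == c)%:R))
   + v 0 0 *: (P *m delta_mx a a) + v 0 1 *: (P *m delta_mx b a)).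
  exact: continuous_chart.
apply/funext => v; rewrite !scalemxAr -!mulmxDr; congr (P *m _).
apply/matrixP => r c; rewrite !mxE; case: (eqVneq c a) => _.
  by rewrite !andbT add0r !mulr_natr.
by rewrite !andbF !mulr0 !addr0.
Qed.

Lemma chart1_continuous : continuous chart1.
Proof.
rewrite (_ : chart1 = fun v => (P *m \matrix_(r, c) (if c == a then 0 else
   if c == b then (r == a)%:R else (r == c)%:R))
   + v 0 0 *: (P *m delta_mx a a) + v 0 1 *: (P *m delta_mx b a)).
  exact: continuous_chart.
apply/funext => v; rewrite !scalemxAr -!mulmxDr; congr (P *m _).
apply/matrixP => r c; rewrite !mxE; case: (eqVneq c a) => _.
  by rewrite !andbT add0r !mulr_natr.
by rewrite !andbF !mulr0 !addr0.
Qed.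

Lemma chart0P (v : 'rV[C]_2) : v 0 0 != 0 ->
  exists g : GL C n, \val g = chart0 v /\ flag_of g = line_flag v.
Proof.
move=> v0; pose u : 'M[C]_n := \matrix_(r, c) if c == a then v 0 0 *+ (r == a) else (r == c)%:R.
have uu : upper_triangular u.
  apply/upper_triangularP => i j ij; rewrite mxE; have -> : (j == i) = false.
    by rewrite -val_eqE /= gtn_eqF.
  case: (eqVneq i a) => [<-|_] //.
  by rewrite -val_eqE /= gtn_eqF.
have E : chart0 v = P *m (elem b a (v 0 1 / v 0 0) *m u).
  congr (P *m _); apply/matrixP => r c; rewrite elem_mulmx !mxE eqxx.
  case: (eqVneq c a) => _; last by rewrite mul0rn mulr0 addr0.
  by congr (_ + _); rewrite mulr1n; case: (r == b); rewrite ?mulr0 // mulr1n divfK.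
have un : u \in unitmx.
  rewrite unitmxE -det_tr (det_trig uu) unitfE; apply/prodf_neq0 => i _; rewrite !mxE eqxx.
  case: (i == a); rewrite mulr1n.
    exact: v0.
  exact: oner_neq0.
have cu : chart0 v \in unitmx by rewrite E !unitmx_mul unitmx_perm elem_unit.
exists (GLmk cu); split=> //; rewrite /line_flag v0; apply/line_pointE.
by exists u.
Qed.

Lemma chart1P (v : 'rV[C]_2) : v 0 1 != 0 ->
  exists g : GL C n, \val g = chart1 v /\ flag_of g = line_flag v.
Proof.
move=> v1; have aNb := bNa; rewrite eq_sym in aNb.
(* The factor that remains when the swap is split off. *)
pose u1 : 'M[C]_n := perm_mx (tperm a b) *m
  \matrix_(r, c) (if c == a then v 0 0 *+ (r == a) + v 0 1 *+ (r == b)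
    else if c == b then (r == a)%:R else (r == c)%:R).
have u1E r c : u1 r c = if c == a then v 0 0 *+ (r == b) + v 0 1 *+ (r == a)
    else if c == b then (r == b)%:R else (r == c)%:R.
  rewrite tperm_mulmx mxE; case: tpermP => [->|->|/eqP/negbTE ra /eqP/negbTE rb].
  - by rewrite !eqxx (negbTE bNa) (negbTE aNb); case: (eqVneq c a) => // _; case: (eqVneq c b).
  - by rewrite !eqxx (negbTE bNa) (negbTE aNb); case: (eqVneq c a) => // _; case: (eqVneq c b).
  - by rewrite ra rb.
have u1u : u1 \in unitmx.
  have trig : is_trig_mx u1 -> u1 \in unitmx.
    move=> tr; rewrite unitmxE (det_trig tr) unitfE; apply/prodf_neq0 => i _; rewrite u1E eqxx.
    case: (eqVneq i a) => [->|_]; first by rewrite (negbTE aNb) add0r; exact: v1.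
    by case: (i == b); exact: oner_neq0.
  apply: trig; apply/is_trig_mxP => i j ij; rewrite u1E.
  have ijF : (i == j) = false by rewrite -val_eqE /= ltn_eqF.
  case: (eqVneq j a) => [ja|_].
    have -> : (i == b) = false by rewrite -val_eqE /= ltn_eqF // (ltn_trans _ ab) // -ja.
    by rewrite -ja ijF addr0.
  by case: (eqVneq j b) => [jb|_]; rewrite -?jb ijF.
have cE : chart1 v = P *m (perm_mx (tperm a b) *m u1).
  by rewrite /u1 [perm_mx _ *m (perm_mx _ *m _)]mulmxA -perm_mxM tperm2 perm_mx1 mul1mx.
clearbody u1.
have cu : chart1 v \in unitmx by rewrite cE !unitmx_mul !unitmx_perm.
exists (GLmk cu); split=> //; rewrite /line_flag; case: eqVneq => v0 /=.
  apply/line_inftyE; exists u1; split; last by rewrite -cE.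
  apply/upper_triangularP => i j ij; rewrite u1E v0.
  have ijF : (j == i) = false by rewrite -val_eqE /= gtn_eqF.
  case: (eqVneq i a) => [ia|_]; first by rewrite -ia ijF mul0rn addr0.
  by case: (eqVneq i b) => [ib|_]; rewrite -?ib ijF.
apply/line_pointE; exists (elem b a (- (v 0 1 / v 0 0)) *m (perm_mx (tperm a b) *m u1)); split.
  apply/upper_triangularP => i j ij; rewrite elem_mulmx !tperm_mulmx tpermL !u1E.
  have ijF : (j == i) = false by rewrite -val_eqE /= gtn_eqF.
  case: (tpermP a b j) => [ja|jb|/eqP/negbTE ja /eqP/negbTE jb].
  - have -> : (i == a) = false by rewrite -ja -val_eqE /= ltn_eqF.
    have -> : (i == b) = false by rewrite -val_eqE /= ltn_eqF // (ltn_trans _ ab) // -ja.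
    by rewrite ja (negbTE aNb) mulr0n mulr0 addr0 -val_eqE /= gtn_eqF // (ltn_trans _ ab) // -ja.
  - have -> : (i == b) = false by rewrite -jb -val_eqE /= ltn_eqF.
    rewrite jb !eqxx (negbTE bNa) (negbTE aNb) !mulr1n !mulr0n add0r addr0.
    case: (eqVneq i a) => [_|ia]; first by rewrite mulNr divfK // subrr.
    have -> : (b == i) = false by rewrite -jb ijF.
    by rewrite mulr0 addr0.
  - rewrite ja jb mulr0n mulr0 !mulr0n !addr0 ijF.
    by case: eqP => _ //; case: eqP.
by rewrite /= cE [elem _ _ _ *m (_ *m _)]mulmxA elemK // mul1mx.
Qed.

Lemma line_flag_open (U : set (Fl C n)) : open U ->
  exists2 V : set 'rV[C]_2, open V & forall v, v != 0 -> (V v <-> U (line_flag v)).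
Proof.
move=> /open_quotientP /open_set_typeP [W oW E].
have WE (g : GL C n) : U (flag_of g) <-> W (\val g).
  by have := congr1 (fun A => A g) E => /= <-.
exists ([set v : 'rV[C]_2 | v 0 0 != 0] `&` chart0 @^-1` W
  `|` [set v : 'rV[C]_2 | v 0 1 != 0] `&` chart1 @^-1` W).
  apply: openU; apply: openI.
  - by apply: open_neq0; exact: coord_continuous.
  - by move/continuousP: chart0_continuous; apply.
  - by apply: open_neq0; exact: coord_continuous.
  - by move/continuousP: chart1_continuous; apply.
move=> v v0; split.
  case=> -[/= vi].
    by have [g [<- <-]] := chart0P vi; move/WE.
  by have [g [<- <-]] := chart1P vi; move/WE.
move=> Uv; case: (eqVneq (v 0 0) 0) => vE; last first.
  by left; split=> //=; have [g [<- ge]] := chart0P vE; apply/WE; rewrite ge.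
have v1 : v 0 1 != 0 by apply: contraNneq v0 => v1; apply/eqP; apply: row2P; rewrite [RHS]mxE.
by right; split=> //=; have [g [<- ge]] := chart1P v1; apply/WE; rewrite ge.
Qed.

Lemma line_vec_continuous : continuous line_vec.
Proof.
apply: continuous_mx => i j.
rewrite (_ : (fun g => _) = fun g : 'M[C]_n => g (w (if j == 0 then a else b)) a).
  exact: coord_continuous.
by apply/funext => g; rewrite mxE.
Qed.

Lemma line_complement_open : open [set A : 'M[C]_n | ~ line_equations a b (perm_mx w *m A)].
Proof.
have E (A : 'M[C]_n) r c : (perm_mx w *m A) r c = A (w r) c by rewrite -row_permE mxE.
rewrite (_ : [set A | _] =
  (\bigcup_(rc in [set rc : 'I_n * 'I_n | (rc.2 < rc.1)%N && (rc.1 != b)])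
    [set A : 'M[C]_n | A (w rc.1) rc.2 != 0])
  `|` (\bigcup_(c in [set c : 'I_n | (c < a)%N]) [set A : 'M[C]_n | A (w b) c != 0])
  `|` (\bigcup_(c in [set c : 'I_n | (a <= c < b)%N])
     [set A : 'M[C]_n | A (w a) a * A (w b) c - A (w a) c * A (w b) a != 0])).
  apply: openU; first apply: openU; apply: bigcup_open => c _; apply: open_neq0.
  - exact: coord_continuous.
  - exact: coord_continuous.
  - have cM i j k l : continuous (fun A : 'M[C]_n => A i j * A k l).
      by move=> A; exact: (cvgM (@coord_continuous C n n i j A) (@coord_continuous C n n k l A)).
    by move=> A; exact: (@cvgB C C^o _ _ _ _ _ _ _ (cM _ _ _ _ A) (cM _ _ _ _ A)).
rewrite predeqE => A; split.
  move=> nA; apply: contrapT => H; apply: nA; split=> [r c cr rb|c ca|c cab]; rewrite !E.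
  - apply/eqP/negPn/negP => A0; apply: H; left; left; exists (r, c) => //=.
    by rewrite cr.
  - by apply/eqP/negPn/negP => A0; apply: H; left; right; exists c.
  - apply/eqP; rewrite -subr_eq0; apply/negPn/negP => A0; apply: H; right.
    by exists c.
move=> H [e1 e2 e3]; case: H => [[[[r c] /= /andP[cr rb]]|[c /= ca]]|[c /= cab]].
- by have := e1 r c cr rb; rewrite E => ->; rewrite eqxx.
- by have := e2 c ca; rewrite E => ->; rewrite eqxx.
- by have := e3 c cab; rewrite !E => ->; rewrite subrr eqxx.
Qed.

(** The inverse maps are [line_vec] and [line_flag].  An open set of the projective
    line is pulled back to the closed line as the trace of an open set of flags:
    those that are off the line, which is closed, or whose coordinates satisfy an
    open condition. *)
Lemma line_homeomorphic : homeomorphic L (projective_line C).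
Proof.
have vecP (F : L) : @punctured_plane C (line_vec (\val (repr (\val F)))).
  have e : flag_of (repr (\val F)) = \val F by rewrite /flag_of reprK.
  apply: line_vec_neq0; rewrite e; exact: set_valP.
pose vec (F : L) : @punctured_plane C := exist (fun v => v \in @punctured_plane C) _ (mem_set (vecP F)).
pose f (F : L) : projective_line C := \pi_(projective_line C) (vec F).
pose h (x : projective_line C) : L :=
  exist (fun F => F \in L) _ (mem_set (line_flag_in (\val (repr x)))).
have piP (u v : @punctured_plane C) : \pi_(projective_line C) u = \pi_(projective_line C) v <->
    exists2 c, c != 0 & \val u = c *: \val v.
  by rewrite -same_lineP; split=> [/eqmodP|H]; last apply/eqmodP.
have hpi (v : @punctured_plane C) : \val (h (\pi_(projective_line C) v)) = line_flag (\val v).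
  have /piP [c c0 e] := reprK (\pi_(projective_line C) v).
  by rewrite /= e line_flagZ.
have fE (g : GL C n) (gL : L (flag_of g)) (v : @punctured_plane C) :
    line_vec (\val g) = \val v ->
    f (exist (fun F => F \in L) _ (mem_set gL)) = \pi_(projective_line C) v.
  move=> gv; apply/piP => /=; set g' := repr _.
  have e : flag_of g' = line_flag (\val v).
    by rewrite -gv line_flag_vec // /flag_of reprK.
  exact: line_vec_flag (set_valP v) e.
exists f, h; split.
- move=> F; apply: val_inj; rewrite hpi /=.
  have e : flag_of (repr (\val F)) = \val F by rewrite /flag_of reprK.
  rewrite line_flag_vec // e //; exact: set_valP.
- move=> x; have [v ->] : exists v, x = \pi_(projective_line C) v by exists (repr x); rewrite reprK.
  set F := h _; have FE : \val F = line_flag (\val v) by exact: hpi.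
  apply/piP => /=; have e : flag_of (repr (\val F)) = line_flag (\val v) by rewrite -FE /flag_of reprK.
  exact: line_vec_flag (set_valP v) e.
- apply/continuousP => B /open_quotientP /open_set_typeP [B' oB' BE].
  have BP (v : @punctured_plane C) : B (\pi_(projective_line C) v) <-> B' (\val v).
    by have := congr1 (fun A => A v) BE => /= <-.
  apply/open_set_typeP; exists [set F |
    forall LF : L F, B (f (exist (fun F => F \in L) _ (mem_set LF)))].
    apply/open_quotientP/open_set_typeP.
    exists ([set A : 'M[C]_n | ~ line_equations a b (perm_mx w *m A)] `|`
      line_vec @^-1` (B' `&` ([set v : 'rV[C]_2 | v 0 0 != 0] `|` [set v : 'rV[C]_2 | v 0 1 != 0]))).
      apply: openU; first exact: line_complement_open.
      move/continuousP: line_vec_continuous; apply; apply: openI => //.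
      by apply: openU; apply: open_neq0; exact: coord_continuous.
    rewrite predeqE => g /=; split.
      move=> H LF; case: H => [nL|[Bg _]]; first by case: nL; apply/flag_lineP.
      have vg := line_vec_neq0 LF.
      pose v : @punctured_plane C := exist (fun v => v \in @punctured_plane C) _ (mem_set vg).
      by rewrite (fE g LF v) //; apply/BP.
    move=> H; case: (pselect (L (flag_of g))) => [LF|nL]; last first.
      by left => /flag_lineP /nL.
    right; have vg := line_vec_neq0 LF.
    pose v : @punctured_plane C := exist (fun v => v \in @punctured_plane C) _ (mem_set vg).
    split; first by have := H LF; rewrite (fE g LF v) // => /BP.
    case: (eqVneq (line_vec (\val g) 0 0) 0) => v0; last by left.
    right; clear v; apply: contraNneq vg => v1; apply/eqP; apply: row2P; by rewrite [RHS]mxE.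
  rewrite predeqE => F /=; split.
    move=> H; have := H (set_valP F); congr (B (f _)); exact: val_inj.
  by move=> H LF; move: H; congr (B (f _)); exact: val_inj.
- apply/continuousP => U /open_set_typeP [U' oU' <-].
  have [V oV VE] := line_flag_open oU'.
  apply/open_quotientP/open_set_typeP; exists V => //.
  rewrite predeqE => v; split=> [Vv|Uv].
    by have := (VE _ (set_valP v)).1 Vv; rewrite -(hpi v).
  by apply/(VE _ (set_valP v)); rewrite -(hpi v).
Qed.
End LineTopology.

(** * Characters of the torus *)

Section Characters.
Variables (C : numClosedFieldType) (n : nat).
Implicit Types a b : 'I_n -> int.

Definition primitive a := \big[gcdn/0%N]_(m < n) `|a m|%N = 1%N.

Lemma primitive_neq0 a : primitive a -> exists i, a i != 0.
Proof.
move=> pa; apply: contrapT => H; move: pa; rewrite /primitive big1 // => i _.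
by apply/eqP; rewrite absz_eq0; apply/negPn/negP => ai; apply: H; exists i.
Qed.

Lemma torus_char_surj a (z : C) : primitive a -> z != 0 ->
  exists t : GL C n, torus t /\ torus_char a t = z.
Proof.
move=> /primitive_neq0 [i ai] z0.
have [y y0 yE] : exists2 y : C, y != 0 & y ^ a i = z.
  case E : (a i) ai => [[|k]|k] // _.
    have yk : (k.+1.-root z) ^+ k.+1 = z by rewrite rootCK.
    exists (k.+1.-root z) => //; apply: contraNneq z0 => y0.
    by rewrite -yk y0 expr0n.
  have yk : (k.+1.-root z) ^+ k.+1 = z by rewrite rootCK.
  exists (k.+1.-root z)^-1; last by rewrite NegzE -exprnN exprVn invrK.
  by rewrite invr_eq0; apply: contraNneq z0 => y0; rewrite -yk y0 expr0n.
have [|t [tt tE]] := @torus_exists C n (fun j => if j == i then y else 1).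
  by move=> j; case: ifP => // _; exact: oner_neq0.
exists t; split=> //; rewrite /torus_char (bigD1 i) //= tE eqxx yE big1 ?mulr1 // => j ji.
by rewrite tE (negbTE ji) exp1rz.
Qed.

(** Test on the torus elements [(2 ^ m_1, ..., 2 ^ m_n)] with [m] orthogonal to
    [a].  Then [b] is orthogonal to all these [m], so it is proportional to [a],
    and both vectors are primitive. *)
Lemma character_kernel a b : primitive a -> primitive b ->
  (forall t : GL C n, torus t -> torus_char a t = 1 -> torus_char b t = 1) ->
  (forall m, b m = a m) \/ (forall m, b m = - a m).
Proof.
move=> pa pb ker.
have two0 : (2 : C) != 0 by rewrite pnatr_eq0.
have two_exp (e : int) : (2 : C) ^ e = 1 -> e = 0.
  have pow k : (2 : C) ^+ k.+1 != 1.
    by rewrite -natrX (eqr_nat _ _ 1) expnS; apply/eqP; lia.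
  case: e => [[//|k]|k] /eqP; first by rewrite -exprnP (negbTE (pow k)).
  by rewrite NegzE -exprnN invr_eq1 (negbTE (pow k)).
have charE c (m : 'I_n -> int) (t : GL C n) : (forall j, \val t j j = 2 ^ m j) ->
    torus_char c t = 2 ^ (\sum_j m j * c j).
  move=> tE; rewrite /torus_char (eq_bigr (fun j => (2 : C) ^ (m j * c j))); last first.
    by move=> j _; rewrite tE exprz_exp.
  by elim/big_rec2: _ => [|j x y _ ->]; rewrite ?expr0z // expfzDr.
have orth (m : 'I_n -> int) : \sum_j m j * a j = 0 -> \sum_j m j * b j = 0.
  move=> ma; have [|t [tt tE]] := @torus_exists C n (fun j => 2 ^ m j).
    by move=> j; exact: expfz_neq0.
  have := ker t tt; rewrite !(charE _ m) // ma expr0z => /(_ erefl) e.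
  exact: two_exp e.
(* Here [m] has the entries [a j] at [i] and [- a i] at [j]. *)
have cross i j : b i * a j = b j * a i.
  case: (eqVneq i j) => [->//|ij].
  have := orth (fun l => if l == i then a j else if l == j then - a i else 0).
  have S (c : 'I_n -> int) : \sum_l (if l == i then a j else if l == j then - a i else 0) * c l =
      a j * c i - a i * c j.
    rewrite (bigD1 i) //= (bigD1 j) 1?eq_sym //= eqxx eq_sym (negbTE ij) eqxx.
    rewrite big1 ?addr0 ?mulNr // => l /andP[li lj].
    by rewrite (negbTE li) (negbTE lj) mul0r.
  rewrite !S => H; have := H (ltac:(by rewrite mulrC subrr)) => /eqP.
  by rewrite subr_eq0 => /eqP e; rewrite mulrC e mulrC.
have absE i : `|b i|%N = `|a i|%N.
  have gcdM c (x : 'I_n -> nat) :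
      \big[gcdn/0%N]_(m < n) (c * x m)%N = (c * \big[gcdn/0%N]_(m < n) x m)%N.
    by rewrite (big_morph (muln c) (fun x y => muln_gcdr c x y) (muln0 c)).
  have h1 := gcdM `|b i|%N (fun m => `|a m|%N); have h2 := gcdM `|a i|%N (fun m => `|b m|%N).
  rewrite pa muln1 in h1; rewrite pb muln1 in h2; rewrite -h1 -h2.
  by apply: eq_bigr => m _; rewrite -!abszM cross mulrC.
have [j aj] := primitive_neq0 pa.
have [e|e] : b j = a j \/ b j = - a j by have := absE j; lia.
  by left=> m; apply: (mulIf aj); rewrite cross e mulrC.
by right=> m; apply: (mulIf aj); rewrite cross e mulNr mulrC mulNr.
Qed.

Definition torus_act k (a : 'I_k -> 'I_n -> int) (t : GL C n) (v : 'rV[C]_k) : 'rV[C]_k :=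
  \row_l (torus_char (a l) t * v 0 l).

Section LineCorrespondence.
Variables (k1 k2 : nat) (a1 : 'I_k1 -> 'I_n -> int) (a2 : 'I_k2 -> 'I_n -> int).
Variables (f : 'rV[C]_k1 -> 'rV[C]_k2).
Hypotheses (prim1 : forall k, primitive (a1 k)) (prim2 : forall k, primitive (a2 k)).
Hypothesis dist2 : forall j k, j != k ->
  ~ (forall m, a2 j m = a2 k m) /\ ~ (forall m, a2 j m = - a2 k m).
Hypothesis f_inj : injective f.
Hypothesis f_equiv : forall t v, torus t -> f (torus_act a1 t v) = torus_act a2 t (f v).

Let f0 : f 0 = 0.
Proof.
apply/rowP => m; rewrite mxE; have [|t [tt tE]] := @torus_char_surj (a2 m) 2 (prim2 m).
  by rewrite pnatr_eq0.
have := f_equiv 0 tt; have -> : torus_act a1 t 0 = 0 by apply/rowP => l; rewrite !mxE mulr0.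
move=> /rowP /(_ m); rewrite mxE tE mulr_natl mulr2n => /eqP.
by rewrite -subr_eq0 opprD addrA subrr sub0r oppr_eq0 => /eqP.
Qed.

(** The image of the [k]-th basis vector is nonzero and fixed by the kernel of its
    character.  A primitive character that is trivial on this kernel agrees with
    it up to sign, so only one coordinate of the image is nonzero.  The torus
    acts transitively on the nonzero points of both lines. *)
Lemma line_correspondence k : exists m,
  ((forall x, a2 m x = a1 k x) \/ (forall x, a2 m x = - a1 k x)) /\
  [set f (z *: delta_mx 0 k) | z in setT] = [set z *: delta_mx 0 m | z in setT].
Proof.
have act_line k' (a : 'I_k' -> 'I_n -> int) (l : 'I_k') t z :
    torus_act a t (z *: delta_mx 0 l) = (torus_char (a l) t * z) *: delta_mx 0 l.
  apply/rowP => x; rewrite !mxE eqxx /=; case: eqP => [->|_]; first by rewrite !mulr1.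
  by rewrite !mulr0.
set e := f (1 *: delta_mx 0 k).
have e0 : e != 0.
  rewrite -f0 (inj_eq f_inj) scale1r; apply/eqP => /rowP /(_ k).
  by rewrite !mxE !eqxx => /eqP; rewrite oner_eq0.
have wt m : e 0 m != 0 -> (forall x, a2 m x = a1 k x) \/ (forall x, a2 m x = - a1 k x).
  move=> em; apply: character_kernel => // t tt t1.
  have := f_equiv (1 *: delta_mx 0 k) tt; rewrite act_line t1 mul1r -/e => /rowP /(_ m).
  by rewrite mxE -{1}[e 0 m]mul1r => /(mulIf em).
have [m em] : exists m, e 0 m != 0.
  apply/existsP; apply: contraNT e0 => /existsPn H; apply/eqP/rowP => m.
  by rewrite mxE; apply/eqP/negPn/H.
have eE : e = e 0 m *: delta_mx 0 m.
  apply/rowP => l; rewrite !mxE eqxx /=; case: (eqVneq l m) => [->|lm]; first by rewrite mulr1.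
  rewrite mulr0; apply/eqP/negPn/negP => el; have [d1 d2] := dist2 lm.
  have [hm|hm] := wt _ em; have [hl|hl] := wt _ el.
  - by apply: d1 => x; rewrite hm hl.
  - by apply: d2 => x; rewrite hm hl.
  - by apply: d2 => x; rewrite hm hl opprK.
  - by apply: d1 => x; rewrite hm hl.
have img t : torus t -> f (torus_char (a1 k) t *: delta_mx 0 k) =
    (torus_char (a2 m) t * e 0 m) *: delta_mx 0 m.
  move=> tt; have := f_equiv (1 *: delta_mx 0 k) tt; rewrite act_line mulr1 => ->.
  by rewrite -/e {1}eE act_line.
exists m; split; first exact: wt.
rewrite predeqE => v; split=> -[z _ <-].
  case: (eqVneq z 0) => [->|z0]; first by exists 0; rewrite // !scale0r f0.
  have [t [tt <-]] := torus_char_surj (prim1 k) z0.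
  by exists (torus_char (a2 m) t * e 0 m) => //; rewrite img.
case: (eqVneq z 0) => [->|z0]; first by exists 0; rewrite // !scale0r f0.
have [|t [tt tE]] := @torus_char_surj (a2 m) (z / e 0 m) (prim2 m).
  by rewrite mulf_neq0 ?invr_eq0.
by exists (torus_char (a1 k) t) => //; rewrite img // tE divfK.
Qed.
End LineCorrespondence.

Lemma neg_c1_opp a b : (forall m, b m = - a m) -> neg_c1 b = - neg_c1 a.
Proof.
by move=> E; rewrite /neg_c1 -sumrN; apply: eq_bigr => m _; rewrite E mulrNz.
Qed.

Lemma neg_c1_ext a b : (forall m, b m = a m) -> neg_c1 b = neg_c1 a.
Proof. by move=> E; apply: eq_bigr => m _; rewrite E. Qed.

Lemma neg_c1_inj a b : neg_c1 a = neg_c1 b -> forall m, a m = b m.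
Proof.
have E c m : mcoeff (mnm1 m) (neg_c1 c) = c m.
  rewrite /neg_c1 raddf_sum (bigD1 m) //= raddfMz /= mcoeffXU eqxx big1 ?addr0 => [|j jm].
    by rewrite intz.
  by rewrite raddfMz /= mcoeffXU (negbTE jm) mul0rz.
by move=> e m; rewrite -!E e.
Qed.
End Characters.

(** * Independence of the graph from the paving *)

Section GraphUniqueness.
Variables (C : numClosedFieldType) (n l : nat) (X : set (Fl C n)) (Xf : nat -> set (Fl C n)).

Lemma filtration_mono (D : paving_data C n l) k k' : good_affine_paving X Xf D ->
  (k <= k' <= l)%N -> Xf k `<=` Xf k'.
Proof.
move=> [[_ _ _ mono _] _] /andP[kk' k'l].
have [d E] : exists d, k' = (k + d)%N by exists (k' - k)%N; lia.
rewrite {}E {kk'} in k'l *; elim: d k'l => [|d IH] kdl; first by rewrite addn0.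
rewrite addnS in kdl *; apply: (@subset_trans _ (Xf (k + d)%N)); last exact: mono.
by apply: IH; exact: ltnW.
Qed.

Lemma strata_disjoint (D : paving_data C n l) F i j : good_affine_paving X Xf D ->
  stratum Xf i F -> stratum Xf j F -> i = j :> 'I_l.
Proof.
move=> gD [Fi nFi] [Fj nFj]; apply/val_inj; case: (ltngtP i j) => // [ij|ji].
  by case: nFj; apply: (filtration_mono gD) Fi; rewrite ij ltnW.
by case: nFi; apply: (filtration_mono gD) Fj; rewrite ji ltnW.
Qed.

Lemma fixpt_stratum (D : paving_data C n l) i : good_affine_paving X Xf D ->
  stratum Xf i (fixpt D i).
Proof.
move=> [_ /(_ i) [e _ _ _ _]].
by have : [set fixpt D i] (fixpt D i) by []; rewrite -e => -[].
Qed.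

Lemma fixpt_unique (D D' : paving_data C n l) : good_affine_paving X Xf D ->
  good_affine_paving X Xf D' -> fixpt D =1 fixpt D'.
Proof.
move=> [_ g] [_ g'] i; have [e _ _ _ _] := g i; have [e' _ _ _ _] := g' i.
have : [set fixpt D' i] (fixpt D i) by rewrite -e' e.
by [].
Qed.

(** The transition map between the two parametrizations of a stratum is an
    equivariant bijection, so it matches the coordinate lines.  The fixed point
    added by the closure of a line is not on it, being in an earlier stratum;
    so the end points of matching lines agree. *)
Lemma paving_edges (D D' : paving_data C n l) i j : good_affine_paving X Xf D ->
  good_affine_paving X Xf D' -> j \in idx D i ->
  j \in idx D' i /\ ((forall m, weight D' i j m = weight D i j m) \/
                     (forall m, weight D' i j m = - weight D i j m)).
Proof.
move=> gD gD' ji; have fixE := fixpt_unique gD gD'.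
have [_ lt [phi [[psi [K1 K2 _ _]] equiv lines]] _ prim] := gD.2 i.
have [_ lt' [phi' [[psi' [K1' K2' _ _]] equiv' lines']] dist' prim'] := gD'.2 i.
pose k := enum_rank_in ji j; have kE : enum_val k = j by rewrite enum_rankK_in.
have [||||| m [wm lm]] := @line_correspondence C n _ _ (fun k => weight D i (enum_val k))
    (fun k => weight D' i (enum_val k)) (psi' \o phi) _ _ _ _ _ k.
- by move=> x; apply: prim; exact: enum_valP.
- by move=> x; apply: prim'; exact: enum_valP.
- move=> x y xy; have [||| d1 d2] := dist' (enum_val x) (enum_val y); try exact: enum_valP.
    by rewrite (inj_eq enum_val_inj).
  by split=> E; [case/eqP: d1; exact: neg_c1_ext|case/eqP: d2; exact: neg_c1_opp].
- apply: (can_inj (g := psi \o phi')) => v /=.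
  by rewrite K2' K1.
- move=> t v tt; apply: (can_inj K1'); apply: val_inj => /=.
  rewrite K2' (equiv t v tt); have := equiv' t (psi' (phi v)) tt.
  by rewrite /torus_act /rep_act => ->; rewrite K2'.
have linesE : coord_line phi k = coord_line phi' m.
  rewrite predeqE => F; split=> -[z _ <-].
    have : [set (psi' \o phi) (z *: delta_mx 0 k) | z in setT]
      ((psi' \o phi) (z *: delta_mx 0 k)) by exists z.
    rewrite lm => -[y _ e]; exists y => //; rewrite e /= K2' //.
  have : [set z *: delta_mx 0 m | z in setT] (z *: delta_mx 0 m : 'rV[C]_#|idx D' i|) by exists z.
  by rewrite -lm => -[y _ e]; exists y => //; rewrite -e /= K2'.
have [cl _] := lines k; have [cl' _] := lines' m.
have pE : fixpt D j = fixpt D' (enum_val m).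
  have : (coord_line phi k `|` [set fixpt D (enum_val k)]) (fixpt D j) by right; rewrite kE.
  rewrite -cl linesE cl' => -[|//].
  rewrite -linesE => -[z _ e]; have := set_valP (phi (z *: delta_mx 0 k)); rewrite e.
  move=> st; have := strata_disjoint gD st (fixpt_stratum j gD) => ij.
  by have h := lt j ji; exfalso; move: h; rewrite ij ltnn.
have jE : j = enum_val m.
  apply: (strata_disjoint gD (fixpt_stratum j gD)).
  by rewrite pE; exact: fixpt_stratum gD'.
split; first by rewrite jE; exact: enum_valP.
by move: wm; rewrite -jE kE.
Qed.

Lemma GKM_graph_sub (D D' : paving_data C n l) : good_affine_paving X Xf D ->
  good_affine_paving X Xf D' ->
  forall x y f, edge (GKM_graph X D) x y f -> edge (GKM_graph X D') x y f.
Proof.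
move=> gD gD' x y f [i [j [ji xy fE]]]; have [ji' wE] := paving_edges gD gD' ji.
exists i, j; split=> //; first by rewrite -!(fixpt_unique gD gD').
case: wE => wE.
  by rewrite (neg_c1_ext wE).
by rewrite (neg_c1_opp wE) opprK; case: fE; [right|left].
Qed.

Lemma GKM_graph_unique (D D' : paving_data C n l) : good_affine_paving X Xf D ->
  good_affine_paving X Xf D' -> GKM_graph X D = GKM_graph X D'.
Proof.
move=> gD gD'; congr LabelledGraph; apply/funext => x; apply/funext => y.
by rewrite predeqE => f; split; [exact: (GKM_graph_sub gD gD')|exact: (GKM_graph_sub gD' gD)].
Qed.
End GraphUniqueness.

(** * The paving by noncrossing cells *)

Section NCPaving.
Variables (C : numClosedFieldType) (n : nat) (n_gt0 : (0 < n)%N).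
Variables (w : 'I_#|NC n| -> 'S_n).
Hypotheses (w_inj : injective w) (w_NC : forall i, w i \in NC n)
  (w_bruhat : forall i j, bruhat (w i) (w j) -> (i <= j)%N).

Lemma NC_enumerated v : v \in NC n -> exists i, v = w i.
Proof.
move=> vNC; have im : [set w i | i : 'I_#|NC n|]%SET = NC n.
  apply/eqP; rewrite eqEcard card_imset // card_ord leqnn andbT.
  by apply/fintype.subsetP => _ /imsetP[i _ ->]; exact: w_NC.
have /imsetP[i _ ->] : v \in [set w i | i : 'I_#|NC n|]%SET by rewrite im.
by exists i.
Qed.

Lemma root_weight_inj (x y z t : 'I_n) : x != y ->
  (forall m, root_weight x y m = root_weight z t m) -> x = z /\ y = t.
Proof.
move=> xy E; split; apply/eqP.
  have := E x; rewrite /root_weight eqxx (negbTE xy).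
  by case: (x == z) => //; case: (x == t).
have := E y; rewrite /root_weight eqxx eq_sym (negbTE xy).
by case: (y == z); case: (y == t).
Qed.

Lemma root_weight_primitive (x y : 'I_n) : x != y -> primitive (root_weight x y).
Proof.
move=> xy; rewrite /primitive (bigD1 x) //= /root_weight eqxx (negbTE xy) subr0.
exact: gcd1n.
Qed.

Lemma tperm_ordered_inj (a b c d : 'I_n) : (a < b)%N -> (c < d)%N ->
  tperm a b = tperm c d -> (a, b) = (c, d).
Proof.
move=> ab cd e; have := congr1 (fun s : 'S_n => s a) e; rewrite /= tpermL.
case: tpermP => [-> ->//|ad bc|_ _ ba]; first by move: ab cd; rewrite ad bc; lia.
by move: ab; rewrite ba ltnn.
Qed.

Definition lower_cover (i j : 'I_#|NC n|) : pred ('I_n * 'I_n) :=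
  fun p => (p \in NC_inversions (w i)) && (w j == tperm p.1 p.2 * w i)%g.

(** At most one pair qualifies; the default is returned when there is none. *)
Definition cover_pair i j : 'I_n * 'I_n :=
  odflt (Ordinal n_gt0, Ordinal n_gt0) [pick p | lower_cover i j p].

(** The coordinate line of the free position of [(a, b)] has weight
    [t_(w b) - t_(w a)] and ends at the fixed point of [w (a b)]. *)
Definition NC_paving : paving_data C n #|NC n| := {|
  fixpt := fun i => perm_flag C (w i);
  idx := fun i => finset (fun j => [exists p, lower_cover i j p]);
  weight := fun i j => root_weight (w i (cover_pair i j).2) (w i (cover_pair i j).1) |}.

Lemma cover_pairP i j : j \in idx NC_paving i -> lower_cover i j (cover_pair i j).
Proof.
rewrite inE => /existsP[p Pp]; rewrite /cover_pair.
by case: pickP => [//|/(_ p)]; rewrite Pp.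
Qed.

Lemma lower_cover_lt i j p : lower_cover i j p ->
  [/\ (p.1 < p.2)%N, (w i p.2 < w i p.1)%N & w j = (tperm p.1 p.2 * w i)%g].
Proof. by case: p => a b /andP[]; rewrite NC_invE => /and3P[? ? _] /eqP. Qed.

Lemma lower_cover_uniq i j p : lower_cover i j p -> cover_pair i j = p.
Proof.
move=> Pp; have ji : j \in idx NC_paving i by rewrite inE; apply/existsP; exists p.
have [h1 _ e1] := lower_cover_lt (cover_pairP ji); have [h2 _ e2] := lower_cover_lt Pp.
rewrite [LHS]surjective_pairing [RHS]surjective_pairing; apply: tperm_ordered_inj => //.
by apply: (mulIg (w i)); rewrite -e1.
Qed.

Definition cover_enum i (k : 'I_#|idx NC_paving i|) := cover_pair i (enum_val k).

Lemma cover_enum_inj i : injective (@cover_enum i).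
Proof.
move=> k k' e; apply/enum_val_inj/w_inj.
have [_ _ ->] := lower_cover_lt (cover_pairP (enum_valP k)).
have [_ _ ->] := lower_cover_lt (cover_pairP (enum_valP k')).
by move: e; rewrite /cover_enum => ->.
Qed.

Lemma cover_enumP i x : reflect (exists k, @cover_enum i k = x) (x \in NC_inversions (w i)).
Proof.
apply: (iffP idP) => [xi|[k <-]]; last first.
  by have /andP[] := cover_pairP (enum_valP k).
have [j jE] : exists j, (tperm x.1 x.2 * w i)%g = w j.
  apply: NC_enumerated; by move: xi; case: x => a b; rewrite NC_invE => /and3P[].
have cx : lower_cover i j x by rewrite /lower_cover xi -jE eqxx.
have ji : j \in idx NC_paving i by rewrite inE; apply/existsP; exists x.
exists (enum_rank_in ji j); rewrite /cover_enum enum_rankK_in //.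
exact: lower_cover_uniq.
Qed.

Lemma NC_stratum (i : 'I_#|NC n|) : stratum (@NC_filtration C n w) i = NC_cell (w i).
Proof.
rewrite predeqE => F; split=> [[[j /= ji Fj] nF]|Fi].
  move: ji; rewrite ltnS leq_eqVlt => /orP[/eqP/val_inj <- //|ji].
  by case: nF; exists j.
split; first by exists i => /=.
by move=> [j /= ji /(NC_cell_disjoint Fi)/w_inj ij]; move: ji; rewrite ij ltnn.
Qed.

(** The order of the cells extends the Bruhat order, so the closed sets that bound
    the first [k] cells do not leave their union. *)
Lemma NC_filtration_closed k :
  zclosed (X := Fl_variety C n) (NC_filtration w k).
Proof.
have /choice [Y YP] : forall i, exists Y : set (Fl C n), [/\ zclosed (X := Fl_variety C n) Y,
    NC_cell (w i) `<=` Y &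
    forall F, Y F -> exists v, [/\ v \in NC n, bruhat v (w i) & NC_cell v F]].
  by move=> i; exact: NC_cell_closure.
rewrite (_ : NC_filtration w k = \bigcup_(i in [set i : 'I_#|NC n| | (i < k)%N]) Y i).
  apply: (@zclosedU C n 'I_#|NC n| [set i : 'I_#|NC n| | (i < k)%N] Y
    [seq i : 'I_#|NC n| <- enum 'I_#|NC n| | (i < k)%N]).
    by move=> i; rewrite mem_filter mem_enum andbT.
  by move=> i _; have [] := YP i.
rewrite predeqE => F; split=> -[i ik Fi]; have [_ sub Yi] := YP i.
  by exists i => //; exact: sub.
have [v [vNC vi Fv]] := Yi F Fi; have [j jE] := NC_enumerated vNC.
exists j; last by rewrite -jE.
by apply: leq_ltn_trans ik; apply: w_bruhat; rewrite -jE.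
Qed.

Lemma NC_filtration_QFl : NC_filtration w #|NC n| = QFl C n.
Proof.
rewrite QFl_cells // predeqE => F; split=> [[i _ Fi]|[v /= vNC Fv]].
  by exists (w i) => //=.
by have [i e] := NC_enumerated vNC; exists i => //=; rewrite -e.
Qed.

Lemma NC_good_cell i : good_cell (NC_filtration w) NC_paving i.
Proof.
have lt j : j \in idx NC_paving i -> (j < i)%N.
  move=> /cover_pairP /lower_cover_lt [h1 h2 e].
  have := bruhat_tperm_inv h1 h2; rewrite -e => /w_bruhat; rewrite leq_eqVlt.
  case/orP => // /eqP/val_inj ji; have := congr1 (fun s : 'S_n => s (cover_pair i j).1) e.
  by rewrite ji /= tpermMl eqxx => /perm_inj e'; move: h1; rewrite ji -{1}e' ltnn.
have inj := @cover_enum_inj i; have prP := @cover_enumP i.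
have SE := NC_stratum i.
split=> //.
- by rewrite SE; exact: cell_fixed inj prP.
- exists (cell_param prP SE); split.
  + by have iso := cell_param_isomorphism inj prP SE; exact: iso.
  + by move=> t v tt; exact: (cell_equivariant inj prP v tt).
  + move=> k; set p := cover_enum k.
    have [ab _ e] := lower_cover_lt (cover_pairP (enum_valP k)).
    have -> : coord_line (cell_param prP SE) k = range (line_point ab (w i) : C -> Fl C n).
      rewrite predeqE => F; split=> -[z _ <-]; exists z => //=;
        congr flag_of; apply: GL_inj; by rewrite /= cellmx_line.
    rewrite /= e; split; first exact: zclosure_line.
    exact: line_homeomorphic.
- move=> j k ji ki jk.
  have [h1 g1 e1] := lower_cover_lt (cover_pairP ji).
  have [h2 g2 e2] := lower_cover_lt (cover_pairP ki).
  have pne (p : 'I_n * 'I_n) : (p.1 < p.2)%N -> w i p.2 != w i p.1.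
    by move=> p12; rewrite (inj_eq perm_inj) -val_eqE /= gtn_eqF.
  split; apply: contra jk => /eqP.
    move=> /neg_c1_inj /(root_weight_inj (pne _ h1)) [/perm_inj E2 /perm_inj E1].
    by apply/eqP/w_inj; rewrite e1 e2 E1 E2.
  rewrite -(@neg_c1_opp _ (weight NC_paving i k)
    (root_weight (w i (cover_pair i k).1) (w i (cover_pair i k).2))).
    move=> /neg_c1_inj /(root_weight_inj (pne _ h1)) [/perm_inj E2 /perm_inj E1].
    by move: h1 h2; rewrite E1 E2; lia.
  by move=> m; rewrite /= /root_weight opprB.
- move=> j ji; apply: root_weight_primitive.
  have [h1 _ _] := lower_cover_lt (cover_pairP ji).
  by rewrite (inj_eq perm_inj) -val_eqE /= gtn_eqF.
Qed.

Lemma NC_good_paving : good_affine_paving (QFl C n) (@NC_filtration C n w) NC_paving.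
Proof.
split; last exact: NC_good_cell.
split.
- rewrite -NC_filtration_QFl => t F tt [i il Fi]; exists i => //.
  move: Fi; have inj := @cover_enum_inj i; have prP := @cover_enumP i.
  rewrite (NC_cellE C inj prP) => -[v _ <-].
  rewrite -(cell_equivariant inj prP v tt).
  by exists (cell_act (w i) (@cover_enum i) t v).
- by rewrite predeqE => F; split=> // -[].
- exact: NC_filtration_QFl.
- by move=> k _ F [i /= ik Fi]; exists i => //=; exact: ltnW.
- by move=> k _; exact: NC_filtration_closed.
Qed.

Lemma neg_c1_root (x y : 'I_n) : x != y ->
  neg_c1 (root_weight x y) = mpolyX int (mnm1 x) - mpolyX int (mnm1 y).
Proof.
move=> xy; rewrite /neg_c1 (bigD1 x) //= (bigD1 y) 1?eq_sym //= big1 ?addr0.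
  by rewrite /root_weight !eqxx (negbTE xy) eq_sym (negbTE xy) subr0 sub0r mulrNz.
by move=> m /andP[mx my]; rewrite /root_weight (negbTE mx) (negbTE my) subrr mulr0z.
Qed.

Lemma lower_cover_edge i j (a b : 'I_n) f (x y : Fl C n) : (a < b)%N -> (w i b < w i a)%N ->
  w j = (tperm a b * w i)%g ->
  (x = perm_flag C (w i) /\ y = perm_flag C (w j)) \/ (x = perm_flag C (w j) /\ y = perm_flag C (w i)) ->
  (let e := mpolyX int (mnm1 (w i b)) - mpolyX int (mnm1 (w i a)) in f = e \/ f = - e) ->
  edge (GKM_graph (QFl C n) NC_paving) x y f.
Proof.
move=> ab wab wj xy fE; have cov : lower_cover i j (a, b).
  by rewrite /lower_cover NC_invE ab wab -wj w_NC eqxx.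
exists i, j; split=> //; first by rewrite inE; apply/existsP; exists (a, b).
rewrite /= (lower_cover_uniq cov) /= neg_c1_root //.
by rewrite (inj_eq perm_inj) -val_eqE /= gtn_eqF.
Qed.

(** Of two adjacent elements one is the longer; the edge is a coordinate line of
    its cell.  Passing from positions to values turns [w (a b)] into
    [(w a  w b) w]. *)
Lemma NC_paving_graph :
  GKM_graph (QFl C n) NC_paving = map_graph (@perm_flag C n) (Cayley_NC n).
Proof.
have fx i : @T_fixed C n (perm_flag C (w i)) /\ NC_cell (w i) (perm_flag C (w i)).
  have := cell_fixed C (@cover_enum_inj i) (@cover_enumP i).
  by rewrite predeqE => /(_ (perm_flag C (w i))) [_ /(_ erefl)] [].
congr LabelledGraph; rewrite ?predeqE.
  move=> F; split=> [[QF TF]|[v /= vNC <-]].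
    move: QF; rewrite QFl_cells // => -[v /= vNC Fv]; have [i e] := NC_enumerated vNC.
    exists v => //; rewrite e in Fv *.
    have := cell_fixed C (@cover_enum_inj i) (@cover_enumP i).
    by rewrite predeqE => /(_ F) [/(_ (conj Fv TF)) ->].
  have [i ->] := NC_enumerated vNC; split; last exact: (fx i).1.
  rewrite QFl_cells //; exists (w i); [exact: w_NC|exact: (fx i).2].
apply/funext => x; apply/funext => y; rewrite predeqE => f; split.
  move=> [i [j [ji xy fE]]]; have [h1 _ e] := lower_cover_lt (cover_pairP ji).
  rewrite /= in fE; set p := cover_pair i j in h1 e fE *.
  have p12 : w i p.2 != w i p.1 by rewrite (inj_eq perm_inj) -val_eqE /= gtn_eqF.
  rewrite neg_c1_root // in fE.
  have wj : w j = (w i * tperm (w i p.1) (w i p.2))%g by rewrite e conjgC tpermJ.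
  case: xy => -[-> ->].
    exists (w i), (w j); split=> //; split; [exact: w_NC|exact: w_NC|].
    by exists (w i p.1), (w i p.2); split=> //; rewrite 1?eq_sym.
  exists (w j), (w i); split=> //; split; [exact: w_NC|exact: w_NC|].
  exists (w i p.1), (w i p.2); split=> //; rewrite 1?eq_sym //.
  by rewrite wj -mulgA tperm2 mulg1.
move=> [u [v [-> -> [uNC vNC [a [b [ab vE fE]]]]]]].
have [i ui] := NC_enumerated uNC; have [j vj] := NC_enumerated vNC; rewrite ui vj in vE *.
have [a' [b' [ab' wj {}fE]]] : exists a' b' : 'I_n, [/\ (a' < b')%N, w j = (tperm a' b' * w i)%g &
    let e := mpolyX int (mnm1 (w i b')) - mpolyX int (mnm1 (w i a')) in f = e \/ f = - e].
  have E : w j = (tperm ((w i)^-1 a) ((w i)^-1 b) * w i)%g by rewrite vE [RHS]conjgC tpermJ !permKV.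
  case: (ltngtP ((w i)^-1%g a) ((w i)^-1%g b)) => [lt|lt|/val_inj/perm_inj e].
  - by exists ((w i)^-1%g a), ((w i)^-1%g b); rewrite !permKV.
  - exists ((w i)^-1%g b), ((w i)^-1%g a); rewrite !permKV tpermC; split=> //=.
    by rewrite opprB; case: fE => fE; [right; rewrite fE|left; rewrite fE opprB].
  - by rewrite e eqxx in ab.
case: (ltngtP (w i b') (w i a')) => [lt|lt|/val_inj/perm_inj e].
- by apply: (lower_cover_edge ab' lt wj _ fE); left.
- have wjb : w j b' = w i a' by rewrite wj tpermMl eqxx; case: eqP => // ->.
  have wja : w j a' = w i b' by rewrite wj tpermMl eqxx.
  apply: (@lower_cover_edge j i a' b') => //; first by rewrite wja wjb.
  + by rewrite wj mulgA tperm2 mul1g.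
  + by right.
  + rewrite wja wjb /= opprB; case: fE => /= fE; [right|left]; rewrite fE ?opprB //.
- by move: ab'; rewrite e ltnn.
Qed.
End NCPaving.

Theorem theorem11p2 (R : realType) (n : nat) (n_gt0 : (0 < n)%N)
    (w : 'I_#|NC n| -> 'S_n) (w_inj : injective w)
    (w_NC : forall i, w i \in NC n)
    (w_bruhat : forall i j, bruhat (w i) (w j) -> (i <= j)%N) :
  (exists D : paving_data R[i] n #|NC n|,
     good_affine_paving (QFl R[i] n) (NC_filtration w) D) /\
  (forall D : paving_data R[i] n #|NC n|,
     good_affine_paving (QFl R[i] n) (NC_filtration w) D ->
     GKM_graph (QFl R[i] n) D = map_graph (@perm_flag R[i] n) (Cayley_NC n)).
Proof.
have good := @NC_good_paving R[i] n n_gt0 w w_inj w_NC w_bruhat.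
split; first by exists (NC_paving R[i] n_gt0 w).
move=> D gD; rewrite (GKM_graph_unique gD good).
exact: NC_paving_graph.
Qed.
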